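(* Let $R$ and $R'$ be rings with involution such that $(4k+2)$-dimensional symmetric forms over $R$, respectively over $R'$, necessarily have even rank (e.g. group rings). Let $(C,\phi^C)$ be a symmetric Poincaré complex over $R$ and $(D,\phi^D)$ a symmetric Poincaré complex over $R'$. Then $$\tau^{NEW}(C\otimes D,\phi^C\otimes\phi^D)=\chi(D)\,\tau^{NEW}(C,\phi^C)+\chi(C)\,\tau^{NEW}(D,\phi^D)\in K_1(R\otimes R'),$$ where the torsions on the right are mapped to $K_1(R\otimes R')$ by the maps induced by $R\to R\otimes R'$ and $R'\to R\otimes R'$.
   Context: All rings ($R$, $R'$, $R\otimes R'$, the tensor product over $\mathbb{Z}$) are associative with $1$ and involution and such that the rank of f.g. free modules is well defined. For such a ring (written $R$ here) all modules are based f.g. free; the dual $M^*=\mathrm{Hom}_R(M,R)$ is based via the involution and dual basis, $M^{**}=M$. An isomorphism $f$ of based modules has torsion $\tau(f)\in K_1(R)$ (the class of its matrix), and $\tau(f)^*=\tau(f^* )$. $\epsilon(M,N)=\mathrm{rank}(M)\mathrm{rank}(N)\tau(-1)\in K_1(R)$, and $\epsilon(a,b)=ab\,\tau(-1)$ for integers. A $(4k+2)$-dimensional symmetric form over $R$ is a based f.g. free module $M$ with an isomorphism $\phi_0:M^*\to M$ such that $\phi_0^*=-\phi_0$, i.e. a $(4k+2)$-dimensional symmetric Poincaré complex (defined below) whose chain complex is $M$ concentrated in degree $2k+1$; its rank is the rank of $M$. Chain complexes are bounded complexes of based f.g. free modules, in degrees $0,\dots,n$ if $n$-dimensional. $\chi(C)=\sum_r(-1)^r\mathrm{rank}\,C_r$,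 $(SC)_r=C_{r-1}$, $C_{odd}=\bigoplus C_{2r+1}$, $C_{even}=\bigoplus C_{2r}$, $\beta(C,D)=\sum_{i>j}(\epsilon(C_{2i},D_{2j})-\epsilon(C_{2i+1},D_{2j+1}))$. A signed complex is $(C,\eta_C)$ with $\eta_C\in\{0,\tau(-1)\}$; $\eta_{SC}=-\eta_C$, $\eta_{C\oplus D}=\eta_C+\eta_D-\beta(C,D)+\epsilon(C_{odd},\chi(D))$. For a contractible signed complex with chain contraction $\Gamma$, $\tau^{NEW}(C)=\tau(d+\Gamma:C_{odd}\to C_{even})+\eta_C$. The mapping cone of $f:C\to D$ is $\mathcal{C}(f)_r=D_r\oplus C_{r-1}$, $d=\begin{pmatrix}d_D&(-1)^{r+1}f\\0&d_C\end{pmatrix}$, $\eta_{\mathcal{C}(f)}=\eta_{D\oplus SC}$; for a chain equivalence, $\tau^{NEW}(f)=\tau^{NEW}(\mathcal{C}(f))$. With $C^r=(C_r)^*$, the dual complex $C^{n-*}$ has $(C^{n-*})_r=C^{n-r}$, $d=(-1)^rd_C^*:C^{n-r}\to C^{n-r+1}$, and sign $\eta_{C^{n-*}}=(-1)^{n+1}\eta_C^*+(-1)^{n+1}\beta(C,C)^*+\sum_{r\equiv n+2,n+3\,(\mathrm{mod}\,4)}\epsilon(C^r,C^r)$. $T\phi=(-1)^{pq}\phi^*:D^q\to C_p$ for $\phi:C^p\to D_q$. An $n$-dimensional symmetric complex $(C,\phi)$ is an $n$-dimensional complex $C$ with morphisms $\phi_s:C^{n-r+s}\to C_r$ ($s\ge0$)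 such that $d\phi_s+(-1)^r\phi_sd^*+(-1)^{n+s+1}(\phi_{s-1}+(-1)^sT\phi_{s-1})=0:C^{n-r+s-1}\to C_r$ ($\phi_{-1}=0$). So $\phi_0:C^{n-*}\to C$ is a chain map, chain homotopic to $T\phi_0$. It is Poincaré if $\phi_0$ is a chain equivalence. Its absolute torsion is $\tau^{NEW}(C,\phi)=\tau^{NEW}(\phi_0:C^{n-*}\to C)\in K_1(R)$, which is independent of the choice of sign $\eta_C$. Tensor product: for $C$ over $R$ and $D$ over $R'$, $(C\otimes D)_r=\bigoplus_sC_s\otimes D_{r-s}$ with $d(x\otimes y)=x\otimes d_D(y)+(-1)^{r-s}d_C(x)\otimes y$ for $x\in C_s$, $y\in D_{r-s}$. For $(C,\phi)$ of dimension $n$ and $(D,\theta)$ of dimension $m$, $(C\otimes D,\phi\otimes\theta)$ is the $(n+m)$-dimensional symmetric Poincaré complex over $R\otimes R'$ with $(\phi\otimes\theta)_s=\sum_{r=0}^s(-1)^{(n+r)s}\phi_r\otimes T\theta_{s-r}$. Only the component $(\phi\otimes\theta)_0=\phi_0\otimes T\theta_0:(C\otimes D)^{n+m-*}\to C\otimes D$ enters $\tau^{NEW}$; it is formed using the chain isomorphism $(C\otimes D)^{n+m-*}\cong C^{n-*}\otimes D^{m-*}$ which is multiplication by $(-1)^{(n-p)q}$ on $C^p\otimes D^q$. *)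

(* Defs.v *)
From HB Require Import structures.
From mathcomp Require Import all_boot all_order all_algebra.
From mathcomp Require Import boolp classical_sets.
From mathcomp Require Import mxtens.

Set Implicit Arguments.
Unset Strict Implicit.
Unset Printing Implicit Defensive.

Import Order.TTheory GRing.Theory Num.Theory.
Local Open Scope ring_scope.

(* Rings are not assumed nontrivial ([pzRingType]), since a tensor product of
   nonzero rings may vanish; [rank_well_defined] below excludes the zero ring. *)
HB.mixin Record PzRing_hasInvolution R of GRing.PzRing R := {
  invol : R -> R;
  involD : {morph invol : x y / x + y};
  involM : forall x y, invol (x * y) = invol y * invol x;
  involK : involutive invol
}.

#[short(type="invRingType")]
HB.structure Definition InvRing := {R of GRing.PzRing R & PzRing_hasInvolution R}.

Lemma invol1 (R : invRingType) : invol (1 : R) = 1.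
Proof. by rewrite -[LHS]mulr1 -{2}(involK 1) -involM mulr1 involK. Qed.

Lemma invol0 (R : invRingType) : invol (0 : R) = 0.
Proof. by apply: (addrI (invol 0)); rewrite -involD !addr0. Qed.

Lemma involN (R : invRingType) : {morph @invol R : x / - x}.
Proof. by move=> x; apply: (addrI (invol x)); rewrite -involD !subrr invol0. Qed.

Section TensorRing.
Local Open Scope quotient_scope.
Variables R S : pzRingType.

(* The tensor product over Z: a sequence [:: (r_1, s_1); ...] stands for the
   formal sum of the r_i (x) s_i, and two formal sums are identified when all
   biadditive maps to abelian groups agree on them; see [tensor_generated] and
   [tensor_universal].  Signs are absorbed by - (r (x) s) = (- r) (x) s. *)
Definition biadditive (A : zmodType) (f : R -> S -> A) :=
  (forall x y s, f (x + y) s = f x s + f y s) /\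
  (forall x s t, f x (s + t) = f x s + f x t).

Definition tsum_eval (A : zmodType) (f : R -> S -> A) (u : seq (R * S)) : A :=
  \sum_(p <- u) f p.1 p.2.

Definition tsum_eq (u v : seq (R * S)) : bool :=
  `[< forall (A : zmodType) (f : R -> S -> A),
        biadditive f -> tsum_eval f u = tsum_eval f v >].

Lemma tsum_eq_refl : reflexive tsum_eq.
Proof. by move=> u; apply/asboolP. Qed.

Lemma tsum_eq_sym : symmetric tsum_eq.
Proof.
by move=> u v; apply/asboolP/asboolP => uv A f fP; rewrite uv.
Qed.

Lemma tsum_eq_trans : transitive tsum_eq.
Proof.
move=> v u w /asboolP uv /asboolP vw; apply/asboolP => A f fP.
by rewrite uv // vw.
Qed.

Canonical tsum_equiv := EquivRel tsum_eq tsum_eq_refl tsum_eq_sym tsum_eq_trans.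

Definition tensor_ring := {eq_quot tsum_equiv}.
HB.instance Definition _ := Choice.on tensor_ring.
HB.instance Definition _ := EqQuotient.on tensor_ring.

Local Notation T := tensor_ring.
Local Notation class := (\pi_tensor_ring).

Lemma tsum_piP u v :
  (forall (A : zmodType) (f : R -> S -> A),
     biadditive f -> tsum_eval f u = tsum_eval f v) <-> class u = class v.
Proof. by split=> [uv|/eqmodP/asboolP]; [apply/eqmodP/asboolP|]. Qed.

Definition tens (r : R) (s : S) : T := class [:: (r, s)].

Definition tsum_opp (u : seq (R * S)) := [seq (- p.1, p.2) | p <- u].
Definition tsum_mul (u v : seq (R * S)) :=
  [seq (p.1 * q.1, p.2 * q.2) | p <- u, q <- v].

Lemma biadd_sum0 (A : zmodType) (f : R -> S -> A) : biadditive f ->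
  (forall s, f 0 s = 0) * (forall r, f r 0 = 0).
Proof.
move=> [fl fr]; split=> x.
  by apply: (addrI (f 0 x)); rewrite -fl !addr0.
by apply: (addrI (f x 0)); rewrite -fr !addr0.
Qed.

Lemma biaddN (A : zmodType) (f : R -> S -> A) r s :
  biadditive f -> f (- r) s = - f r s.
Proof.
move=> fP; apply: (addrI (f r s)).
by rewrite -(fP.1) !subrr (biadd_sum0 fP).
Qed.

Lemma tsum_eval_cat A f u v :
  @tsum_eval A f (u ++ v) = tsum_eval f u + tsum_eval f v.
Proof. by rewrite /tsum_eval big_cat. Qed.

Lemma tsum_eval_opp A f u : biadditive f ->
  @tsum_eval A f (tsum_opp u) = - tsum_eval f u.
Proof.
move=> fP; rewrite /tsum_eval big_map -sumrN; apply: eq_bigr => p _.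
exact: biaddN.
Qed.

Lemma tsum_eval_mul A f u v :
  @tsum_eval A f (tsum_mul u v) =
  tsum_eval (fun x y => tsum_eval (fun x' y' => f (x * x') (y * y')) v) u.
Proof. by rewrite /tsum_eval big_allpairs_dep. Qed.

Lemma tsum_eval_mulr A f u v :
  @tsum_eval A f (tsum_mul u v) =
  tsum_eval (fun x' y' => tsum_eval (fun x y => f (x * x') (y * y')) u) v.
Proof. by rewrite /tsum_eval big_allpairs_dep exchange_big. Qed.

Lemma biadd_mull (A : zmodType) (f : R -> S -> A) v : biadditive f ->
  biadditive (fun x y => tsum_eval (fun x' y' => f (x * x') (y * y')) v).
Proof.
move=> fP; split=> *; rewrite /tsum_eval -big_split; apply: eq_bigr => p _ /=.
  by rewrite mulrDl fP.1.
by rewrite mulrDl fP.2.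
Qed.

Lemma biadd_mulr (A : zmodType) (f : R -> S -> A) u : biadditive f ->
  biadditive (fun x' y' => tsum_eval (fun x y => f (x * x') (y * y')) u).
Proof.
move=> fP; split=> *; rewrite /tsum_eval -big_split; apply: eq_bigr => p _ /=.
  by rewrite mulrDr fP.1.
by rewrite mulrDr fP.2.
Qed.

Definition tadd (x y : T) : T := class (repr x ++ repr y).
Definition topp (x : T) : T := class (tsum_opp (repr x)).
Definition tmul (x y : T) : T := class (tsum_mul (repr x) (repr y)).

Lemma tsum_repr (A : zmodType) (f : R -> S -> A) u : biadditive f ->
  tsum_eval f (repr (class u)) = tsum_eval f u.
Proof. by move: A f; apply/tsum_piP; rewrite reprK. Qed.

Lemma tadd_pi u v : tadd (class u) (class v) = class (u ++ v).
Proof. by apply/tsum_piP => A f fP; rewrite !tsum_eval_cat !tsum_repr. Qed.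

Lemma topp_pi u : topp (class u) = class (tsum_opp u).
Proof. by apply/tsum_piP => A f fP; rewrite !tsum_eval_opp ?tsum_repr. Qed.

Lemma tmul_pi u v : tmul (class u) (class v) = class (tsum_mul u v).
Proof.
apply/tsum_piP => A f fP.
rewrite tsum_eval_mul tsum_repr; last exact: biadd_mull.
rewrite -tsum_eval_mul tsum_eval_mulr tsum_repr; last exact: biadd_mulr.
by rewrite -tsum_eval_mulr.
Qed.

Lemma tensW (P : T -> Prop) : (forall u, P (class u)) -> forall x, P x.
Proof. by move=> Pu x; rewrite -[x]reprK. Qed.

Lemma taddA : associative tadd.
Proof.
elim/tensW => u; elim/tensW => v; elim/tensW => w.
by rewrite !tadd_pi catA.
Qed.

Lemma taddC : commutative tadd.
Proof.
elim/tensW => u; elim/tensW => v; rewrite !tadd_pi.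
by apply/tsum_piP => A f fP; rewrite !tsum_eval_cat addrC.
Qed.

Lemma tadd0 : left_id (class [::]) tadd.
Proof. by elim/tensW => u; rewrite tadd_pi. Qed.

Lemma taddN : left_inverse (class [::]) topp tadd.
Proof.
elim/tensW => u; rewrite topp_pi tadd_pi; apply/tsum_piP => A f fP.
by rewrite tsum_eval_cat tsum_eval_opp // addNr /tsum_eval big_nil.
Qed.

HB.instance Definition _ := GRing.isZmodule.Build T taddA taddC tadd0 taddN.

Lemma tmulA : associative tmul.
Proof.
elim/tensW => u; elim/tensW => v; elim/tensW => w; rewrite !tmul_pi.
apply/tsum_piP => A f fP; rewrite !tsum_eval_mul.
apply: eq_bigr => p _; rewrite tsum_eval_mul; apply: eq_bigr => q _.
by apply: eq_bigr => r _; rewrite !mulrA.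
Qed.

Lemma tmul1 : left_id (tens 1 1) tmul.
Proof.
elim/tensW => u; rewrite tmul_pi; apply/tsum_piP => A f fP.
by rewrite tsum_eval_mul {1}/tsum_eval big_seq1; apply: eq_bigr => p _; rewrite !mul1r.
Qed.

Lemma tmulr1 : right_id (tens 1 1) tmul.
Proof.
elim/tensW => u; rewrite tmul_pi; apply/tsum_piP => A f fP.
by rewrite tsum_eval_mulr {1}/tsum_eval big_seq1; apply: eq_bigr => p _; rewrite !mulr1.
Qed.

Lemma tmulDl : left_distributive tmul tadd.
Proof.
elim/tensW => u; elim/tensW => v; elim/tensW => w.
rewrite !(tadd_pi, tmul_pi); apply/tsum_piP => A f fP.
by rewrite tsum_eval_cat !tsum_eval_mul tsum_eval_cat.
Qed.

Lemma tmulDr : right_distributive tmul tadd.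
Proof.
elim/tensW => u; elim/tensW => v; elim/tensW => w.
rewrite !(tadd_pi, tmul_pi); apply/tsum_piP => A f fP.
by rewrite tsum_eval_cat !tsum_eval_mulr tsum_eval_cat.
Qed.

HB.instance Definition _ :=
  GRing.Zmodule_isPzRing.Build T tmulA tmul1 tmulr1 tmulDl tmulDr.

Lemma tensM r s r' s' : tens r s * tens r' s' = tens (r * r') (s * s').
Proof. exact: tmul_pi. Qed.

Lemma tensDl r r' s : tens (r + r') s = tens r s + tens r' s.
Proof.
rewrite [RHS]tadd_pi; apply/tsum_piP => A f fP.
by rewrite /tsum_eval big_cat !big_seq1 fP.1.
Qed.

Lemma tensDr r s s' : tens r (s + s') = tens r s + tens r s'.
Proof.
rewrite [RHS]tadd_pi; apply/tsum_piP => A f fP.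
by rewrite /tsum_eval big_cat !big_seq1 fP.2.
Qed.

Lemma class_cons p u : class (p :: u) = tens p.1 p.2 + class u.
Proof. by case: p => r s; rewrite [RHS]tadd_pi. Qed.

Lemma tensor_generated (x : T) :
  exists u : seq (R * S), x = \sum_(p <- u) tens p.1 p.2.
Proof.
elim/tensW: x => u; exists u; elim: u => [|p u IH]; first by rewrite big_nil.
by rewrite big_cons class_cons IH.
Qed.

Lemma tensor_universal (A : zmodType) (f : R -> S -> A) : biadditive f ->
  exists2 g : T -> A, {morph g : x y / x + y} & forall r s, g (tens r s) = f r s.
Proof.
move=> fP; exists (fun x => tsum_eval f (repr x)).
  elim/tensW => u; elim/tensW => v.
  by rewrite [_ + _]tadd_pi !tsum_repr // tsum_eval_cat.
by move=> r s; rewrite tsum_repr // /tsum_eval big_seq1.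
Qed.

Definition tensl (r : R) : T := tens r 1.
Definition tensr (s : S) : T := tens 1 s.

Lemma tensl_additive : {morph tensl : x y / x - y}.
Proof.
move=> x y; apply: (addIr (tensl y)); rewrite subrK -tensDl subrK //.
Qed.
Lemma tensl_multiplicative : GRing.monoid_morphism tensl.
Proof. by split=> // x y; rewrite tensM mulr1. Qed.
Lemma tensr_additive : {morph tensr : x y / x - y}.
Proof.
move=> x y; apply: (addIr (tensr y)); rewrite subrK -tensDr subrK //.
Qed.
Lemma tensr_multiplicative : GRing.monoid_morphism tensr.
Proof. by split=> // x y; rewrite tensM mulr1. Qed.

HB.instance Definition _ := GRing.isZmodMorphism.Build R T tensl tensl_additive.
HB.instance Definition _ := GRing.isMonoidMorphism.Build R T tensl tensl_multiplicative.
HB.instance Definition _ := GRing.isZmodMorphism.Build S T tensr tensr_additive.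
HB.instance Definition _ := GRing.isMonoidMorphism.Build S T tensr tensr_multiplicative.

End TensorRing.

Section TensorInvolution.
Local Open Scope quotient_scope.
Variables R S : invRingType.
Local Notation T := (tensor_ring R S).

Definition tinvol (x : T) : T :=
  \pi_(tensor_ring R S) [seq (invol p.1, invol p.2) | p <- repr x].

Lemma tinvol_pi u :
  tinvol (\pi u) = \pi_(tensor_ring R S) [seq (invol p.1, invol p.2) | p <- u].
Proof.
apply/tsum_piP => A f [fl fr]; rewrite /tsum_eval !big_map.
rewrite -![\sum_(j <- _) _]/(tsum_eval (fun x y => f (invol x) (invol y)) _).
by rewrite tsum_repr //; split=> *; rewrite involD ?fl ?fr.
Qed.

Lemma tinvolD : {morph tinvol : x y / x + y}.
Proof.
elim/tensW => u; elim/tensW => v.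
by rewrite [u in tinvol u]tadd_pi !tinvol_pi map_cat [RHS]tadd_pi.
Qed.

Lemma tinvolM x y : tinvol (x * y) = tinvol y * tinvol x.
Proof.
elim/tensW: x => u; elim/tensW: y => v.
rewrite [u in tinvol u]tmul_pi !tinvol_pi [RHS]tmul_pi.
apply/tsum_piP => A f fP; rewrite tsum_eval_mulr /tsum_eval !big_map big_allpairs_dep.
apply: eq_bigr => p _; rewrite big_map; apply: eq_bigr => q _ /=.
by rewrite !involM.
Qed.

Lemma tinvolK : involutive tinvol.
Proof.
elim/tensW => u; rewrite (tinvol_pi u) tinvol_pi -map_comp -[in RHS](map_id u).
by congr (\pi_(tensor_ring R S) _); apply: eq_map => -[r s] /=; rewrite !involK.
Qed.

HB.instance Definition _ := PzRing_hasInvolution.Build T tinvolD tinvolM tinvolK.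

Lemma invol_tens (r : R) (s : S) : invol (tens r s) = tens (invol r) (invol s).
Proof. exact: tinvol_pi. Qed.

End TensorInvolution.

Definition mx_inverse (R : pzRingType) n (A B : 'M[R]_n) :=
  A *m B = 1%:M /\ B *m A = 1%:M.

Definition mx_invertible (R : pzRingType) n (A : 'M[R]_n) :=
  exists B, mx_inverse A B.

Section K1.
Local Open Scope quotient_scope.
Variable R : pzRingType.

(* For n <= N this is the block sum of A with the identity of size N - n. *)
Definition stabmx n N (A : 'M[R]_n) : 'M[R]_N :=
  pid_mx n *m A *m pid_mx n + copid_mx n.

(* The commutator subgroup of GL_n(R); it is closed under inverses because the
   inverse of a commutator is a commutator. *)
Inductive comm_prod n : 'M[R]_n -> Prop :=
| comm_prod1 : comm_prod 1%:M
| comm_prodM X X' Y Y' Z : mx_inverse X X' -> mx_inverse Y Y' ->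
    comm_prod Z -> comm_prod (X *m Y *m X' *m Y' *m Z).

(* K_1(R) is GL(R) / [GL(R), GL(R)], written additively, where GL(R) is the
   union of the GL_n(R) under stabilisation. *)
Definition GL := {n : nat & {A : 'M[R]_n | `[< mx_invertible A >]}}.
Definition GLmx (x : GL) : 'M[R]_(tag x) := val (tagged x).

Definition K1_eq (x y : GL) : bool :=
  `[< exists N, [/\ (tag x <= N)%N, (tag y <= N)%N &
        exists2 X, comm_prod X &
          stabmx N (GLmx x) = stabmx N (GLmx y) *m X] >].

Lemma stabmxM n N (A B : 'M[R]_n) : (n <= N)%N ->
  stabmx N A *m stabmx N B = stabmx N (A *m B).
Proof.
move=> le_nN; rewrite /stabmx mulmxDl (mulmxDr (_ *m _)) (mulmxDr (copid_mx n)) -!mulmxA.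
rewrite mul_pid_mx_copid // !mulmx0 addr0.
rewrite !(mulmxA (copid_mx n)) mul_copid_mx_pid // mul0mx add0r copid_mx_id //.
by rewrite (mulmxA (pid_mx n) (pid_mx n)) pid_mx_id // pid_mx_1 mul1mx.
Qed.

Lemma stabmx1 n N : (n <= N)%N -> stabmx N (1%:M : 'M[R]_n) = 1%:M.
Proof.
by move=> le_nN; rewrite /stabmx mulmx1 pid_mx_id // addrC subrK.
Qed.

Lemma stabmx_id n (A : 'M[R]_n) : stabmx n A = A.
Proof.
by rewrite /stabmx /copid_mx pid_mx_1 mul1mx mulmx1 subrr addr0.
Qed.

Lemma stabmx_stab n N K (A : 'M[R]_n) : (n <= N)%N -> (N <= K)%N ->
  stabmx K (stabmx N A) = stabmx K A.
Proof.
move=> le_nN le_NK; rewrite /stabmx mulmxDr mulmxDl !mulmxA mul_pid_mx.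
rewrite -(mulmxA _ (pid_mx n)) mul_pid_mx !(minn_idPr le_nN).
rewrite ?minnn ?(minn_idPl le_nN) ?(minn_idPr le_nN) -addrA; congr (_ + _).
rewrite /copid_mx mulmxBr mulmx1 mulmxBl pid_mx_id //.
rewrite !mul_pid_mx ?minnn ?(minn_idPr le_nN) ?(minn_idPl le_nN).
by rewrite ?(minn_idPr le_nN) addrC addrA subrK.
Qed.

Lemma mx_inverseC n (A B : 'M[R]_n) : mx_inverse A B -> mx_inverse B A.
Proof. by case. Qed.

Lemma mx_inverseM n (A A' B B' : 'M[R]_n) :
  mx_inverse A A' -> mx_inverse B B' -> mx_inverse (A *m B) (B' *m A').
Proof.
move=> [AA A'A] [BB B'B]; split.
  by rewrite mulmxA -(mulmxA A) BB mulmx1.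
by rewrite mulmxA -(mulmxA B') A'A mulmx1.
Qed.

Lemma mx_inverse_stab n N (A B : 'M[R]_n) : (n <= N)%N ->
  mx_inverse A B -> mx_inverse (stabmx N A) (stabmx N B).
Proof.
by move=> le_nN [AB BA]; split; rewrite stabmxM // ?AB ?BA stabmx1.
Qed.

Lemma mx_inverse1 n : mx_inverse (1%:M : 'M[R]_n) 1%:M.
Proof. by split; rewrite mulmx1. Qed.

Lemma comm_prod_mul n (X Y : 'M[R]_n) :
  comm_prod X -> comm_prod Y -> comm_prod (X *m Y).
Proof.
move=> + cY; elim=> [|U U' V V' Z UU VV _ IH]; first by rewrite mul1mx.
by rewrite -mulmxA; apply: comm_prodM.
Qed.

Lemma comm_prod_comm n (X X' Y Y' : 'M[R]_n) :
  mx_inverse X X' -> mx_inverse Y Y' -> comm_prod (X *m Y *m X' *m Y').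
Proof.
by move=> XX YY; rewrite -[_ *m Y']mulmx1; apply: comm_prodM => //; apply: comm_prod1.
Qed.

Lemma comm_prod_conj n (P P' X : 'M[R]_n) : mx_inverse P P' ->
  comm_prod X -> comm_prod (P *m X *m P').
Proof.
move=> [PP P'P]; elim=> [|U U' V V' Z UU VV _ IH].
  by rewrite mulmx1 PP; apply: comm_prod1.
have conjM (A B : 'M[R]_n) :
    P *m (A *m B) *m P' = (P *m A *m P') *m (P *m B *m P').
  by rewrite !mulmxA -(mulmxA _ P' P) P'P mulmx1.
rewrite !conjM; apply: comm_prodM => //.
  by case: UU => u1 u2; split; rewrite -conjM ?u1 ?u2 mulmx1 PP.
by case: VV => u1 u2; split; rewrite -conjM ?u1 ?u2 mulmx1 PP.
Qed.

Lemma comm_prod_inv n (X : 'M[R]_n) : comm_prod X ->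
  exists2 X', mx_inverse X X' & comm_prod X'.
Proof.
elim=> [|U U' V V' Z UU VV _ [Z' ZZ cZ]].
  by exists 1%:M; [exact: mx_inverse1|exact: comm_prod1].
exists (Z' *m (V *m U *m V' *m U')); last first.
  by apply: comm_prod_mul => //; apply: comm_prod_comm.
apply: mx_inverseM => //; rewrite -!(mulmxA U) -(mulmxA V U) -mulmxA.
have := mx_inverseM (mx_inverseM UU VV)
          (mx_inverseM (mx_inverseC UU) (mx_inverseC VV)).
by rewrite !mulmxA.
Qed.

Lemma comm_prod_stab n N (X : 'M[R]_n) : (n <= N)%N ->
  comm_prod X -> comm_prod (stabmx N X).
Proof.
move=> le_nN; elim=> [|U U' V V' Z UU VV _ IH].
  by rewrite stabmx1 //; apply: comm_prod1.
by rewrite -!stabmxM //; apply: comm_prodM => //; apply: mx_inverse_stab.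
Qed.

Lemma K1_eqP_raise (x y : GL) : reflect (exists N0, forall N, (N0 <= N)%N ->
     [/\ (tag x <= N)%N, (tag y <= N)%N & exists2 X, comm_prod X &
          stabmx N (GLmx x) = stabmx N (GLmx y) *m X]) (K1_eq x y).
Proof.
apply: (iffP (asboolP _)) => [[N [xN yN [X cX eX]]]|[N /(_ N (leqnn _))]]; last by exists N.
exists N => K NK; split; rewrite ?(leq_trans _ NK) //.
exists (stabmx K X); first exact: comm_prod_stab.
by rewrite -(stabmx_stab _ xN NK) eX -stabmxM // stabmx_stab.
Qed.

Lemma K1_eq_refl : reflexive K1_eq.
Proof.
move=> x; apply/asboolP; exists (tag x); split=> //; exists 1%:M.
  exact: comm_prod1.
by rewrite mulmx1.
Qed.

Lemma K1_eq_symm x y : K1_eq x y -> K1_eq y x.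
Proof.
move=> /asboolP[N [xN yN [X cX eX]]]; apply/asboolP; exists N; split=> //.
have [X' [XX X'X] cX'] := comm_prod_inv cX; exists X' => //.
by rewrite eX -mulmxA XX mulmx1.
Qed.

Lemma K1_eq_sym : symmetric K1_eq.
Proof. by move=> x y; apply/idP/idP; apply: K1_eq_symm. Qed.

Lemma K1_eq_trans : transitive K1_eq.
Proof.
move=> y x z /K1_eqP_raise[N1 h1] /K1_eqP_raise[N2 h2].
apply/asboolP; exists (N1 + N2)%N.
have [|xN yN [X cX ->]] := h1 (N1 + N2)%N; first exact: leq_addr.
have [|_ zN [Y cY ->]] := h2 (N1 + N2)%N; first exact: leq_addl.
by split=> //; exists (Y *m X); rewrite ?mulmxA //; apply: comm_prod_mul.
Qed.

Canonical K1_equiv := EquivRel K1_eq K1_eq_refl K1_eq_sym K1_eq_trans.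

Definition K1 := {eq_quot K1_equiv}.
HB.instance Definition _ := Choice.on K1.
HB.instance Definition _ := EqQuotient.on K1.

Lemma mx1_invertible n : `[< mx_invertible (1%:M : 'M[R]_n) >].
Proof. by apply/asboolP; exists 1%:M; exact: mx_inverse1. Qed.

Definition GL_of n (A : 'M[R]_n) : GL :=
  Tagged (fun n => {A : 'M[R]_n | `[< mx_invertible A >]})
    (insubd (exist _ 1%:M (mx1_invertible n)) A).

(* The class of an invertible matrix.  The sizes may be distinct expressions (an
   isomorphism of based modules of a priori unrelated ranks); if the sizes differ
   or A is singular the value is the irrelevant default 0. *)
Definition torsion m n (A : 'M[R]_(m, n)) : K1 :=
  \pi_K1 (GL_of (conform_mx 1%:M A : 'M[R]_n)).

Lemma GL_ofK n (A : 'M[R]_n) : mx_invertible A -> GLmx (GL_of A) = A.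
Proof. by move=> /asboolP iA; rewrite /GLmx /= val_insubd iA. Qed.

Lemma GLmx_invertible x : mx_invertible (GLmx x).
Proof. by apply/asboolP; apply: (svalP (tagged x)). Qed.

Lemma GLmxK x : GL_of (GLmx x) = x.
Proof.
case: x => n A; rewrite /GL_of /GLmx /=; congr (Tagged _ _); apply: val_inj.
by rewrite val_insubd /=; case: ifP => // /negbT/negP[]; apply: (svalP A).
Qed.

Lemma torsion_repr (x : K1) : x = torsion (GLmx (repr x)).
Proof. by rewrite /torsion conform_mx_id GLmxK reprK. Qed.

Lemma torsion_eqP m n (A : 'M[R]_m) (B : 'M[R]_n) :
  mx_invertible A -> mx_invertible B ->
  torsion A = torsion B <->
  exists N0, forall N, (N0 <= N)%N -> [/\ (m <= N)%N, (n <= N)%N &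
    exists2 X, comm_prod X & stabmx N A = stabmx N B *m X].
Proof.
move=> iA iB; rewrite /torsion !conform_mx_id -{2}(GL_ofK iA) -{2}(GL_ofK iB).
split; first by move=> /eqmodP/K1_eqP_raise.
by move=> h; apply/eqmodP/K1_eqP_raise.
Qed.

Lemma mx_invertible_stab n N (A : 'M[R]_n) : (n <= N)%N ->
  mx_invertible A -> mx_invertible (stabmx N A).
Proof. by move=> nN [B AB]; exists (stabmx N B); apply: mx_inverse_stab. Qed.

Lemma mx_invertibleM n (A B : 'M[R]_n) :
  mx_invertible A -> mx_invertible B -> mx_invertible (A *m B).
Proof.
by move=> [A' AA] [B' BB]; exists (B' *m A'); apply: mx_inverseM.
Qed.

Lemma torsion_stab n N (A : 'M[R]_n) : (n <= N)%N -> mx_invertible A ->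
  torsion (stabmx N A) = torsion A.
Proof.
move=> nN iA; apply/torsion_eqP => //; first exact: mx_invertible_stab.
exists N => K NK; split=> //; first exact: leq_trans NK.
by exists 1%:M; [exact: comm_prod1|rewrite mulmx1 stabmx_stab].
Qed.

Lemma torsion_eq_comm n (A B X : 'M[R]_n) : mx_invertible A -> mx_invertible B ->
  comm_prod X -> A = B *m X -> torsion A = torsion B.
Proof.
move=> iA iB cX eA; apply/torsion_eqP => //; exists n => N nN; split=> //.
by exists (stabmx N X); [exact: comm_prod_stab|rewrite eA stabmxM].
Qed.

Definition K1_add (x y : K1) : K1 :=
  let A := GLmx (repr x) in let B := GLmx (repr y) in
  let N := maxn (tag (repr x)) (tag (repr y)) in
  torsion (stabmx N A *m stabmx N B).

Lemma K1_addE n (A B : 'M[R]_n) : mx_invertible A -> mx_invertible B ->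
  K1_add (torsion A) (torsion B) = torsion (A *m B).
Proof.
move=> iA iB; rewrite /K1_add.
set x := repr _; set y := repr _.
have iX := GLmx_invertible x; have iY := GLmx_invertible y.
have /torsion_eqP-/(_ iA iX)[N1 h1] : torsion A = torsion (GLmx x).
  by rewrite -torsion_repr.
have /torsion_eqP-/(_ iB iY)[N2 h2] : torsion B = torsion (GLmx y).
  by rewrite -torsion_repr.
set m := maxn (tag x) (tag y); set N := (N1 + N2 + m)%N.
have [|nN xN [U cU eU]] := h1 N; first by rewrite /N -addnA leq_addr.
have [|_ yN [V cV eV]] := h2 N; first by rewrite /N addnAC leq_addl.
have xm : (tag x <= m)%N := leq_maxl _ _.
have ym : (tag y <= m)%N := leq_maxr _ _.
have mN : (m <= N)%N := leq_addl _ _.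
rewrite -(torsion_stab nN (mx_invertibleM iA iB)) -(torsion_stab mN); last first.
  by apply: mx_invertibleM; apply: mx_invertible_stab.
rewrite -!stabmxM // !stabmx_stab // eU eV; symmetry.
have [Y' YY] := mx_invertible_stab yN iY.
apply: (@torsion_eq_comm _ _ _ (Y' *m U *m stabmx N (GLmx y) *m V)).
- by rewrite -eU -eV; apply: mx_invertibleM; apply: mx_invertible_stab.
- by apply: mx_invertibleM; apply: mx_invertible_stab.
- by apply: comm_prod_mul => //; apply: comm_prod_conj => //; apply: mx_inverseC.
- by rewrite !mulmxA -(mulmxA _ _ Y') YY.1 mulmx1.
Qed.

Lemma K1_ind3 (P : K1 -> K1 -> K1 -> Prop) :
  (forall n (A B C : 'M[R]_n), mx_invertible A -> mx_invertible B ->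
     mx_invertible C -> P (torsion A) (torsion B) (torsion C)) ->
  forall x y z, P x y z.
Proof.
move=> PH x y z; rewrite [x]torsion_repr [y]torsion_repr [z]torsion_repr.
move: (repr x) (repr y) (repr z) => {}x {}y {}z.
pose N := (tag x + tag y + tag z)%N.
have xN : (tag x <= N)%N by rewrite /N -addnA leq_addr.
have yN : (tag y <= N)%N by rewrite /N addnAC leq_addl.
have zN : (tag z <= N)%N by rewrite leq_addl.
have := (GLmx_invertible x, GLmx_invertible y, GLmx_invertible z).
move=> [[iX iY] iZ].
rewrite -(torsion_stab xN) // -(torsion_stab yN) // -(torsion_stab zN) //.
by apply: PH; apply: mx_invertible_stab.
Qed.

Definition mx_inv n (A : 'M[R]_n) : 'M[R]_n := xget 1%:M (mx_inverse A).

Lemma mx_invP n (A : 'M[R]_n) : mx_invertible A -> mx_inverse A (mx_inv A).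
Proof. by rewrite /mx_inv => -[B AB]; case: xgetP => [C -> //|/(_ B)]. Qed.

Definition K1_opp (x : K1) : K1 := torsion (mx_inv (GLmx (repr x))).

Lemma K1_addA : associative K1_add.
Proof.
apply: K1_ind3 => n A B C iA iB iC.
have iM := mx_invertibleM; rewrite !K1_addE ?mulmxA //; exact: iM.
Qed.

Lemma K1_addC : commutative K1_add.
Proof.
move=> x y; apply: (K1_ind3 (P := fun x y _ => K1_add x y = K1_add y x) _ x y x).
move=> n A B _ iA iB _; rewrite !K1_addE //.
have [[A' AA] [B' BB]] := (iA, iB).
apply: (@torsion_eq_comm _ _ _ (A' *m B' *m A *m B)).
- exact: mx_invertibleM.
- exact: mx_invertibleM.
- by apply: comm_prod_comm; apply: mx_inverseC.
- by rewrite !mulmxA -(mulmxA B A) AA.1 mulmx1 BB.1 mul1mx.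
Qed.

Lemma K1_add0 : left_id (torsion (1%:M : 'M[R]_0)) K1_add.
Proof.
move=> x; apply: (K1_ind3 (P := fun x _ _ => K1_add _ x = x) _ x x x).
move=> n A _ _ iA _ _.
have i1 k : mx_invertible (1%:M : 'M[R]_k) by exists 1%:M; exact: mx_inverse1.
by rewrite -(torsion_stab (leq0n n)) // stabmx1 // K1_addE // mul1mx.
Qed.

Lemma K1_addN : left_inverse (torsion (1%:M : 'M[R]_0)) K1_opp K1_add.
Proof.
move=> x; suff: K1_add (K1_opp x) (torsion (GLmx (repr x))) = torsion (1%:M : 'M_0).
  by rewrite -torsion_repr.
rewrite /K1_opp; have iX := GLmx_invertible (repr x); have XX := mx_invP iX.
have i1 k : mx_invertible (1%:M : 'M[R]_k) by exists 1%:M; exact: mx_inverse1.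
rewrite K1_addE //; last by exists (GLmx (repr x)); exact: mx_inverseC.
by rewrite XX.2 -(torsion_stab (leq0n (tag (repr x)))) // stabmx1.
Qed.

HB.instance Definition _ :=
  GRing.isZmodule.Build K1 K1_addA K1_addC K1_add0 K1_addN.

Lemma torsionM n (A B : 'M[R]_n) : mx_invertible A -> mx_invertible B ->
  torsion (A *m B) = torsion A + torsion B.
Proof. by move=> iA iB; rewrite -K1_addE. Qed.

Lemma torsion1 n : torsion (1%:M : 'M[R]_n) = 0.
Proof.
rewrite -(stabmx1 (leq0n n)) torsion_stab //; exists 1%:M; exact: mx_inverse1.
Qed.

End K1.

Arguments torsion {R m n} A.
Arguments GLmx {R} x.

Section K1Functor.
Variables R S : pzRingType.

Lemma map_stabmx (f : {rmorphism R -> S}) n N (A : 'M[R]_n) :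
  map_mx f (stabmx N A) = stabmx N (map_mx f A).
Proof.
by rewrite /stabmx map_mxD !map_mxM map_copid_mx !map_pid_mx.
Qed.

Lemma map_mx_inverse (f : {rmorphism R -> S}) n (A B : 'M[R]_n) :
  mx_inverse A B -> mx_inverse (map_mx f A) (map_mx f B).
Proof. by move=> [AB BA]; split; rewrite -map_mxM ?AB ?BA map_mx1. Qed.

Lemma map_comm_prod (f : {rmorphism R -> S}) n (A : 'M[R]_n) :
  comm_prod A -> comm_prod (map_mx f A).
Proof.
elim=> [|U U' V V' Z UU VV _ IH]; first by rewrite map_mx1; apply: comm_prod1.
by rewrite !map_mxM; apply: comm_prodM => //; apply: map_mx_inverse.
Qed.

(* The induced map; see [K1_map_torsion]. *)
Definition K1_map (f : {rmorphism R -> S}) (x : K1 R) : K1 S :=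
  torsion (map_mx f (GLmx (repr x))).

Lemma K1_map_torsion (f : {rmorphism R -> S}) n (A : 'M[R]_n) :
  mx_invertible A -> K1_map f (torsion A) = torsion (map_mx f A).
Proof.
move=> iA; rewrite /K1_map; set x := repr _.
have iX := GLmx_invertible x.
have /torsion_eqP-/(_ iX iA)[N /(_ N (leqnn _))[xN nN [X cX eX]]] :
  torsion (GLmx x) = torsion A by rewrite -torsion_repr.
have imap k (B : 'M[R]_k) : mx_invertible B -> mx_invertible (map_mx f B).
  by move=> [B' BB]; exists (map_mx f B'); apply: map_mx_inverse.
rewrite -(torsion_stab xN) -?(torsion_stab nN); try exact: imap.
apply: (@torsion_eq_comm _ _ _ _ (map_mx f X)).
- by apply: mx_invertible_stab => //; exact: imap.
- by apply: mx_invertible_stab => //; exact: imap.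
- exact: map_comm_prod.
- by rewrite -!map_stabmx eX map_mxM.
Qed.

End K1Functor.

Section K1Involution.
Variable R : invRingType.

(* The matrix of the dual morphism f^* in the dual bases. *)
Definition adjmx m n (A : 'M[R]_(m, n)) : 'M[R]_(n, m) := map_mx invol A^T.

Lemma adjmxM m n p (A : 'M[R]_(m, n)) (B : 'M[R]_(n, p)) :
  adjmx (A *m B) = adjmx B *m adjmx A.
Proof.
apply/matrixP => i j; rewrite !mxE.
rewrite (big_morph invol (@involD R) (invol0 R)).
by apply: eq_bigr => k _; rewrite involM !mxE.
Qed.

Lemma adjmxK m n (A : 'M[R]_(m, n)) : adjmx (adjmx A) = A.
Proof. by apply/matrixP => i j; rewrite !mxE involK. Qed.

Lemma adjmxD m n (A B : 'M[R]_(m, n)) : adjmx (A + B) = adjmx A + adjmx B.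
Proof. by apply/matrixP => i j; rewrite !mxE involD. Qed.

Lemma adjmxN m n (A : 'M[R]_(m, n)) : adjmx (- A) = - adjmx A.
Proof. by apply/matrixP => i j; rewrite !mxE involN. Qed.

Lemma adj_pid_mx m n r : adjmx (pid_mx r : 'M_(m, n)) = pid_mx r.
Proof.
apply/matrixP => i j; rewrite !mxE.
rewrite eq_sym; case: eqP => [->|_] /=; last by rewrite invol0.
by case: (j < r)%N => /=; rewrite ?mulr0n ?mulr1n ?invol1 ?invol0.
Qed.

Lemma adjmx1 n : adjmx (1%:M : 'M_n) = 1%:M.
Proof. by rewrite -pid_mx_1 adj_pid_mx. Qed.

Lemma adj_stabmx n N (A : 'M[R]_n) : adjmx (stabmx N A) = stabmx N (adjmx A).
Proof.
by rewrite /stabmx /copid_mx !adjmxD adjmxN !adjmxM adjmx1 !adj_pid_mx mulmxA.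
Qed.

Lemma adj_mx_inverse n (A B : 'M[R]_n) :
  mx_inverse A B -> mx_inverse (adjmx A) (adjmx B).
Proof. by move=> [AB BA]; split; rewrite -adjmxM ?AB ?BA adjmx1. Qed.

Lemma adj_comm_prod n (A : 'M[R]_n) : comm_prod A -> comm_prod (adjmx A).
Proof.
elim=> [|U U' V V' Z UU VV _ IH]; first by rewrite adjmx1; apply: comm_prod1.
rewrite !adjmxM; apply: comm_prod_mul => //; rewrite !mulmxA.
by apply: comm_prod_comm; apply: adj_mx_inverse; apply: mx_inverseC.
Qed.

(* The involution with tau(f)^* = tau(f^* ); see [K1_star_torsion]. *)
Definition K1_star (x : K1 R) : K1 R := torsion (adjmx (GLmx (repr x))).

Lemma K1_star_torsion n (A : 'M[R]_n) :
  mx_invertible A -> K1_star (torsion A) = torsion (adjmx A).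
Proof.
move=> iA; rewrite /K1_star; set x := repr _.
have iX := GLmx_invertible x.
have /torsion_eqP-/(_ iX iA)[N /(_ N (leqnn _))[xN nN [X cX eX]]] :
  torsion (GLmx x) = torsion A by rewrite -torsion_repr.
have iadj k (B : 'M[R]_k) : mx_invertible B -> mx_invertible (adjmx B).
  by move=> [B' BB]; exists (adjmx B'); apply: adj_mx_inverse.
rewrite -(torsion_stab xN) -?(torsion_stab nN); try exact: iadj.
have [P AP] := mx_invertible_stab nN (iadj _ _ iA).
apply: (@torsion_eq_comm _ _ _ _ (P *m adjmx X *m stabmx N (adjmx A))).
- by apply: mx_invertible_stab => //; exact: iadj.
- by apply: mx_invertible_stab => //; exact: iadj.
- by apply: comm_prod_conj; [exact: mx_inverseC|exact: adj_comm_prod].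
- by rewrite -adj_stabmx eX adjmxM adj_stabmx !mulmxA AP.1 mul1mx.
Qed.

End K1Involution.

Definition rank_well_defined (R : pzRingType) : Prop :=
  forall m n (A : 'M[R]_(m, n)) (B : 'M[R]_(n, m)),
    A *m B = 1%:M -> B *m A = 1%:M -> m = n.

(* A based f.g. free module is given by its rank and a morphism M -> N by its
   matrix in 'M_(rank N, rank M), acting on columns (right modules), so that
   composition is the matrix product.  M^* is identified with M by the dual basis.
   The data of a symmetric form do not involve k. *)
Record symmetric_form_4k2 (R : invRingType) := SymmetricForm4k2 {
  form_rank : nat;
  form_phi0 : 'M[R]_form_rank;
  form_iso : mx_invertible form_phi0;
  form_skew : adjmx form_phi0 = - form_phi0
}.

Definition forms_4k2_have_even_rank (R : invRingType) : Prop :=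
  forall M : symmetric_form_4k2 R, ~~ odd (form_rank M).

Definition sgn (R : pzRingType) (k : int) : R := (-1) ^+ `|k|%N.
Arguments sgn {R} k.

Section SignedComplexes.
Variable R : invRingType.

Definition torsionN1 : K1 R := torsion ((-1)%:M : 'M[R]_1).

Definition eps (a b : int) : K1 R := torsionN1 *~ (a * b).

(* Degrees range over int, with C_r = 0 outside [0, cdim].  Families of morphisms
   are indexed by pairs of degrees (source, target) and vanish off the relevant
   diagonal; this avoids casts between equal degrees.  [cd r s] is the part of the
   differential going from C_r to C_s, hence is nonzero only for s = r - 1. *)
Record signed_complex := SignedComplex {
  cdim : nat;
  crk : int -> nat;
  cd : forall r s : int, 'M[R]_(crk s, crk r);
  ceta : K1 R
}.

Definition gmap (C D : signed_complex) :=
  forall r s : int, 'M[R]_(crk D s, crk C r).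

Definition has_degree (C D : signed_complex) (k : int) (f : gmap C D) : Prop :=
  forall r s, s != r + k -> f r s = 0.

Record is_signed_complex (C : signed_complex) : Prop := {
  crk_out : forall r : int, (r < 0) || ((cdim C)%:Z < r) -> crk C r = 0%N;
  cd_degree : @has_degree C C (-1) (@cd C);
  cd_cd : forall r, cd C (r + 1) r *m cd C (r + 2) (r + 1) = 0;
  ceta_sign : ceta C = 0 \/ ceta C = torsionN1
}.

Definition chi (C : signed_complex) : int :=
  \sum_(r < (cdim C).+1) (-1) ^+ r * (crk C r)%:Z.

(* In sums over C_odd and C_even the bound is generous: the summands beyond the
   dimension are zero modules. *)
Definition rk_odd (C : signed_complex) : nat :=
  (\sum_(i < (cdim C).+1) crk C i.*2.+1)%N.
Definition rk_even (C : signed_complex) : nat :=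
  (\sum_(i < (cdim C).+1) crk C i.*2)%N.

Definition beta (C D : signed_complex) : K1 R :=
  \sum_(i < (cdim C).+1) \sum_(j < i)
     (eps (crk C i.*2) (crk D j.*2) - eps (crk C i.*2.+1) (crk D j.*2.+1)).

Definition is_contraction (C : signed_complex) (G : gmap C C) : Prop :=
  has_degree 1 G /\
  forall r, cd C (r + 1) r *m G r (r + 1) + G (r - 1) r *m cd C r (r - 1) = 1%:M.

Definition odd_to_even (C : signed_complex) (G : gmap C C) :
    'M[R]_(rk_even C, rk_odd C) :=
  \mxblock_(i < (cdim C).+1, j < (cdim C).+1)
     (cd C j.*2.+1 i.*2 + G j.*2.+1 i.*2).

(* The torsion computed with some chain contraction; 0 if there is none. *)
Definition tau_new (C : signed_complex) : K1 R :=
  xget 0 [set t | exists2 G, @is_contraction C G &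
                  t = torsion (odd_to_even G) + ceta C]%classic.

Definition suspension (C : signed_complex) : signed_complex := {|
  cdim := (cdim C).+1;
  crk := fun r => crk C (r - 1);
  cd := fun r s => cd C (r - 1) (s - 1);
  ceta := - ceta C
|}.

Definition direct_sum (C D : signed_complex) : signed_complex := {|
  cdim := maxn (cdim C) (cdim D);
  crk := fun r => (crk C r + crk D r)%N;
  cd := fun r s => block_mx (cd C r s) 0 0 (cd D r s);
  ceta := ceta C + ceta D - beta C D + eps (rk_odd C) (chi D)
|}.

Definition mapping_cone (C D : signed_complex) (f : gmap C D) : signed_complex := {|
  cdim := maxn (cdim D) (cdim C).+1;
  crk := fun r => (crk D r + crk C (r - 1))%N;
  cd := fun r s => block_mx (cd D r s) (sgn (r + 1) *: f (r - 1) s)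
                            0          (cd C (r - 1) (s - 1));
  ceta := ceta (direct_sum D (suspension C))
|}.

Definition gid (C : signed_complex) : gmap C C :=
  fun r s => if r == s then pid_mx (crk C r) else 0.

Definition gcomp (C D E : signed_complex) (g : gmap D E) (f : gmap C D) : gmap C E :=
  fun r s => g s s *m f r s.

Definition is_chain_map (C D : signed_complex) (f : gmap C D) : Prop :=
  has_degree 0 f /\
  forall r, cd D (r + 1) r *m f (r + 1) (r + 1) = f r r *m cd C (r + 1) r.

Definition chain_homotopic (C D : signed_complex) (f g : gmap C D) : Prop :=
  exists2 h : gmap C D, has_degree 1 h &
    forall r, f r r - g r r =
      cd D (r + 1) r *m h r (r + 1) + h (r - 1) r *m cd C r (r - 1).

Definition is_chain_equivalence (C D : signed_complex) (f : gmap C D) : Prop :=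
  is_chain_map f /\
  exists g : gmap D C, [/\ is_chain_map g,
    chain_homotopic (gcomp g f) (gid C) & chain_homotopic (gcomp f g) (gid D)].

Definition tau_new_map (C D : signed_complex) (f : gmap C D) : K1 R :=
  tau_new (mapping_cone f).

Definition dual_complex (C : signed_complex) : signed_complex :=
  let n := cdim C in {|
  cdim := n;
  crk := fun r => crk C (n%:Z - r);
  cd := fun r s => sgn r *: adjmx (cd C (n%:Z - s) (n%:Z - r));
  ceta := K1_star (ceta C) *~ (-1) ^+ n.+1 + K1_star (beta C C) *~ (-1) ^+ n.+1
          + \sum_(r < n.+1 | ((r == n + 2 %[mod 4]) || (r == n + 3 %[mod 4]))%N)
              eps (crk C r) (crk C r)
|}.

(* As C^p is identified with C_p, families C^p -> D_q have the type [gmap C D]. *)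
Definition transposition (C D : signed_complex) (phi : gmap C D) : gmap D C :=
  fun q p => sgn (p * q) *: adjmx (phi p q).

Definition phi_pred (C : signed_complex) (phi : nat -> gmap C C) (s : nat) : gmap C C :=
  if s is s'.+1 then phi s' else fun _ _ => 0.

(* [phi s p q] is the part C^p -> C_q of phi_s, nonzero only for p + q = n + s;
   [phi_cycle] is the relation between morphisms C^p -> C_r, p = n - r + s - 1. *)
Record is_symmetric_structure (C : signed_complex) (phi : nat -> gmap C C) : Prop := {
  phi_degree : forall s p q, p + q != (cdim C)%:Z + s%:Z -> phi s p q = 0;
  phi_cycle : forall (s : nat) (p r : int), p + r = (cdim C)%:Z + s%:Z - 1 ->
    cd C (r + 1) r *m phi s p (r + 1)
    + sgn r *: (phi s (p + 1) r *m adjmx (cd C (p + 1) p))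
    + sgn ((cdim C)%:Z + s%:Z + 1) *:
        (phi_pred phi s p r + sgn s%:Z *: transposition (phi_pred phi s) p r) = 0
}.

Definition duality_map (C : signed_complex) (phi0 : gmap C C) :
    gmap (dual_complex C) C :=
  fun r s => phi0 ((cdim C)%:Z - r) s.

Record is_symmetric_Poincare (C : signed_complex) (phi : nat -> gmap C C) : Prop := {
  poincare_complex : is_signed_complex C;
  poincare_structure : is_symmetric_structure phi;
  poincare_equivalence : is_chain_equivalence (duality_map (phi 0%N))
}.

(* The torsion only involves phi_0, and does not depend on the sign of C. *)
Definition absolute_torsion (C : signed_complex) (phi0 : gmap C C) : K1 R :=
  tau_new_map (duality_map phi0).

End SignedComplexes.

Arguments torsionN1 {R}.

Section TensorProduct.
Variables R S : invRingType.
Local Notation T := (tensor_ring R S).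

(* The Kronecker product, with entries a (x) b and bases ordered lexicographically. *)
Definition tmx m n p q (A : 'M[R]_(m, n)) (B : 'M[S]_(p, q)) :
    'M[T]_(m * p, n * q) :=
  tensmx (map_mx (@tensl R S) A) (map_mx (@tensr R S) B).

Definition tensor_complex (C : signed_complex R) (D : signed_complex S)
    (eta : K1 T) : signed_complex T := {|
  cdim := (cdim C + cdim D)%N;
  crk := fun r => (\sum_(i < (cdim C).+1) crk C i * crk D (r - i%:Z))%N;
  cd := fun r s => \mxblock_(i < (cdim C).+1, j < (cdim C).+1)
    (tmx (gid C j i) (cd D (r - j%:Z) (s - i%:Z))
     + sgn (r - j%:Z) *: tmx (cd C j i) (gid D (r - j%:Z) (s - i%:Z)));
  ceta := eta
|}.

(* The matrix block (i, j) is the part (C_j (x) D_(p-j))^* -> C_i (x) D_(q-i); the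
   sign (-1)^((n-j)(p-j)) is that of the isomorphism
   (C (x) D)^(n+m-* ) = C^(n-* ) (x) D^(m-* ). *)
Definition tensor_phi0 (C : signed_complex R) (D : signed_complex S) (eta : K1 T)
    (phi0 : gmap C C) (theta0 : gmap D D) :
    gmap (tensor_complex C D eta) (tensor_complex C D eta) :=
  fun p q => \mxblock_(i < (cdim C).+1, j < (cdim C).+1)
    (sgn (((cdim C)%:Z - j%:Z) * (p - j%:Z)) *:
       tmx (phi0 j i) (transposition theta0 (p - j%:Z) (q - i%:Z))).

End TensorProduct.

(* Main.v *)
Require Import Defs.
From mathcomp Require Import all_boot all_order all_algebra all_fingroup.
From mathcomp Require Import boolp classical_sets mxtens.
From mathcomp Require Import zify.

(** Up to multiples of tau(-1) the formula is the product formula for torsions of chain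
    equivalences. Filter the cone of [f (x) 1] by the degree in [D]: the map
    d + Gamma from the odd to the even part becomes block triangular, and a basis
    element [y] of [D] contributes the corresponding map for the cone of [f] if [y] is
    even, and its inverse if [y] is odd ([has_torsion_tensorl]). This gives chi(D)
    tau(f); similarly for [1 (x) g] ([has_torsion_tensorr]), and [f (x) g] is a
    composite ([has_torsion_comp]). The point of the theorem is that, with the signs
    that enter the absolute torsion, all multiples of tau(-1) cancel. As 2 tau(-1) = 0,
    these are parities of numbers of basis elements.

    To separate the signs from the algebra, a complex is treated as one module with one
    numbered basis and a degree function ([based_complex], [model]). For a map from [B]
    to [C] such that basis elements with the same number have degrees of the same
    parity, the odd and the even part of the cone are numbered in parallel, without any
    choice of order, and [has_torsion C B f u] says that [u] is the torsion in these
    numberings. For the duality map of an n-dimensional complex the parities match if n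
    is even. If n is odd, the dual has to be renumbered by an involution that exchanges
    odd and even basis elements. There is one, because d + Gamma is invertible and ranks
    are well defined, so that there are as many odd as even elements ([odd_dim_card]).

    Then the absolute torsion of [phi_0] is [u] + (N_o + A) tau(-1), where N_o is the
    number of basis elements of odd degree and A is the number of those of degree
    congruent to n + 2 or n + 3 modulo 4 ([absolute_torsionE]). Indeed the passage from
    the bases ordered by degree to the parallel numberings costs the sign of a
    permutation; its inversions ([cone_inversions], [dual_inversions]) cancel against
    the terms beta in the signs of the cone and of the dual, except for the number N_o,
    and A comes from the definition of the sign of the dual.

    In the product, [theta_0] may be replaced by the homotopic map T [theta_0]
    ([has_torsion_transposition]). The identification of the dual of the product with
    the product of the duals has the sign (-1)^((n - |x|) |y|), which contributes the
    number of pairs of basis elements for which the exponent is odd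
    ([has_torsion_tensor_dual]); if n and m are odd, the involution on pairs is an even
    permutation and may be dropped ([tensor_involution]). Modulo 2, A is the sum of the
    binomial coefficients of |x| - n over 2, so that A for the product is
    N_D A_C + N_C A_D plus the number of pairs for which (n - |x|) (m - |y|) is odd, where
    N_C and N_D are the total ranks. That number cancels against the sign of the
    identification, since in odd dimension there are as many odd as even elements
    ([sign_count]). *)

Set Implicit Arguments.
Unset Strict Implicit.
Unset Printing Implicit Defensive.

Import Order.TTheory GRing.Theory Num.Theory.
Local Open Scope ring_scope.

(** * Linear identities in abelian groups *)

Inductive zexpr := ZVar of nat | ZAdd of zexpr & zexpr | ZOpp of zexpr | ZZero.

Fixpoint zeval (V : zmodType) (env : seq V) (t : zexpr) : V :=
  match t with
  | ZVar i => nth 0 env i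
  | ZAdd a b => zeval env a + zeval env b
  | ZOpp a => - zeval env a
  | ZZero => 0
  end.

Fixpoint zcoef (t : zexpr) (i : nat) : int :=
  match t with
  | ZVar j => (i == j)%:Z
  | ZAdd a b => zcoef a i + zcoef b i
  | ZOpp a => - zcoef a i
  | ZZero => 0
  end.

Lemma zevalE (V : zmodType) (env : seq V) t :
  zeval env t = \sum_(i < size env) env`_i *~ zcoef t i.
Proof.
elim: t => [j|a IHa b IHb|a IHa|] /=.
- have [lt_j|le_j] := ltnP j (size env); last first.
    rewrite nth_default // big1 // => i _.
    by rewrite (ltn_eqF (leq_trans (ltn_ord i) le_j)).
  rewrite (bigD1 (Ordinal lt_j)) //= eqxx big1 ?addr0 // => i ni.
  by rewrite (_ : (i == j :> nat) = false) //; apply/negbTE; rewrite -val_eqE in ni.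
- by rewrite IHa IHb -big_split; apply: eq_bigr => i _ /=; rewrite -mulrzDr.
- by rewrite IHa -sumrN; apply: eq_bigr => i _; rewrite -mulrNz.
- by rewrite big1.
Qed.

Lemma zmodule_eq (V : zmodType) (env : seq V) a b :
  all (fun i => zcoef a i == zcoef b i) (iota 0 (size env)) ->
  zeval env a = zeval env b.
Proof.
move=> /allP ab; rewrite !zevalE; apply: eq_bigr => i _.
by rewrite (eqP (ab i _)) // mem_iota ltn_ord.
Qed.

(* Equality of atoms disregards the inferred structure of a multiple [a *+ k]. *)
Ltac zmod_same x y :=
  match constr:((x, y)) with
  | (?a, ?a) => constr:(tt)
  | ((?a *+ ?k)%R, (?b *+ ?k)%R) => zmod_same a b
  end.
Ltac zmod_index x env :=
  match env with
  | ?y :: _ => let _ := zmod_same x y in constr:(0%N)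
  | _ :: ?env' => let i := zmod_index x env' in constr:(S i)
  end.
Ltac zmod_add x env :=
  match env with
  | _ => let _ := zmod_index x env in env
  | _ => constr:(x :: env)
  end.
Ltac zmod_env t env :=
  lazymatch t with
  | (?a + ?b)%R => let env' := zmod_env a env in zmod_env b env'
  | (- ?a)%R => zmod_env a env
  | 0%R => env
  | _ => zmod_add t env
  end.
Ltac zmod_reify t env :=
  lazymatch t with
  | (?a + ?b)%R =>
      let a' := zmod_reify a env in let b' := zmod_reify b env in constr:(ZAdd a' b')
  | (- ?a)%R => let a' := zmod_reify a env in constr:(ZOpp a')
  | 0%R => constr:(ZZero)
  | _ => let i := zmod_index t env in constr:(ZVar i)
  end.
(** Reflects the two sides to integral coefficient lists over their common atoms. *)
Ltac zmodule :=
  lazymatch goal with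
  | |- @eq ?T ?l ?r =>
      let env0 := zmod_env l (@nil T) in
      let env := zmod_env r env0 in
      let a := zmod_reify l env in
      let b := zmod_reify r env in
      exact: (@zmodule_eq _ env a b isT)
  end.

(** * Torsions of particular matrices *)

Local Notation block_mxE4 := (block_mxEul, block_mxEur, block_mxEdl, block_mxEdr).
Local Notation mx0E := (mulmx0, mul0mx, addr0, add0r).

Section Torsion.
Variable R : pzRingType.
Local Notation tN1 := (torsion ((-1)%:M : 'M[R]_1)).

Lemma mx_inverse_invertible n (A B : 'M[R]_n) : mx_inverse A B -> mx_invertible A.
Proof. by exists B. Qed.

Lemma mx_invertible1 n : mx_invertible (1%:M : 'M[R]_n).
Proof. by exists 1%:M; apply: mx_inverse1. Qed.
Hint Resolve mx_invertible1 : core.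

Lemma torsion_inv n (A B : 'M[R]_n) : mx_inverse A B -> torsion B = - torsion A.
Proof.
move=> AB; apply/eqP; rewrite -addr_eq0 -torsionM ?AB.2 ?torsion1 //.
  by exists A; apply: mx_inverseC.
by exists B.
Qed.

Lemma torsion_conj n (P P' A : 'M[R]_n) : mx_inverse P P' -> mx_invertible A ->
  torsion (P *m A *m P') = torsion A.
Proof.
move=> PP iA; have iP := mx_inverse_invertible PP.
have iP' := mx_inverse_invertible (mx_inverseC PP).
have iPA := mx_invertibleM iP iA.
by rewrite !torsionM // (torsion_inv PP) addrAC subrr add0r.
Qed.

Section Embedding.
Variables (n N : nat) (U : 'M[R]_(N, n)) (V : 'M[R]_(n, N)).

(** When [V *m U = 1] this is the matrix of the automorphism [A] of the direct
    summand [U], extended by the identity of the summand [ker V]. *)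
Definition mx_embed (A : 'M[R]_n) : 'M[R]_N := 1%:M + U *m (A - 1%:M) *m V.

Hypothesis VU : V *m U = 1%:M.

Lemma mx_embedE (a : 'M_n) : mx_embed (1%:M + a) = 1%:M + U *m a *m V.
Proof. by rewrite /mx_embed [1%:M + a]addrC addrK. Qed.

Lemma mx_embedM A B : mx_embed A *m mx_embed B = mx_embed (A *m B).
Proof.
have [a ->] : exists a, A = 1%:M + a by exists (A - 1%:M); rewrite addrC subrK.
have [b ->] : exists b, B = 1%:M + b by exists (B - 1%:M); rewrite addrC subrK.
rewrite [in RHS]mulmxDl !mul1mx [in RHS]mulmxDr mulmx1 -addrA !mx_embedE.
rewrite mulmxDl mul1mx mulmxDr mulmx1 -!addrA; congr (_ + _).
by rewrite !(mulmxDr U) !mulmxDl !mulmxA -(mulmxA (U *m a) V U) VU mulmx1.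
Qed.

Lemma mx_embed1 : mx_embed 1%:M = 1%:M.
Proof. by rewrite /mx_embed subrr mulmx0 mul0mx addr0. Qed.

Lemma mx_embed_inverse A B : mx_inverse A B -> mx_inverse (mx_embed A) (mx_embed B).
Proof. by move=> [AB BA]; split; rewrite mx_embedM ?AB ?BA mx_embed1. Qed.

Lemma mx_embed_invertible A : mx_invertible A -> mx_invertible (mx_embed A).
Proof. by move=> [B AB]; exists (mx_embed B); apply: mx_embed_inverse. Qed.

(** The involution of [R^N + R^n] that exchanges the image of [U] with the
    second summand. *)
Definition mx_embed_swap : 'M[R]_(N + n) := block_mx (1%:M - U *m V) U V 0.

Local Notation swap := mx_embed_swap.

Lemma mx_embed_swapK : swap *m swap = 1%:M.
Proof.
have e : (1%:M - U *m V) *m U = 0 by rewrite mulmxBl mul1mx -mulmxA VU mulmx1 subrr.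
have e' : V *m (1%:M - U *m V) = 0 by rewrite mulmxBr mulmx1 mulmxA VU mul1mx subrr.
rewrite /swap mulmx_block !mulmx0 !addr0 VU e e' mulmxBr mulmx1 mulmxA e mul0mx subr0.
by rewrite subrK mul0mx addr0 -scalar_mx_block.
Qed.

Lemma mx_embed_swapE A :
  swap *m block_mx (mx_embed A) 0 0 1%:M *m swap = block_mx 1%:M 0 0 A.
Proof.
have e : (1%:M - U *m V) *m U = 0 by rewrite mulmxBl mul1mx -mulmxA VU mulmx1 subrr.
have e' : V *m (1%:M - U *m V) = 0 by rewrite mulmxBr mulmx1 mulmxA VU mul1mx subrr.
rewrite /swap mulmx_block !mulmx0 !mul0mx !addr0 !add0r !mulmx1 /mx_embed.
rewrite [(1%:M - _) *m (_ + _)]mulmxDr mulmx1 !mulmxA e !mul0mx addr0.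
rewrite [V *m (_ + _)]mulmxDr mulmx1 !mulmxA VU mul1mx mulmxBl mul1mx.
rewrite (addrC V) subrK mulmx_block !mulmx0 !addr0 e -!mulmxA e' mulmx0 VU mulmx1.
by rewrite mulmxBr mulmx1 mulmxA e !mul0mx subr0 subrK addr0.
Qed.

End Embedding.

Lemma stabmx_embed n N (A : 'M[R]_n) : (n <= N)%N ->
  stabmx N A = mx_embed (pid_mx n) (pid_mx n) A.
Proof.
move=> nN; rewrite /stabmx /mx_embed mulmxBr mulmxBl mulmx1 mul_pid_mx ?minnn.
by rewrite /copid_mx addrCA.
Qed.

Lemma stabmx_block n N (A : 'M[R]_n) : stabmx (n + N) A = block_mx A 0 0 1%:M.
Proof.
rewrite /stabmx /copid_mx pid_mx_col pid_mx_row pid_mx_block mul_col_mx mul1mx mul0mx.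
rewrite mul_mx_row mulmx1 mulmx0 scalar_mx_block opp_block_mx add_block_mx.
by rewrite subrr !subr0 !block_mxEh add_row_mx add0r add_col_mx !addr0.
Qed.

Lemma torsion_block1r n N (A : 'M[R]_n) : mx_invertible A ->
  torsion (block_mx A 0 0 (1%:M : 'M_N)) = torsion A.
Proof. by move=> iA; rewrite -stabmx_block torsion_stab ?leq_addr. Qed.

Lemma mx_invertible_block n N (A : 'M[R]_n) (B : 'M[R]_N) :
  mx_invertible A -> mx_invertible B -> mx_invertible (block_mx A 0 0 B).
Proof.
move=> [A' [AA AA']] [B' [BB BB']]; exists (block_mx A' 0 0 B').
by split; rewrite mulmx_block !mulmx0 !mul0mx !addr0 !add0r ?(AA, AA', BB, BB') -scalar_mx_block.
Qed.

(** Stabilising by [1_n], the automorphism [mx_embed U V A] becomes conjugate to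
    one that depends on the sizes and on [A] but not on the embedding, so it may
    be compared with the standard embedding that defines stabilisation. *)
Lemma torsion_embed n N (U : 'M[R]_(N, n)) (V : 'M[R]_(n, N)) (A : 'M[R]_n) :
  V *m U = 1%:M -> mx_invertible A -> torsion (mx_embed U V A) = torsion A.
Proof.
move=> VU iA.
have swp N' (U' : 'M[R]_(N', n)) (V' : 'M[R]_(n, N')) : V' *m U' = 1%:M ->
    torsion (mx_embed U' V' A) = torsion (block_mx (1%:M : 'M_N') 0 0 A).
  move=> VU'; have iE := mx_embed_invertible VU' iA.
  rewrite -(torsion_block1r n iE) -(mx_embed_swapE VU').
  rewrite torsion_conj //; first by split; apply: mx_embed_swapK.
  by apply: mx_invertible_block.
have big N' (U' : 'M[R]_(N', n)) (V' : 'M[R]_(n, N')) : (n <= N')%N -> V' *m U' = 1%:M ->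
    torsion (mx_embed U' V' A) = torsion A.
  move=> nN VU'; rewrite swp // -(torsion_stab nN iA) stabmx_embed // [RHS]swp //.
  by rewrite pid_mx_id // pid_mx_1.
have iE := mx_embed_invertible VU iA.
rewrite -(torsion_block1r n iE) -(big (N + n)%N (col_mx U 0) (row_mx V 0)) ?leq_addl //.
  rewrite /mx_embed mul_col_mx mul0mx mul_mx_row !mul_col_mx mulmx0 !mul0mx.
  by rewrite -block_mxEh scalar_mx_block add_block_mx !addr0.
by rewrite mul_row_col VU mul0mx addr0.
Qed.

Lemma torsion_block_diag n N (A : 'M[R]_n) (B : 'M[R]_N) :
  mx_invertible A -> mx_invertible B ->
  torsion (block_mx A 0 0 B) = torsion A + torsion B.
Proof.
move=> iA iB.
have -> : block_mx A 0 0 B = block_mx A 0 0 1%:M *m block_mx 1%:M 0 0 B.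
  by rewrite mulmx_block !mulmx0 !mul0mx !addr0 !add0r mulmx1 mul1mx.
rewrite torsionM ?torsion_block1r //; try exact: mx_invertible_block.
congr (_ + _).
have VU : row_mx (0 : 'M_(N, n)) 1%:M *m col_mx (0 : 'M_(n, N)) 1%:M = 1%:M :> 'M[R]_N.
  by rewrite mul_row_col mul0mx add0r mulmx1.
rewrite -(torsion_embed VU iB) /mx_embed.
rewrite mul_col_mx mul0mx mul1mx mul_mx_row mulmx0 mulmx1 scalar_mx_block.
by rewrite !block_mxEh add_row_mx addr0 add_col_mx addr0 (addrC 1%:M) subrK.
Qed.

(** The commutator [[1 v; 0 1], [1 0; w 1]] is [1 + v w] (stabilised) as soon as
    [w v = 0]. *)
Lemma torsion_transvection n k (v : 'M[R]_(n, k)) (w : 'M[R]_(k, n)) : w *m v = 0 ->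
  mx_invertible (1%:M + v *m w) /\ torsion (1%:M + v *m w) = 0.
Proof.
move=> wv.
have vwv : v *m w *m v = 0 by rewrite -mulmxA wv mulmx0.
have wvw : w *m v *m w = 0 by rewrite wv mul0mx.
have vwvw : v *m w *m v *m w = 0 by rewrite vwv mul0mx.
have iT : mx_invertible (1%:M + v *m w).
  exists (1%:M - v *m w).
  by split; rewrite !(mulmxDl, mulmxDr, mulmxN, mulNmx, mul1mx, mulmx1, mulmxA) vwvw ?oppr0 addr0
    ?subrK ?addrK.
split=> //; rewrite -(torsion_block1r k iT).
pose X (c : R) : 'M[R]_(n + k) := block_mx 1%:M (c *: v) 0 1%:M.
pose Y (c : R) : 'M[R]_(n + k) := block_mx 1%:M 0 (c *: w) 1%:M.
have XX : mx_inverse (X 1) (X (-1)).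
  split; rewrite /X mulmx_block !mulmx0 !mul0mx !addr0 !add0r !mulmx1 !mul1mx -scalerDl.
    by rewrite addNr scale0r -scalar_mx_block.
  by rewrite addrN scale0r -scalar_mx_block.
have YY : mx_inverse (Y 1) (Y (-1)).
  split; rewrite /Y mulmx_block !mulmx0 !mul0mx !addr0 !add0r !mulmx1 !mul1mx -scalerDl.
    by rewrite addrN scale0r -scalar_mx_block.
  by rewrite addNr scale0r -scalar_mx_block.
have -> : block_mx (1%:M + v *m w) 0 0 1%:M = X 1 *m Y 1 *m (X (-1) *m Y (-1)).
  rewrite /X /Y !scale1r !scaleN1r !mulmx_block !(mx0E, mulmx1, mul1mx).
  rewrite !(mulmxDl, mulmxDr, mul1mx, mulmxN, mulNmx, mulmxA, mulmx1) !(vwv, wvw, vwvw) wv.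
    by rewrite !(addr0, oppr0, add0r, subr0, opprK) addrK !addNr subrr.
have iXX := mx_inverse_invertible XX; have iYY := mx_inverse_invertible YY.
have iXX' := mx_inverse_invertible (mx_inverseC XX).
have iYY' := mx_inverse_invertible (mx_inverseC YY).
rewrite !torsionM //; try exact: mx_invertibleM.
by rewrite (torsion_inv XX) (torsion_inv YY) addrACA subrr add0r subrr.
Qed.

Lemma torsion_block_ut n N (A : 'M[R]_n) (B : 'M[R]_(n, N)) (D : 'M[R]_N) :
  mx_invertible A -> mx_invertible D ->
  mx_invertible (block_mx A B 0 D) /\ torsion (block_mx A B 0 D) = torsion A + torsion D.
Proof.
move=> iA iD; have [A' AA] := iA.
have -> : block_mx A B 0 D =
    block_mx A 0 0 D *m (1%:M + col_mx (A' *m B) 0 *m row_mx 0 1%:M).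
  rewrite mul_col_row scalar_mx_block add_block_mx mulmx_block.
  by rewrite !(addr0, add0r, mulmx0, mul0mx, mulmx1, mul1mx) mulmxA AA.1 mul1mx.
have wv0 : row_mx (0 : 'M_(N, n)) (1%:M : 'M[R]_N) *m col_mx (A' *m B) 0 = 0.
  by rewrite mul_row_col mul0mx mulmx0 addr0.
have [iT tT] := torsion_transvection wv0.
have iAD := mx_invertible_block iA iD.
split; first exact: mx_invertibleM.
by rewrite torsionM // tT addr0 torsion_block_diag.
Qed.

(** A matrix that raises a height function is a sum of multiples of its columns,
    and splitting off a nonzero column of maximal height is a transvection. *)
Lemma torsion_unitriangular n (T : 'M[R]_n) (h : 'I_n -> int) :
  (forall i j, T i j != 0 -> h j < h i) ->
  mx_invertible (1%:M + T) /\ torsion (1%:M + T) = 0.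
Proof.
have [k] := ubnP #|[pred j | col j T != 0]|; elim: k T => // k IH T le_k raiseT.
have [/existsP[j0 nz0]|] := boolP [exists j, col j T != 0]; last first.
  rewrite negb_exists => /forallP T0.
  suff -> : T = 0 by rewrite addr0 torsion1.
  apply/matrixP => i j; move/negPn/eqP: (T0 j) => /matrixP/(_ i 0).
  by rewrite !mxE.
pose j1 := [arg max_(j > j0 | col j T != 0) h j]%O.
have [nz1 max1] : col j1 T != 0 /\ forall j, col j T != 0 -> h j <= h j1.
  by rewrite /j1; case: arg_maxP => // j nz mx; split.
pose w : 'M[R]_(1, n) := delta_mx 0 j1.
pose T1 := col j1 T *m w.
have T1E i j : T1 i j = T i j1 *+ (j == j1).
  rewrite !mxE big_ord1 !mxE eqxx /=; case: (j == j1); rewrite ?mulr1 ?mulr0 //.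
have colT2 j : col j (T - T1) = if j == j1 then 0 else col j T.
  apply/matrixP => i j'; rewrite mxE [LHS]mxE [X in _ + X]mxE T1E.
  by case: eqP => [->|_]; rewrite !mxE ?subrr ?subr0.
have T2T1 : (T - T1) *m T1 = 0.
  rewrite mulmxA -/w [X in X *m w](_ : _ = 0) ?mul0mx //.
  apply/matrixP => i j; rewrite !mxE big1 // => l _; rewrite mxE [X in _ + X]mxE T1E [col _ _ _ _]mxE.
  have [->|lj] := eqVneq l j1; first by rewrite subrr mul0r.
  rewrite subr0; have [-> |nzl] := eqVneq (T l j1) 0; first by rewrite mulr0.
  have lt1 := raiseT _ _ nzl.
  have [/matrixP/(_ i 0)|/max1] := eqVneq (col l T) 0; first by rewrite !mxE => ->; rewrite mul0r.
  by rewrite leNgt lt1.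
have -> : 1%:M + T = (1%:M + (T - T1)) *m (1%:M + T1).
  by rewrite mulmxDl mul1mx mulmxDr mulmx1 T2T1 addr0 -addrA (addrC T1) subrK.
have [i2 t2] : mx_invertible (1%:M + (T - T1)) /\ torsion (1%:M + (T - T1)) = 0.
  apply: IH => [|i j].
    rewrite -ltnS; apply: leq_trans le_k; rewrite ltnS; apply: (@proper_card _ _ [pred j | col j T != 0]).
    apply/properP; split.
      by apply/fintype.subsetP => j; rewrite !inE colT2; case: ifP => // _; rewrite eqxx.
    by exists j1; rewrite !inE ?nz1 // colT2 !eqxx.
  move=> nz; apply: raiseT; apply: contraNneq nz => T0.
  rewrite mxE [X in _ + X]mxE T1E T0 add0r; have [<-|_] := eqVneq j j1; last by rewrite mulr0n oppr0.
  by rewrite T0 oppr0.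
have [i1 t1] : mx_invertible (1%:M + T1) /\ torsion (1%:M + T1) = 0.
  apply: torsion_transvection; apply/matrixP => i j; rewrite -rowE !mxE.
  by have [//|/raiseT] := eqVneq (T j1 j1) 0; rewrite ltxx.
by split; [apply: mx_invertibleM | rewrite torsionM // t1 t2 addr0].
Qed.

(** The pairs of a block and a position in it are numbered arbitrarily, so that either
    factor of a product may index the blocks. *)
Section BlockTriangular.
Variables (m n w : nat) (c : 'I_w -> 'I_m * 'I_n) (b : 'I_m * 'I_n -> 'I_w).
Hypotheses (bK : cancel b c) (cK : cancel c b).

Definition mx_blocks (F : 'I_m -> 'M[R]_n) : 'M[R]_w :=
  \matrix_(i, j) (F (c i).1 (c i).2 (c j).2 *+ ((c i).1 == (c j).1)).

Lemma mx_block_index i y x : (i == b (y, x)) = ((c i).1 == y) && ((c i).2 == x).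
Proof. by rewrite -{1}(cK i) (can_eq bK) -pair_eqE. Qed.

Lemma mx_blocksM F G : mx_blocks F *m mx_blocks G = mx_blocks (fun y => F y *m G y).
Proof.
apply/matrixP => i j; rewrite !mxE.
rewrite (reindex b); last by apply: onW_bij; exists c.
transitivity (\sum_y \sum_x mx_blocks F i (b (y, x)) * mx_blocks G (b (y, x)) j).
  by rewrite pair_bigA; apply: eq_bigr => -[].
rewrite (bigD1 (c i).1) //= [X in _ + X]big1 ?addr0 => [|y ny].
  rewrite -sumrMnl; apply: eq_bigr => x _; rewrite !mxE bK eqxx /= mulr1n.
  by rewrite mulrnAr.
by apply: big1 => x _; rewrite !mxE bK /= eq_sym (negPf ny) mulr0n mul0r.
Qed.

Lemma mx_blocks1 : mx_blocks (fun=> 1%:M) = 1%:M.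
Proof.
apply/matrixP => i j; rewrite !mxE -mulrnA; congr (_ *+ _).
by rewrite -(inj_eq (can_inj cK)) -pair_eqE /pair_eq andbC; case: ((c i).2 == _); case: ((c i).1 == _).
Qed.

Lemma mx_blocks_inverse F G : (forall y, mx_inverse (F y) (G y)) ->
  mx_inverse (mx_blocks F) (mx_blocks G).
Proof.
move=> FG; split; rewrite mx_blocksM -mx_blocks1; congr mx_blocks.
  by apply/funext => y; case: (FG y).
by apply/funext => y; case: (FG y).
Qed.

Lemma mx_blocks_invertible F : (forall y, mx_invertible (F y)) ->
  mx_invertible (mx_blocks F).
Proof.
move=> iF; exists (mx_blocks (fun y => mx_inv (F y))).
by apply: mx_blocks_inverse => y; apply: mx_invP.
Qed.

Lemma torsion_mx_blocks F : (forall y, mx_invertible (F y)) ->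
  torsion (mx_blocks F) = \sum_y torsion (F y).
Proof.
move=> iF.
pose only y := mx_blocks (fun z => if z == y then F y else 1%:M).
have ionly y : mx_invertible (only y).
  by apply: mx_blocks_invertible => z; case: ifP => // _.
have tonly y : torsion (only y) = torsion (F y).
  pose U : 'M[R]_(w, n) := \matrix_(i, j) (i == b (y, j))%:R.
  pose V : 'M[R]_(n, w) := \matrix_(j, i) (i == b (y, j))%:R.
  have UE (X : 'M[R]_(w, n)) i j : (V *m X) j i = X (b (y, j)) i.
    rewrite !mxE (bigD1 (b (y, j))) //= mxE eqxx mul1r big1 ?addr0 // => k nk.
    by rewrite mxE (negPf nk) mul0r.
  have VU : V *m U = 1%:M.
    by apply/matrixP => i j; rewrite UE !mxE (can_eq bK) xpair_eqE eqxx.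
  rewrite -(torsion_embed VU (iF y)); congr torsion; apply/matrixP => i j.
  rewrite mxE [RHS]mxE [in RHS]mxE.
  have rowU k (X : 'M[R]_(n, k)) l : (U *m X) i l = X (c i).2 l *+ ((c i).1 == y).
    rewrite mxE; have [iy|niy] := eqVneq (c i).1 y; last first.
      rewrite big1 ?mulr0n // => x _; rewrite mxE; case: eqP => [ei|]; last by rewrite mul0r.
      by rewrite ei bK eqxx in niy.
    rewrite mulr1n (bigD1 (c i).2) //= mxE mx_block_index iy !eqxx mul1r.
    rewrite big1 ?addr0 // => x nx; rewrite mxE mx_block_index.
    by rewrite (eq_sym _ x) (negPf nx) andbF mul0r.
  rewrite -mulmxA rowU.
  have colV k (X : 'M[R]_(k, n)) l : (X *m V) l j = X l (c j).2 *+ ((c j).1 == y).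
    rewrite mxE; have [iy|niy] := eqVneq (c j).1 y; last first.
      rewrite big1 ?mulr0n // => x _; rewrite mxE; case: eqP => [ei|]; last by rewrite mulr0.
      by rewrite ei bK eqxx in niy.
    rewrite mulr1n (bigD1 (c j).2) //= mxE mx_block_index iy !eqxx mulr1.
    rewrite big1 ?addr0 // => x nx; rewrite mxE mx_block_index.
    by rewrite (eq_sym _ x) (negPf nx) andbF mulr0.
  rewrite colV -(can_eq cK i j) -pair_eqE /pair_eq /= !mxE.
  have [iy|niy] := eqVneq (c i).1 y.
    rewrite iy (eq_sym y); have [jy|njy] := eqVneq (c j).1 y; last first.
      by rewrite /= !mulr0n addr0.
    by rewrite /= !mulr1n addrC subrK.
  rewrite !mulr0n addr0 mxE -mulrnA; congr (_ *+ _).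
  by case: ((c i).1 == _); case: ((c i).2 == _).
have -> : mx_blocks F = \big[@mulmx R w w w/1%:M]_(y <- enum 'I_m) only y.
  have H s : uniq s -> \big[@mulmx R w w w/1%:M]_(y <- s) only y =
      mx_blocks (fun z => if z \in s then F z else 1%:M).
    elim: s => [|y s IH] /=; first by rewrite big_nil mx_blocks1.
    case/andP=> ys us; rewrite big_cons IH // mx_blocksM; congr mx_blocks.
    apply/funext => z; rewrite inE; case: eqP => [->|_]; rewrite ?mul1mx //=.
    by rewrite (negPf ys) mulmx1.
  rewrite H ?enum_uniq //; congr mx_blocks; apply/funext => z.
  by rewrite mem_enum.
rewrite -big_enum /=; elim: (enum _) => [|y s IH]; first by rewrite !big_nil torsion1.
rewrite !big_cons torsionM // ?IH ?tonly //.
by elim: s {IH} => [|z s IH]; rewrite ?big_nil ?big_cons //; apply: mx_invertibleM.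
Qed.

(** The diagonal blocks split off a unitriangular factor. *)
Lemma torsion_block_triangular (B : 'M[R]_w) (F : 'I_m -> 'M[R]_n) (h : 'I_m -> int) :
  (forall y, mx_invertible (F y)) ->
  (forall y x x', B (b (y, x)) (b (y, x')) = F y x x') ->
  (forall y x y' x', y != y' -> B (b (y, x)) (b (y', x')) != 0 -> h y' < h y) ->
  mx_invertible B /\ torsion B = \sum_y torsion (F y).
Proof.
move=> iF diagB triB.
pose F' y := mx_inv (F y).
have FF : mx_inverse (mx_blocks F) (mx_blocks F').
  by apply: mx_blocks_inverse => y; apply: mx_invP.
pose T := mx_blocks F' *m (B - mx_blocks F).
have [iT tT] : mx_invertible (1%:M + T) /\ torsion (1%:M + T) = 0.
  apply: (torsion_unitriangular (h := fun i => h (c i).1)) => i j nz.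
  have [//|hij] := boolP (h (c j).1 < h (c i).1).
  case/eqP: nz; rewrite mxE big1 // => k _; rewrite !mxE.
  have [eik|] := eqVneq (c i).1 (c k).1; last by rewrite mulr0n mul0r.
  suff -> : B k j - F (c k).1 (c k).2 (c j).2 *+ ((c k).1 == (c j).1) = 0 by rewrite mulr0.
  rewrite -{1}(cK k) -{1}(cK j); case: (c k) eik => y x /= eik; case: (c j) hij => y' x' /=.
  rewrite eik; have [->|nyy] := eqVneq y y'; first by rewrite diagB subrr.
  move=> hij; rewrite subr0; apply: contraNeq hij.
  exact: triB.
have -> : B = mx_blocks F *m (1%:M + T).
  by rewrite mulmxDr mulmx1 mulmxA FF.1 mul1mx addrC subrK.
have iF' := mx_inverse_invertible FF.
by split; [apply: mx_invertibleM | rewrite torsionM // tT addr0 torsion_mx_blocks].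
Qed.

End BlockTriangular.

Lemma torsion_triangular_signs n (s : 'I_n -> bool) (h : 'I_n -> int) (A : 'M[R]_n) :
  (forall i, A i i = (-1) ^+ s i) ->
  (forall i j, i != j -> A i j != 0 -> h j < h i) ->
  mx_invertible A /\ torsion A = tN1 *+ #|[pred i | s i]|.
Proof.
move=> diagA triA; pose c (i : 'I_n) := (i, ord0 : 'I_1); pose b (p : 'I_n * 'I_1) := p.1.
have bK : cancel b c by case=> i j; rewrite /c /b /= (ord1 j).
have cK : cancel c b by [].
have iF y : mx_invertible (((-1) ^+ s y)%:M : 'M[R]_1).
  by exists ((-1) ^+ s y)%:M; split; rewrite -scalar_mxM -expr2 sqrr_sign.
have [|y x y' x'|iA ->] := torsion_block_triangular (B := A)
  (F := fun y => ((-1) ^+ s y)%:M : 'M[R]_1) (h := h) bK cK iF.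
- by move=> y x x'; rewrite mxE !ord1 eqxx diagA.
- exact: triA.
split=> //; rewrite (bigID s) /= [X in _ + X]big1 ?addr0 => [|y /negPf->]; last first.
  by rewrite expr0 torsion1.
rewrite (eq_bigr (fun=> tN1)) => [|y ->]; last by rewrite expr1.
by rewrite sumr_const.
Qed.

Lemma torsion_diag_sign n (s : 'I_n -> bool) (A : 'M[R]_n) :
  A = \matrix_(i, j) ((-1) ^+ s i *+ (i == j)) ->
  mx_invertible A /\ torsion A = tN1 *+ #|[pred i | s i]|.
Proof.
move=> ->; apply: (torsion_triangular_signs (h := fun=> 0)) => [i|i j /negPf nij].
  by rewrite mxE eqxx.
by rewrite mxE nij mulr0n eqxx.
Qed.

Lemma mx_inverseN1 : mx_inverse ((-1)%:M : 'M[R]_1) (-1)%:M.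
Proof. by split; rewrite -scalar_mxM mulrNN mulr1. Qed.

Lemma torsionN1_double : tN1 *+ 2 = 0.
Proof.
have iN1 := mx_inverse_invertible mx_inverseN1.
by rewrite mulr2n -torsionM // mx_inverseN1.1 torsion1.
Qed.

Lemma torsionN1_odd k : tN1 *+ k =
  tN1 *+ odd k.
Proof.
by rewrite -{1}(odd_double_half k) mulrnDr -muln2 mulnC mulrnA torsionN1_double mul0rn addr0.
Qed.

(** With [u = e_i - e_j] the transposition is [1 - u u^T]; up to the
    transvection [1 - u (e_i + e_j)^T] it is the reflection [1 - 2 u e_i^T],
    which is the automorphism -1 of the summand spanned by [u]. *)
Lemma torsion_tperm n (i j : 'I_n) : i != j ->
  mx_invertible (perm_mx (tperm i j) : 'M[R]_n) /\
  torsion (perm_mx (tperm i j) : 'M[R]_n) = tN1.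
Proof.
move=> nij; pose ei : 'cV[R]_n := delta_mx i 0; pose ej : 'cV[R]_n := delta_mx j 0.
have e1 : ei^T *m ei = 1%:M by rewrite trmx_delta mul_delta_mx; apply/matrixP => a c; rewrite !ord1 !mxE.
have e2 : ej^T *m ej = 1%:M by rewrite trmx_delta mul_delta_mx; apply/matrixP => a c; rewrite !ord1 !mxE.
have e3 : ei^T *m ej = 0 by rewrite trmx_delta mul_delta_mx_0.
have e4 : ej^T *m ei = 0 by rewrite trmx_delta mul_delta_mx_0 // eq_sym.
pose u := ei - ej; pose E := mx_embed u ei^T (-1)%:M.
have VU : ei^T *m u = 1%:M by rewrite mulmxBr e1 e3 subr0.
have iN1 := mx_inverse_invertible mx_inverseN1.
have wv : - (ei + ej)^T *m u = 0.
  by rewrite mulNmx linearD /= mulmxDl !mulmxBr e1 e2 e3 e4 subr0 sub0r subrr oppr0.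
have [iT tT] := torsion_transvection wv.
have iE := mx_embed_invertible VU iN1.
suff -> : perm_mx (tperm i j) = E *m (1%:M + u *m - (ei + ej)^T).
  by split; [apply: mx_invertibleM | rewrite torsionM // tT addr0 torsion_embed].
have -> : perm_mx (tperm i j) = 1%:M - u *m u^T.
  apply/matrixP => a c; rewrite !mxE big_ord1 !mxE eqxx !andbT.
  case: tpermP => [->|->|/eqP na /eqP na']; rewrite ?eqxx ?(negPf nij) ?(eq_sym j) ?(negPf nij).
  - by rewrite subr0 mul1r (eq_sym i) opprB addrC subrK.
  - by rewrite sub0r mulN1r opprK (eq_sym i) addrC subrK.
  - by rewrite (negPf na) (negPf na') subrr mul0r subr0.
have -> : E = 1%:M - (u *m ei^T + u *m ei^T).
  have N2 : (-1)%:M - 1%:M = - (1%:M + 1%:M) :> 'M[R]_1 by rewrite opprD raddfN.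
  by rewrite /E /mx_embed N2 mulmxN mulNmx mulmxDr mulmx1 mulmxDl.
have uw : u *m ei^T *m (u *m - (ei + ej)^T) = u *m - (ei + ej)^T.
  by rewrite mulmxA -(mulmxA u) VU mulmx1.
rewrite [in RHS]mulmxBl mul1mx (mulmxDr (_ + _)) mulmx1 (mulmxDl _ _ (u *m - _)) uw.
have -> : u *m - (ei + ej)^T = - (u *m ei^T) - u *m ej^T.
  by rewrite mulmxN linearD /= mulmxDr opprD.
have -> : u *m u^T = u *m ei^T - u *m ej^T by rewrite linearB /= mulmxBr.
move: (u *m ei^T) (u *m ej^T) => X Y.
have XY : X + (- X - Y) = - Y by rewrite addrA subrr sub0r.
rewrite (addrACA X X) XY -!addrA; congr (_ + _).
by rewrite opprB opprD !opprK addKr addrC.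
Qed.

Lemma torsion_perm_mx n (s : 'S_n) :
  mx_invertible (perm_mx s : 'M[R]_n) /\
  torsion (perm_mx s : 'M[R]_n) = tN1 *+ s.
Proof.
have [ts -> dts] := prod_tpermP s; rewrite odd_perm_prod // -torsionN1_odd.
elim: ts dts => [|[i j] ts IH] /=; first by rewrite big_nil perm_mx1 torsion1.
case/andP=> nij /IH [iS tS]; rewrite big_cons perm_mxM.
have [iT tT] := torsion_tperm nij.
by split; [apply: mx_invertibleM | rewrite torsionM // tT tS mulrS].
Qed.

Lemma torsion_mxsub_perm n (s t : 'S_n) (A : 'M[R]_n) : mx_invertible A ->
  mx_invertible (mxsub s t A) /\
  torsion (mxsub s t A) = torsion A + tN1 *+ (s + t).
Proof.
move=> iA; have -> : mxsub s t A = perm_mx s *m A *m perm_mx t^-1.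
  rewrite -row_permE; apply/matrixP => i j.
  by rewrite -col_permE !mxE.
have [iS tS] := torsion_perm_mx s; have [iT tT] := torsion_perm_mx t^-1.
split; first by do !apply: mx_invertibleM.
rewrite !torsionM ?tS ?tT //; last by apply: mx_invertibleM.
by rewrite odd_permV mulrnDr addrAC addrC.
Qed.
End Torsion.

(** The Vandermonde determinant of [0, ..., n-1] is positive, and permuting the
    nodes by [s] changes the sign of one factor for each inversion. *)
Lemma odd_perm_inversions n (s : 'S_n) :
  s = odd #|[pred p : 'I_n * 'I_n | (p.1 < p.2)%N && (s p.2 < s p.1)%N]| :> bool.
Proof.
pose a (t : 'S_n) : 'rV[int]_n := \row_i (t i)%:Z.
have dV t : Num.sg (\det (Vandermonde n (a t))) =
    (-1) ^+ #|[pred p : 'I_n * 'I_n | (p.1 < p.2)%N && (t p.2 < t p.1)%N]|.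
  rewrite det_Vandermonde pair_big_dep /=.
  rewrite (big_morph Num.sg (@sgrM _) (@sgr1 _)) (bigID (fun p : 'I_n * 'I_n => t p.2 < t p.1)%N) /=.
  rewrite [X in _ * X]big1 ?mulr1 => [|p /andP[lt12]]; last first.
    rewrite -leqNgt leq_eqVlt => /orP[/eqP/val_inj/perm_inj e|lt].
      by rewrite e ltnn in lt12.
    by rewrite !mxE gtr0_sg // subr_gt0 ltz_nat.
  rewrite (eq_bigr (fun=> -1)) => [|p /andP[_ lt]]; last first.
    by rewrite !mxE ltr0_sg // subr_lt0 ltz_nat.
  by rewrite prodr_const.
have ds : Num.sg (\det (Vandermonde n (a s))) =
    (-1) ^+ s * Num.sg (\det (Vandermonde n (a 1%g))).
  have -> : Vandermonde n (a s) = col_perm s (Vandermonde n (a 1%g)).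
    by apply/matrixP => i j; rewrite !mxE perm1.
  by rewrite col_permE det_mulmx det_perm odd_permV mulrC sgrM; case: (s : bool); rewrite ?expr1 ?expr0 ?sgrN sgr1.
move: ds; rewrite !dV [X in _ * (-1) ^+ X]eq_card0 ?expr0 ?mulr1 => [|p]; last first.
  by rewrite !inE !perm1; case: ltngtP.
rewrite -signr_odd => /eqP; rewrite eq_sym => /eqP.
by case: (s : bool); case: (odd _).
Qed.

(** * Contractible complexes on a single graded basis *)

Definition oddz (k : int) : bool := odd `|k|%N.

Lemma oddzD k l : oddz (k + l) = oddz k (+) oddz l.
Proof. by rewrite /oddz; lia. Qed.

Lemma oddzN k : oddz (- k) = oddz k.
Proof. by rewrite /oddz abszN. Qed.

Section Graded.
Variable R : pzRingType.

Definition homog m n (dt : 'I_m -> int) (ds : 'I_n -> int) (k : int) (A : 'M[R]_(m, n)) :=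
  forall i j, A i j != 0 -> dt i = ds j + k.

Lemma homog0 m n (dt : 'I_m -> int) (ds : 'I_n -> int) k : homog dt ds k 0.
Proof. by move=> i j; rewrite mxE eqxx. Qed.

Lemma homog1 n (d : 'I_n -> int) : homog d d 0 1%:M.
Proof. by move=> i j; rewrite mxE addr0; have [->//|_] := eqVneq i j; rewrite eqxx. Qed.

Lemma homogN m n (dt : 'I_m -> int) (ds : 'I_n -> int) k A :
  homog dt ds k A -> homog dt ds k (- A).
Proof. by move=> hA i j; rewrite mxE oppr_eq0; apply: hA. Qed.

Lemma homogD m n (dt : 'I_m -> int) (ds : 'I_n -> int) k A B :
  homog dt ds k A -> homog dt ds k B -> homog dt ds k (A + B).
Proof.
move=> hA hB i j; rewrite mxE; have [->|/hA//] := eqVneq (A i j) 0.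
by rewrite add0r; apply: hB.
Qed.

Lemma homogM m n p (dt : 'I_m -> int) (dn : 'I_n -> int) (ds : 'I_p -> int) k l A B :
  homog dt dn k A -> homog dn ds l B -> homog dt ds (l + k) (A *m B).
Proof.
move=> hA hB i j nz.
have [h|/existsPn h0] := boolP [exists z, (A i z != 0) && (B z j != 0)].
  by case/existsP: h => z /andP[/hA-> /hB->]; rewrite addrA.
case/eqP: nz; rewrite mxE big1 // => z _; have := h0 z; rewrite negb_and !negbK.
by case/orP => /eqP->; rewrite ?mul0r ?mulr0.
Qed.

Record contraction w (deg : 'I_w -> int) (d G : 'M[R]_w) : Prop := Contraction {
  contr_d : homog deg deg (-1) d;
  contr_dd : d *m d = 0;
  contr_G : homog deg deg 1 G;
  contr_dG : d *m G + G *m d = 1%:M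
}.

(** Frames stand for the bases of the odd and the even part of a complex, listed in
    any order. *)
Record frame w n (P : 'I_w -> bool) (f : 'I_n -> 'I_w) : Prop := Frame {
  frame_inj : injective f;
  frameP : forall z, P z = (z \in codom f)
}.

Lemma frame_mem w n P (f : 'I_n -> 'I_w) x : frame P f -> P (f x).
Proof. by move=> fP; rewrite (frameP fP) codom_f. Qed.

Lemma mxsub_frameM w a b c (P : 'I_w -> bool) (h : 'I_b -> 'I_w)
    (f : 'I_a -> 'I_w) (g : 'I_c -> 'I_w) (A B : 'M[R]_w) : frame P h ->
  (forall i j, B i (g j) != 0 -> P i) ->
  mxsub f h A *m mxsub h g B = mxsub f g (A *m B).
Proof.
move=> hP nzB; apply/matrixP => i j; rewrite !mxE.
rewrite [RHS](bigID P) /= [X in _ = _ + X]big1 ?addr0; last first.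
  move=> z; apply: contraNeq => nz; apply: nzB (j) _.
  by apply: contraNneq nz => ->; rewrite mulr0.
rewrite (eq_bigl [in codom h]) => [|z]; last by rewrite (frameP hP).
have uh : uniq (codom h) by apply/injectiveP; apply: frame_inj hP.
by rewrite -(big_uniq _ uh) /= big_image /=; apply: eq_bigr => x _; rewrite !mxE.
Qed.

Arguments mxsub_frameM {w a b c P h f g A B}.

Lemma mxsub_frame1 w n P (f : 'I_n -> 'I_w) : frame P f ->
  mxsub f f 1%:M = 1%:M :> 'M[R]_n.
Proof.
by move=> fP; apply/matrixP => i j; rewrite !mxE (inj_eq (frame_inj fP)).
Qed.

(** As [G G] raises degrees by 2, the right hand side is unitriangular. This makes
    the two folds of [d + G], from the odd to the even part and back, invertible and
    inverse to each other up to a matrix without torsion. *)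
Lemma contraction_sqr w (deg : 'I_w -> int) d G : contraction deg d G ->
  (d + G) *m (d + G) = 1%:M + G *m G.
Proof.
move=> cG; rewrite mulmxDl !mulmxDr (contr_dd cG) add0r addrA.
by rewrite (contr_dG cG).
Qed.

Section Fold.
Variables (w a b : nat) (deg : 'I_w -> int).
Let even z := ~~ oddz (deg z).
Let odd z := oddz (deg z).
Variables (e : 'I_a -> 'I_w) (o : 'I_b -> 'I_w).
Hypotheses (eP : frame even e) (oP : frame odd o).

Section Contraction.
Variables (d G : 'M[R]_w).
Hypothesis cG : contraction deg d G.

Lemma contraction_odd i j : (d + G) i j != 0 -> oddz (deg i) = ~~ oddz (deg j).
Proof.
rewrite mxE; have [->|/(contr_d cG)->] := eqVneq (d i j) 0; last by rewrite oddzD addbT.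
by rewrite add0r => /(contr_G cG)->; rewrite oddzD addbT.
Qed.

Lemma fold_oe_eo : mxsub o e (d + G) *m mxsub e o (d + G) = 1%:M + mxsub o o (G *m G).
Proof.
rewrite (mxsub_frameM eP) => [|i j /contraction_odd]; last first.
  by rewrite /even => ->; rewrite negbK; apply: (frame_mem j oP).
by rewrite (contraction_sqr cG) raddfD /= (mxsub_frame1 oP).
Qed.

Lemma fold_eo_oe : mxsub e o (d + G) *m mxsub o e (d + G) = 1%:M + mxsub e e (G *m G).
Proof.
rewrite (mxsub_frameM oP) => [|i j /contraction_odd]; last first.
  by rewrite /odd => ->; apply: (frame_mem j eP).
by rewrite (contraction_sqr cG) raddfD /= (mxsub_frame1 eP).
Qed.

Lemma unitri_raising n (f : 'I_n -> 'I_w) (k : int) (T : 'M[R]_w) : 0 < k -> homog deg deg k T ->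
  mx_invertible (1%:M + mxsub f f T) /\ torsion (1%:M + mxsub f f T) = 0.
Proof.
move=> k0 hT; apply: (torsion_unitriangular (h := fun i => deg (f i))) => i j.
by rewrite !mxE => /hT->; rewrite ltrDl.
Qed.

Lemma homog_GG : homog deg deg 2 (G *m G).
Proof. exact: homogM (contr_G cG) (contr_G cG). Qed.

Lemma fold_rect_inverse : exists M : 'M[R]_(b, a),
  mxsub e o (d + G) *m M = 1%:M /\ M *m mxsub e o (d + G) = 1%:M.
Proof.
have [[X [X1 X2]] _] := unitri_raising o (ltr0n _ 2) homog_GG.
have [[Y [Y1 Y2]] _] := unitri_raising e (ltr0n _ 2) homog_GG.
exists (X *m mxsub o e (d + G)); split; last by rewrite -mulmxA fold_oe_eo.
rewrite -[LHS]mulmx1 -Y1 -fold_eo_oe !mulmxA -(mulmxA (mxsub e o _ *m X)) fold_oe_eo.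
by rewrite -(mulmxA (mxsub e o _)) X2 mulmx1 fold_eo_oe.
Qed.
End Contraction.
End Fold.

Section FoldSquare.
Variables (w n : nat) (deg : 'I_w -> int).
Variables (e o : 'I_n -> 'I_w).
Hypotheses (eP : frame (fun z => ~~ oddz (deg z)) e) (oP : frame (fun z => oddz (deg z)) o).

Lemma fold_invertible d G : contraction deg d G ->
  mx_invertible (mxsub e o (d + G)) /\ mx_invertible (mxsub o e (d + G)).
Proof.
move=> cG; have [M [M1 M2]] := fold_rect_inverse eP oP cG.
have iM : mx_invertible (mxsub e o (d + G)) by exists M.
split=> //.
have [iU _] := unitri_raising o (ltr0n _ 2) (homog_GG cG).
have -> : mxsub o e (d + G) = (1%:M + mxsub o o (G *m G)) *m M.
  by rewrite -(fold_oe_eo eP oP cG) -mulmxA M1 mulmx1.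
by apply: mx_invertibleM => //; exists (mxsub e o (d + G)).
Qed.

Lemma torsion_fold_oe d G : contraction deg d G ->
  torsion (mxsub o e (d + G)) = - torsion (mxsub e o (d + G)).
Proof.
move=> cG; have [iM iM'] := fold_invertible cG; apply/eqP; rewrite -addr_eq0.
rewrite -torsionM // (fold_oe_eo eP oP cG).
by have [_ ->] := unitri_raising o (ltr0n _ 2) (homog_GG cG).
Qed.

(** For contractions [G], [G'] put [D = (G' - G) G].  As [d (G' - G) = - (G' - G) d],
    the automorphism [1 + D] conjugates [d + G] into [d + G'] up to terms that
    raise degrees by 3. *)
Lemma torsion_fold_indep d G G' : contraction deg d G -> contraction deg d G' ->
  torsion (mxsub e o (d + G)) = torsion (mxsub e o (d + G')).
Proof.
move=> cG cG'; pose D := (G' - G) *m G; pose m := d + G; pose m' := d + G'.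
have hG := contr_G cG; have hG' := contr_G cG'.
have hD : homog deg deg 2 D by apply: (homogM (k := 1) _ hG); apply: homogD => //; apply: homogN.
pose Z := G' *m D - D *m G.
have hZ : homog deg deg 3 Z.
  by apply: homogD; [apply: (homogM hG' hD)|apply/homogN/(homogM hD hG)].
have anti : d *m (G' - G) = - ((G' - G) *m d).
  apply/eqP; rewrite -addr_eq0 mulmxBr mulmxBl addrACA -opprD.
  by rewrite (contr_dG cG) (contr_dG cG') subrr.
have dD : d *m D = D *m d - (G' - G).
  rewrite /D mulmxA anti mulNmx -!mulmxA -[in RHS](addrK (d *m G) (G *m d)) (addrC (G *m d)).
  by rewrite (contr_dG cG) mulmxBr mulmx1 addrAC subrr add0r.
have key : m' *m (1%:M + D) = (1%:M + D) *m m + Z.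
  rewrite /m /m' /Z [LHS]mulmxDr mulmx1 [(d + G') *m D]mulmxDl dD.
  rewrite [(1%:M + D) *m _]mulmxDl mul1mx [D *m (d + G)]mulmxDr.
  move: (D *m d) (D *m G) (G' *m D) => X Y V.
  zmodule.
have [iD tD] := unitri_raising o (ltr0n _ 2) hD.
have [iM iM'] := fold_invertible cG; have [iN _] := fold_invertible cG'.
have eoM : mxsub e o m' *m (1%:M + mxsub o o D) *m mxsub o e m =
    1%:M + mxsub e e (D + (G *m G + D *m (G *m G)) + Z *m m).
  rewrite -[in LHS](mxsub_frame1 oP) -raddfD /= (mxsub_frameM oP) => [|i j]; last first.
    rewrite mxE; have [->|/hD->] := eqVneq (D i (o j)) 0.
      rewrite addr0 mxE; have [->|_] := eqVneq i (o j); first by rewrite (frame_mem j oP).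
      by rewrite eqxx.
    by rewrite oddzD addbF (frame_mem j oP).
  rewrite (mxsub_frameM oP) => [|i j /(contraction_odd cG)->]; last by rewrite (frame_mem j eP).
  rewrite key mulmxDl -mulmxA (contraction_sqr cG) -/m mulmxDl mul1mx mulmxDr mulmx1.
  by rewrite -[in RHS](mxsub_frame1 eP) -raddfD /=; congr mxsub; zmodule.
have hT : forall i j, (D + (G *m G + D *m (G *m G)) + Z *m m) i j != 0 -> deg j < deg i.
  have step (A B : 'M[R]_w) : (forall i j, A i j != 0 -> deg j < deg i) ->
      (forall i j, B i j != 0 -> deg j < deg i) -> forall i j, (A + B) i j != 0 -> deg j < deg i.
    move=> hA hB i j; rewrite mxE; have [->|/hA//] := eqVneq (A i j) 0.
    by rewrite add0r; apply: hB.
  have pos k (A : 'M[R]_w) : 0 < k -> homog deg deg k A -> forall i j, A i j != 0 -> deg j < deg i.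
    by move=> k0 hA i j /hA->; rewrite ltrDl.
  have hGG := homog_GG cG.
  apply: (step); [apply: (step); [|apply: (step)] | rewrite /m mulmxDr; apply: (step)].
  - exact: pos hD.
  - exact: pos hGG.
  - exact: pos (homogM hD hGG).
  - exact: pos (homogM hZ (contr_d cG)).
  - exact: pos (homogM hZ hG).
have [iT] := torsion_unitriangular (T := mxsub e e (D + (G *m G + D *m (G *m G)) + Z *m m))
  (h := fun i => deg (e i)) (fun i j nz => hT _ _ (eq_ind _ (fun x => x != 0) nz _ (mxE _ _ _ _))).
rewrite -eoM !torsionM //; last exact: mx_invertibleM.
rewrite tD addr0 (torsion_fold_oe cG) => /eqP.
by rewrite subr_eq0 => /eqP.
Qed.
End FoldSquare.
End Graded.

Arguments mxsub_frameM {R w a b c P h f g A B}.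

(** * Torsions of chain equivalences between based complexes *)

Definition degs m n (d1 : 'I_m -> int) (d2 : 'I_n -> int) (z : 'I_(m + n)) : int :=
  match split z with inl x => d1 x | inr y => d2 y end.

Lemma degs_l m n (d1 : 'I_m -> int) (d2 : 'I_n -> int) x : degs d1 d2 (lshift n x) = d1 x.
Proof. by rewrite /degs (unsplitK (inl x)). Qed.

Lemma degs_r m n (d1 : 'I_m -> int) (d2 : 'I_n -> int) y : degs d1 d2 (rshift m y) = d2 y.
Proof. by rewrite /degs (unsplitK (inr y)). Qed.

Lemma splitW m n (P : 'I_(m + n) -> Prop) :
  (forall x, P (lshift n x)) -> (forall y, P (rshift m y)) -> forall z, P z.
Proof. by move=> Pl Pr z; rewrite -(splitK z); case: (split z). Qed.

Section BlockGraded.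
Variable R : pzRingType.
Local Notation tN1 := (torsion ((-1)%:M : 'M[R]_1)).

Lemma homog_block m1 m2 n1 n2 (dt1 : 'I_m1 -> int) (dt2 : 'I_m2 -> int)
    (ds1 : 'I_n1 -> int) (ds2 : 'I_n2 -> int) k (A : 'M[R]_(m1, n1)) B C D :
  homog dt1 ds1 k A -> homog dt1 ds2 k B -> homog dt2 ds1 k C -> homog dt2 ds2 k D ->
  homog (degs dt1 dt2) (degs ds1 ds2) k (block_mx A B C D).
Proof.
move=> hA hB hC hD; apply: splitW => i; apply: splitW => j;
rewrite ?block_mxE4 !(degs_l, degs_r).
- exact: hA.
- exact: hB.
- exact: hC.
- exact: hD.
Qed.

Lemma homog_blockK m1 m2 n1 n2 (dt1 : 'I_m1 -> int) (dt2 : 'I_m2 -> int)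
    (ds1 : 'I_n1 -> int) (ds2 : 'I_n2 -> int) k (A : 'M[R]_(m1, n1)) B C D :
  homog (degs dt1 dt2) (degs ds1 ds2) k (block_mx A B C D) ->
  [/\ homog dt1 ds1 k A, homog dt1 ds2 k B, homog dt2 ds1 k C & homog dt2 ds2 k D].
Proof.
move=> h; split=> i j.
- by have := h (lshift _ i) (lshift _ j); rewrite block_mxEul !degs_l.
- by have := h (lshift _ i) (rshift _ j); rewrite block_mxEur degs_l degs_r.
- by have := h (rshift _ i) (lshift _ j); rewrite block_mxEdl degs_l degs_r.
- by have := h (rshift _ i) (rshift _ j); rewrite block_mxEdr !degs_r.
Qed.

(** In an extension of contractible complexes the contractions of the two ends need
    only the correction [- G1 K G2]. *)
Lemma contraction_ext m n (d1 : 'I_m -> int) (d2 : 'I_n -> int) A G1 B G2 (K : 'M[R]_(m, n)) :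
  contraction d1 A G1 -> contraction d2 B G2 -> homog d1 d2 (-1) K ->
  A *m K + K *m B = 0 ->
  contraction (degs d1 d2) (block_mx A K 0 B) (block_mx G1 (- (G1 *m K *m G2)) 0 G2).
Proof.
move=> c1 c2 hK dK; split.
- apply: homog_block => //; [exact: contr_d c1 | exact: homog0 | exact: contr_d c2].
- rewrite mulmx_block !mx0E (contr_dd c1) (contr_dd c2) dK.
  exact: block_mx0.
- apply: homog_block; [exact: contr_G c1 | | exact: homog0 | exact: contr_G c2].
  by apply/homogN/(homogM (homogM (contr_G c1) hK) (contr_G c2)).
- rewrite !mulmx_block !mx0E add_block_mx addr0.
  rewrite (contr_dG c1) (contr_dG c2).
  suff -> : A *m - (G1 *m K *m G2) + K *m G2 + (G1 *m K + - (G1 *m K *m G2) *m B) = 0.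
    by rewrite -scalar_mx_block.
  have AG : A *m G1 = 1%:M - G1 *m A by rewrite -(contr_dG c1) addrK.
  have GB : G2 *m B = 1%:M - B *m G2 by rewrite -(contr_dG c2) addrC addKr.
  have KB : K *m B = - (A *m K) by apply/eqP; rewrite -addr_eq0 addrC dK.
  rewrite mulmxN mulNmx !mulmxA AG -(mulmxA _ G2 B) GB mulmxBr mulmx1.
  rewrite mulmxBl mul1mx mulmxBl -(mulmxA G1 K) (mulmxA K B) KB mulNmx mulmxN !mulmxA.
  zmodule.
Qed.

Lemma contraction_summand m n (d1 : 'I_m -> int) (d2 : 'I_n -> int) (A : 'M[R]_m) B G :
  contraction (degs d1 d2) (block_mx A 0 0 B) G -> contraction d1 A (ulsubmx G).
Proof.
rewrite -(submxK G) block_mxKul; move: (ulsubmx G) (ursubmx G) (dlsubmx G) (drsubmx G).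
move=> G1 X Y G2 [h dd hG].
rewrite !mulmx_block !mx0E add_block_mx scalar_mx_block.
move=> /eq_block_mx[dG _ _ _]; split=> //.
- by have [] := homog_blockK h.
- move: dd; rewrite mulmx_block !mx0E -[RHS]block_mx0.
  by case/eq_block_mx.
- by have [] := homog_blockK hG.
Qed.

Lemma contraction_conj w (deg deg' : 'I_w -> int) (d G S S' : 'M[R]_w) :
  mx_inverse S S' -> homog deg' deg 0 S -> homog deg deg' 0 S' ->
  contraction deg d G -> contraction deg' (S *m d *m S') (S *m G *m S').
Proof.
move=> [SS S'S] hS hS' cG.
have cj A B : S *m A *m S' *m (S *m B *m S') = S *m (A *m B) *m S'.
  by rewrite !mulmxA -(mulmxA (S *m A) S') S'S mulmx1.
split.
- by have := homogM (homogM hS (contr_d cG)) hS'; rewrite add0r addr0.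
- by rewrite cj (contr_dd cG) mulmx0 mul0mx.
- by have := homogM (homogM hS (contr_G cG)) hS'; rewrite add0r addr0.
- by rewrite !cj -mulmxDl -mulmxDr (contr_dG cG) mulmx1.
Qed.

Definition signs_mx n (s : 'I_n -> bool) : 'M[R]_n :=
  \matrix_(i, j) ((-1) ^+ s i *+ (i == j)).

Lemma signs_mulmx m n (s : 'I_m -> bool) (A : 'M[R]_(m, n)) i j :
  (signs_mx s *m A) i j = (-1) ^+ s i * A i j.
Proof.
rewrite mxE (bigD1 i) //= mxE eqxx mulr1n big1 ?addr0 // => k nk.
by rewrite mxE eq_sym (negPf nk) mulr0n mul0r.
Qed.

Lemma mulmx_signs m n (s : 'I_n -> bool) (A : 'M[R]_(m, n)) i j :
  (A *m signs_mx s) i j = (-1) ^+ s j * A i j.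
Proof.
rewrite mxE (bigD1 j) //= mxE eqxx mulr1n big1 ?addr0 => [|k nk].
  by case: (s j); rewrite ?expr0 ?expr1 ?mulrN1 ?mulN1r ?mulr1 ?mul1r.
by rewrite mxE (negPf nk) mulr0n mulr0.
Qed.

Lemma signs_mxK n (s : 'I_n -> bool) : signs_mx s *m signs_mx s = 1%:M.
Proof.
apply/matrixP => i j; rewrite signs_mulmx !mxE mulrnAr.
by case: (s i); rewrite ?expr0 ?expr1 ?mulrNN ?mulr1.
Qed.

(** With these signs the differentials of cones and of products have square zero. *)
Definition sgnmx n (deg : 'I_n -> int) : 'M[R]_n := signs_mx (fun i => oddz (deg i)).

Lemma homog_sgnmx n (deg : 'I_n -> int) : homog deg deg 0 (sgnmx deg).
Proof.
by move=> i j; rewrite mxE addr0; have [->|_] := eqVneq i j; rewrite ?mulr0n ?eqxx.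
Qed.

Lemma mul_sgnmx m n (deg : 'I_m -> int) (A : 'M[R]_(m, n)) i j :
  (sgnmx deg *m A) i j = (-1) ^+ oddz (deg i) * A i j.
Proof. exact: signs_mulmx. Qed.

Lemma mulmx_sgn m n (deg : 'I_n -> int) (A : 'M[R]_(m, n)) i j :
  (A *m sgnmx deg) i j = (-1) ^+ oddz (deg j) * A i j.
Proof. exact: mulmx_signs. Qed.

Lemma sgnmxK n (deg : 'I_n -> int) : sgnmx deg *m sgnmx deg = 1%:M.
Proof. exact: signs_mxK. Qed.

Lemma sgnmx_comm m n (dt : 'I_m -> int) (ds : 'I_n -> int) (k : int) (A : 'M[R]_(m, n)) :
  (forall i j, A i j != 0 -> oddz (dt i) = oddz (ds j) (+) oddz k) ->
  sgnmx dt *m A = (-1) ^+ oddz k *: (A *m sgnmx ds).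
Proof.
move=> hA; apply/matrixP => i j; rewrite mul_sgnmx [RHS]mxE mulmx_sgn.
have [->|/hA->] := eqVneq (A i j) 0; first by rewrite !mulr0.
by rewrite signr_addb mulrA; congr (_ * _); case: oddz; case: oddz; rewrite ?expr0 ?expr1 ?mulr1 ?mul1r.
Qed.

Lemma eq_sgnmx n (d1 d2 : 'I_n -> int) : (forall x, oddz (d1 x) = oddz (d2 x)) ->
  sgnmx d1 = sgnmx d2.
Proof. by move=> e; apply/matrixP => i j; rewrite !mxE e. Qed.

Lemma torsion_sgnmx n (deg : 'I_n -> int) :
  mx_invertible (sgnmx deg) /\
  torsion (sgnmx deg) = tN1 *+ #|[pred i | oddz (deg i)]|.
Proof. exact: torsion_diag_sign. Qed.

(** Unitriangular changes of basis are not seen by the torsion. *)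
Lemma fold_conj_unitriangular w n (deg : 'I_w -> int) (e o : 'I_n -> 'I_w)
    (d G T T' : 'M[R]_w) (h : 'I_w -> int) :
  frame (fun z => ~~ oddz (deg z)) e -> frame (fun z => oddz (deg z)) o ->
  contraction deg d G -> homog deg deg 0 T -> homog deg deg 0 T' ->
  (forall i j, T i j != 0 -> h j < h i) -> (forall i j, T' i j != 0 -> h j < h i) ->
  torsion (mxsub e o ((1%:M + T) *m (d + G) *m (1%:M + T'))) = torsion (mxsub e o (d + G)).
Proof.
move=> eP oP cG hT hT' rT rT'.
have [iM _] := fold_invertible eP oP cG.
rewrite -(mxsub_frameM oP) => [|i j]; last first.
  rewrite mxE; have [->|/hT'->] := eqVneq (T' i (o j)) 0.
    by rewrite addr0 mxE; have [->|_] := eqVneq i (o j); rewrite ?(frame_mem j oP) ?eqxx.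
  by rewrite addr0 (frame_mem j oP).
rewrite -(mxsub_frameM eP) => [|i j /(contraction_odd cG)->]; last by rewrite negbK (frame_mem j oP).
have [iT tT] : mx_invertible (mxsub e e (1%:M + T)) /\ torsion (mxsub e e (1%:M + T)) = 0.
  rewrite raddfD /= (mxsub_frame1 _ eP).
  by apply: (torsion_unitriangular (h := h \o e)) => i j; rewrite mxE => /rT.
have [iT' tT'] : mx_invertible (mxsub o o (1%:M + T')) /\ torsion (mxsub o o (1%:M + T')) = 0.
  rewrite raddfD /= (mxsub_frame1 _ oP).
  by apply: (torsion_unitriangular (h := h \o o)) => i j; rewrite mxE => /rT'.
by rewrite !torsionM ?tT ?tT' ?addr0 ?add0r //; apply: mx_invertibleM.
Qed.

End BlockGraded.

Arguments sgnmx {R n} deg.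
Arguments homog_sgnmx {R n} deg.

Section Cones.
Variable R : pzRingType.
Local Notation tN1 := (torsion ((-1)%:M : 'M[R]_1)).

(** The sum of all the modules of a complex, with one numbered basis: maps between
    such complexes are square matrices, and cones are block matrices. *)
Record based_complex n := BasedComplex { bdeg : 'I_n -> int; bd : 'M[R]_n }.

Section Cone.
Variable n : nat.
Implicit Types C B A : based_complex n.

Definition cone_deg C B : 'I_(n + n) -> int := degs (bdeg C) (fun x => bdeg B x + 1).

Definition cone_d C B (f : 'M[R]_n) : 'M[R]_(n + n) :=
  block_mx (bd C) (f *m sgnmx (bdeg B)) 0 (bd B).

Definition cone_odd (p : 'I_n -> int) (x : 'I_n) : 'I_(n + n) :=
  if oddz (p x) then lshift n x else rshift n x.
Definition cone_even (p : 'I_n -> int) (x : 'I_n) : 'I_(n + n) :=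
  if oddz (p x) then rshift n x else lshift n x.

Definition same_parity C B := forall x, oddz (bdeg C x) = oddz (bdeg B x).

(** As both complexes have the same number of basis elements in each parity,
    the odd part [C_odd + B_even] and the even part [C_even + B_odd] of the cone
    are both numbered by ['I_n], without any choice of order. *)
Definition has_torsion C B (f : 'M[R]_n) (u : K1 R) : Prop :=
  same_parity C B /\ exists2 G, contraction (cone_deg C B) (cone_d C B f) G &
    u = torsion (mxsub (cone_even (bdeg C)) (cone_odd (bdeg C)) (cone_d C B f + G)).

Lemma cone_oddP C B : same_parity C B ->
  frame (fun z => oddz (cone_deg C B z)) (cone_odd (bdeg C)).
Proof.
move=> pC; split.
  by move=> x y; rewrite /cone_odd; case: ifP => ox; case: ifP => oy // /eqP;
    rewrite ?eq_lshift ?eq_rshift ?eq_lrshift ?eq_rlshift // => /eqP.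
apply: splitW => x; rewrite /cone_deg ?degs_l ?degs_r ?oddzD -?pC.
  apply/idP/codomP => [ox|[y]]; first by exists x; rewrite /cone_odd ox.
  by rewrite /cone_odd; case: ifP => [+ /eqP|_ /eqP]; rewrite ?eq_lshift ?eq_lrshift // => + /eqP->.
rewrite addbT; apply/idP/codomP => [ox|[y]]; first by exists x; rewrite /cone_odd (negPf ox).
by rewrite /cone_odd; case: ifPn => [_ /eqP|+ /eqP]; rewrite ?eq_rshift ?eq_rlshift // => + /eqP->.
Qed.

(* The even part is the odd part after a shift of all degrees by 1. *)
Lemma cone_evenP C B : same_parity C B ->
  frame (fun z => ~~ oddz (cone_deg C B z)) (cone_even (bdeg C)).
Proof.
move=> pC; pose shift A := BasedComplex (fun x => bdeg A x + 1) (bd A).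
have pS : same_parity (shift C) (shift B) by move=> x; rewrite /= !oddzD pC.
have -> : (fun z => ~~ oddz (cone_deg C B z)) = (fun z => oddz (cone_deg (shift C) (shift B) z)).
  apply/funext; apply: splitW => x; rewrite /cone_deg !(degs_l, degs_r) /= ?oddzD.
    by rewrite addbT.
  by rewrite !addbT.
have -> : cone_even (bdeg C) = cone_odd (bdeg (shift C)); last exact: cone_oddP.
by apply/funext => x; rewrite /cone_even /cone_odd /= oddzD addbT if_neg.
Qed.

Record is_complex C : Prop := IsComplex {
  bd_homog : homog (bdeg C) (bdeg C) (-1) (bd C);
  bd_bd : bd C *m bd C = 0
}.

Record is_chain C B (f : 'M[R]_n) : Prop := IsChain {
  chain_homog : homog (bdeg C) (bdeg B) 0 f;
  chain_comm : bd C *m f = f *m bd B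
}.

Lemma sgn_bd C : is_complex C -> sgnmx (bdeg C) *m bd C = - (bd C *m sgnmx (bdeg C)).
Proof.
move=> [hd _]; rewrite (sgnmx_comm (ds := bdeg C) (k := -1)) ?expr1 ?scaleN1r // => i j.
by move=> /hd->; rewrite oddzD.
Qed.

Lemma homog_mul_sgn m (dt : 'I_m -> int) (ds ds' : 'I_n -> int) k l (A : 'M[R]_(m, n)) :
  (forall j, ds' j + l = ds j + k) -> homog dt ds k A -> homog dt ds' l (A *m sgnmx ds).
Proof.
move=> e hA i j; rewrite mulmx_sgn e => nz; apply: hA; apply: contraNneq nz => ->.
by rewrite mulr0.
Qed.

Lemma cone_complex C B f : is_complex C -> is_complex B -> is_chain C B f ->
  homog (cone_deg C B) (cone_deg C B) (-1) (cone_d C B f) /\ cone_d C B f *m cone_d C B f = 0.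
Proof.
move=> cC cB cf; split.
  apply: homog_block; [exact: bd_homog | | exact: homog0 |].
    by apply: homog_mul_sgn (chain_homog cf) => j; lia.
  by move=> i j /(bd_homog cB)->; lia.
rewrite /cone_d mulmx_block !mx0E (bd_bd cC) (bd_bd cB).
rewrite -(mulmxA f) (sgn_bd cB) mulmxN !mulmxA (chain_comm cf) addrN.
exact: block_mx0.
Qed.

Lemma cone_parts C B f G : contraction (cone_deg C B) (cone_d C B f) G ->
  [/\ is_complex C, is_complex B & is_chain C B f].
Proof.
move=> cG; have [hC hf _ hB] := homog_blockK (contr_d cG).
have := contr_dd cG; rewrite mulmx_block !mx0E -[RHS]block_mx0.
move=> /eq_block_mx[dC df _ dB].
have cB : is_complex B by split=> // i j /hB; lia.
split=> //; split.
  move=> i j nz; have := hf i j; rewrite mulmx_sgn.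
  by case: oddz; rewrite ?expr0 ?expr1 ?mulN1r ?oppr_eq0 ?mul1r => /(_ nz)->; lia.
apply/eqP; rewrite -subr_eq0; apply/eqP.
rewrite -[LHS]mulmx1 -(sgnmxK _ (bdeg B)) mulmxA mulmxBl -(mulmxA f (bd B)).
have -> : bd B *m sgnmx (bdeg B) = - (sgnmx (bdeg B) *m bd B) by rewrite (sgn_bd cB) opprK.
by rewrite mulmxN opprK mulmxA -(mulmxA (bd C)) df mul0mx.
Qed.

Lemma has_torsion_parts C B f u : has_torsion C B f u ->
  [/\ is_complex C, is_complex B & is_chain C B f].
Proof. by move=> [_ [G cG _]]; apply: cone_parts cG. Qed.

Lemma homog_anti_diag m1 m2 (d1 : 'I_m1 -> int) (d2 : 'I_m2 -> int) k (X : 'M[R]_(m1, m2)) :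
  homog d1 d2 k X -> homog (degs d1 d2) (degs d1 d2) k (block_mx 0 X 0 0).
Proof. by move=> hX; apply: homog_block => //; apply: homog0. Qed.

(** The homotopy [h] is the off-diagonal entry of a unitriangular isomorphism
    between the two cones. *)
Lemma has_torsion_homotopic C B f g h u : homog (bdeg C) (bdeg B) 1 h ->
  f - g = bd C *m h + h *m bd B -> has_torsion C B f u -> has_torsion C B g u.
Proof.
move=> hh fg [pC [G cG ->]].
have [cC cB cf] := cone_parts cG.
pose X := h *m sgnmx (bdeg B); pose T : 'M[R]_(n + n) := block_mx 0 X 0 0.
have TT : T *m T = 0 by rewrite mulmx_block !mx0E block_mx0.
have hT : homog (cone_deg C B) (cone_deg C B) 0 T.
  by apply: homog_anti_diag; apply: homog_mul_sgn hh => j; lia.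
have SS : mx_inverse (1%:M + T) (1%:M + - T).
  split; rewrite mulmxDl mul1mx mulmxDr mulmx1 ?mulmxN ?mulNmx TT ?oppr0 addr0.
    by rewrite -addrA addNr addr0.
  by rewrite -addrA addrN addr0.
have hS T' : homog (cone_deg C B) (cone_deg C B) 0 T' ->
    homog (cone_deg C B) (cone_deg C B) 0 (1%:M + T').
  by move=> hT'; apply: homogD => //; apply: homog1.
have dS : (1%:M + T) *m cone_d C B f *m (1%:M + - T) = cone_d C B g.
  suff -> : (1%:M + T) *m cone_d C B f = cone_d C B g *m (1%:M + T).
    by rewrite -mulmxA SS.1 mulmx1.
  rewrite mulmxDl mul1mx mulmxDr mulmx1 /cone_d /T !mulmx_block.
  rewrite !mx0E !add_block_mx !addr0; congr block_mx.
  have -> : f = g + bd C *m h + h *m bd B by rewrite -addrA -fg addrC subrK.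
  rewrite !mulmxDl /X -[h *m bd B *m _]mulmxA.
  have -> : bd B *m sgnmx (bdeg B) = - (sgnmx (bdeg B) *m bd B) by rewrite (sgn_bd cB) opprK.
  by rewrite mulmxN !mulmxA; zmodule.
split=> //; exists ((1%:M + T) *m G *m (1%:M + - T)).
  by rewrite -dS; apply: contraction_conj cG => //; apply: hS => //; apply: homogN.
rewrite -dS -mulmxDl -mulmxDr.
have low : forall i j, T i j != 0 ->
    degs (fun=> 0 : int) (fun=> -1) j < degs (fun=> 0) (fun=> -1) i.
  apply: splitW => i; apply: splitW => j; rewrite ?block_mxE4.
  - by rewrite mxE eqxx.
  - by rewrite degs_l degs_r.
  - by rewrite mxE eqxx.
  - by rewrite mxE eqxx.
have hNT := homogN hT.
symmetry; apply: fold_conj_unitriangular (cone_evenP pC) (cone_oddP pC) cG hT hNT (low) _.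
by move=> i j; rewrite mxE oppr_eq0; apply: low.
Qed.

(** The cones are conjugate by [diag(1, J)]. In the fold, the part of [J] in odd
    degrees acts on the left and the part in even degrees on the right; together they
    contribute [torsion J]. *)
Lemma has_torsion_involution C B f u (J : 'M[R]_n) (deg' : 'I_n -> int) :
  let B' := BasedComplex deg' (J *m bd B *m J) in
  J *m J = 1%:M -> homog (bdeg B) deg' 0 J -> homog deg' (bdeg B) 0 J ->
  same_parity B B' -> has_torsion C B f u -> has_torsion C B' (f *m J) (u + torsion J).
Proof.
move=> B' JJ hJ hJ' pB [pC [G cG ->]].
have [cC cB cf] := cone_parts cG.
have pC' : same_parity C B' by move=> x; rewrite pC pB.
pose S : 'M[R]_(n + n) := block_mx 1%:M 0 0 J.
have SS : S *m S = 1%:M.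
  by rewrite mulmx_block !mx0E mulmx1 JJ -scalar_mx_block.
have sJ : sgnmx (bdeg B) *m J = J *m sgnmx (bdeg B').
  rewrite (sgnmx_comm (ds := deg') (k := 0)) ?expr0 ?scale1r // => i j /hJ->.
  by rewrite addr0 addbF.
have dS : S *m cone_d C B f *m S = cone_d C B' (f *m J).
  rewrite /S /cone_d !mulmx_block !mx0E !(mul1mx, mulmx1) /=.
  by congr block_mx; rewrite -mulmxA sJ mulmxA.
have hS : homog (cone_deg C B') (cone_deg C B) 0 S.
  apply: homog_block; [exact: homog1 | exact: homog0 | exact: homog0 |].
  by move=> i j /hJ' /= ->; rewrite addrAC.
have hS' : homog (cone_deg C B) (cone_deg C B') 0 S.
  apply: homog_block; [exact: homog1 | exact: homog0 | exact: homog0 |].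
  by move=> i j /hJ /= ->; rewrite addrAC.
split=> //; exists (S *m G *m S); rewrite -dS.
  by apply: contraction_conj cG.
rewrite -mulmxDl -mulmxDr.
have [eP oP] := (cone_evenP pC, cone_oddP pC).
have [iM _] := fold_invertible eP oP cG.
have pJ i j : J i j != 0 -> oddz (bdeg C i) = oddz (bdeg C j).
  by rewrite !pC (pB j) => /hJ->; rewrite addr0.
have pJ0 i j : oddz (bdeg C i) != oddz (bdeg C j) -> J i j = 0.
  by move=> nij; apply/eqP; apply: contraNT nij => /pJ->.
have pS : forall i j, S i j != 0 -> oddz (cone_deg C B i) = oddz (cone_deg C B j).
  apply: splitW => i; apply: splitW => j;
  rewrite ?block_mxE4 /cone_deg ?(degs_l, degs_r).
  - by rewrite mxE; have [->|_] := eqVneq i j; rewrite ?eqxx.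
  - by rewrite mxE eqxx.
  - by rewrite mxE eqxx.
  - by move=> /pJ; rewrite !oddzD !pC => ->.
rewrite -(mxsub_frameM oP) => [|i j /pS->]; last exact: (frame_mem j oP).
rewrite -(mxsub_frameM eP) => [|i j /(contraction_odd cG)->]; last by rewrite negbK (frame_mem j oP).
set e := cone_even _; set o := cone_odd _.
have iE : mx_invertible (mxsub e e S).
  exists (mxsub e e S); split; rewrite (mxsub_frameM eP) ?SS ?(mxsub_frame1 _ eP) // => i j /pS->;
  exact: (frame_mem j eP).
have iO : mx_invertible (mxsub o o S).
  exists (mxsub o o S); split; rewrite (mxsub_frameM oP) ?SS ?(mxsub_frame1 _ oP) // => i j /pS->;
  exact: (frame_mem j oP).
rewrite !torsionM //; last exact: mx_invertibleM.
rewrite addrAC addrC; congr (_ + _); rewrite -torsionM //; congr torsion.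
have eE i j : mxsub e e S i j = if oddz (bdeg C i) then J i j else (i == j)%:R.
  rewrite mxE /e /cone_even; case: ifP => oi; case: ifP => oj;
  rewrite ?block_mxE4 ?mxE //.
    by rewrite pJ0 // oi oj.
  by have [ij|] := eqVneq i j; rewrite // -ij oi in oj.
have oE i j : mxsub o o S i j = if oddz (bdeg C j) then (i == j)%:R else J i j.
  rewrite mxE /o /cone_odd; case: ifP => oi; case: ifP => oj;
  rewrite ?block_mxE4 ?mxE //.
    by rewrite pJ0 // oi oj.
  by have [ij|] := eqVneq i j; rewrite // ij oj in oi.
apply/matrixP => i j; rewrite mxE; have [oi|oi] := boolP (oddz (bdeg C i)).
  have [oj|oj] := boolP (oddz (bdeg C j)).
    rewrite (bigD1 j) //= eE oi oE oj eqxx mulr1 big1 ?addr0 // => k nk.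
    by rewrite oE oj (negPf nk) mulr0.
  rewrite big1 => [|k _]; last rewrite eE oi oE (negPf oj).
    by rewrite pJ0 // oi (negPf oj).
  have [->|/pJ] := eqVneq (J i k) 0; first by rewrite mul0r.
  have [->|/pJ->] := eqVneq (J k j) 0; first by rewrite mulr0.
  by rewrite oi (negPf oj).
rewrite (bigD1 i) //= eE (negPf oi) eqxx mul1r big1 ?addr0 => [|k nk]; last first.
  by rewrite eE (negPf oi) eq_sym (negPf nk) mul0r.
rewrite oE; case: ifP => // oj; have [ij|_] := eqVneq i j; first by rewrite ij oj in oi.
by rewrite pJ0 // (negPf oi) oj.
Qed.
End Cone.

Section Exchange.
Variables (n : nat) (p : 'I_n -> bool).

(** Reordering the even and the odd basis elements of the sum of two cones comes
    down to such exchanges. *)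
Definition exchange (z : 'I_(n + n)) : 'I_(n + n) :=
  match split z with
  | inl x => if p x then rshift n x else lshift n x
  | inr x => if p x then lshift n x else rshift n x
  end.

Lemma exchange_l x : exchange (lshift n x) = if p x then rshift n x else lshift n x.
Proof. by rewrite /exchange (unsplitK (inl x)). Qed.

Lemma exchange_r x : exchange (rshift n x) = if p x then lshift n x else rshift n x.
Proof. by rewrite /exchange (unsplitK (inr x)). Qed.

Lemma exchangeK : involutive exchange.
Proof.
by apply: splitW => x; rewrite ?exchange_l ?exchange_r; case: ifP => px;
  rewrite ?exchange_l ?exchange_r px.
Qed.

(** The exchange is the product of the transpositions of the two copies of [x], for
    [x] in [p]. *)
Lemma torsion_exchange :
  mx_invertible (rowsub exchange 1%:M : 'M[R]_(n + n)) /\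
  torsion (rowsub exchange 1%:M : 'M[R]_(n + n)) =
    tN1 *+ #|[pred x | p x]|.
Proof.
pose t x := tperm (lshift n x) (rshift n x).
have tE (s : seq 'I_n) : uniq s -> forall x,
    (\prod_(y <- s) t y)%g (lshift n x) = (if x \in s then rshift n x else lshift n x) /\
    (\prod_(y <- s) t y)%g (rshift n x) = (if x \in s then lshift n x else rshift n x).
  elim: s => [|y s IH] /=; first by move=> _ x; rewrite big_nil !perm1.
  case/andP=> ys us x; rewrite big_cons !permM /t inE; have [->|nxy] := eqVneq x y.
    by rewrite tpermL tpermR; have [-> ->] := IH us y; rewrite (negPf ys).
  by rewrite !tpermD ?(eq_lshift, eq_rshift, eq_lrshift, eq_rlshift) 1?eq_sym //; apply: IH.
have -> : rowsub exchange 1%:M = perm_mx (\prod_(y | p y) t y)%g :> 'M[R]_(n + n).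
  apply/matrixP => i j; rewrite -big_filter !mxE; congr (_ == _)%:R.
  have us : uniq [seq y <- index_enum 'I_n | p y] by rewrite filter_uniq ?index_enum_uniq.
  move: i; apply: splitW => x; have [L L'] := tE _ us x.
    by rewrite exchange_l L mem_filter mem_index_enum andbT.
  by rewrite exchange_r L' mem_filter mem_index_enum andbT.
have [iP ->] := torsion_perm_mx R (\prod_(y | p y) t y)%g; split=> //.
have tO (s : seq 'I_n) : (\prod_(y <- s) t y)%g = odd (size s) :> bool.
  elim: s => [|y s IH]; first by rewrite big_nil odd_perm1.
  by rewrite big_cons odd_permM odd_tperm eq_lrshift IH.
by rewrite -big_filter tO size_filter -sum1_count sum1_card -torsionN1_odd.
Qed.
End Exchange.

Lemma torsion_mxsub_exchange n (p q : 'I_n -> bool) (A : 'M[R]_(n + n)) : mx_invertible A ->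
  torsion (mxsub (exchange p) (exchange q) A) = torsion A +
    tN1 *+ (#|[pred x | p x]| + #|[pred x | q x]|).
Proof.
move=> iA; have [iP tP] := torsion_exchange p; have [iQ tQ] := torsion_exchange q.
have -> : mxsub (exchange p) (exchange q) A =
    rowsub (exchange p) 1%:M *m A *m rowsub (exchange q) 1%:M.
  have -> : rowsub (exchange q) 1%:M = colsub (exchange q) 1%:M :> 'M[R]_(n + n).
    by apply/matrixP => i j; rewrite !mxE (can2_eq (exchangeK q) (exchangeK q)).
  by rewrite -rowsubE mulmx_colsub mulmx1; apply/matrixP => i j; rewrite !mxE.
rewrite !torsionM ?tP ?tQ //; last exact: mx_invertibleM.
by rewrite mulrnDr addrAC addrC addrA.
Qed.

Lemma contraction_reindex w (s : 'I_w -> 'I_w) (deg deg' : 'I_w -> int) (d G : 'M[R]_w) :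
  involutive s -> (forall x, deg' x = deg (s x)) ->
  contraction deg d G -> contraction deg' (mxsub s s d) (mxsub s s G).
Proof.
move=> sK degs' cG.
have sP : frame xpredT s.
  by split=> [|z]; [apply: inv_inj | apply/esym/codomP; exists (s z); rewrite sK].
split.
- by move=> i j; rewrite mxE !degs'; apply: (contr_d cG).
- by rewrite (mxsub_frameM sP) // (contr_dd cG) raddf0.
- by move=> i j; rewrite mxE !degs'; apply: (contr_G cG).
- by rewrite !(mxsub_frameM sP) // -raddfD /= (contr_dG cG) (mxsub_frame1 _ sP).
Qed.

Section Join.
Variables (m1 m2 n1 n2 : nat) (f1 : 'I_n1 -> 'I_m1) (f2 : 'I_n2 -> 'I_m2).

Definition join_frame (z : 'I_(n1 + n2)) : 'I_(m1 + m2) :=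
  match split z with inl x => lshift m2 (f1 x) | inr y => rshift m1 (f2 y) end.

Lemma join_frame_l x : join_frame (lshift n2 x) = lshift m2 (f1 x).
Proof. by rewrite /join_frame (unsplitK (inl x)). Qed.

Lemma join_frame_r y : join_frame (rshift n1 y) = rshift m1 (f2 y).
Proof. by rewrite /join_frame (unsplitK (inr y)). Qed.

Lemma join_frameP P P1 P2 : frame P1 f1 -> frame P2 f2 ->
  (forall x, P (lshift m2 x) = P1 x) -> (forall y, P (rshift m1 y) = P2 y) ->
  frame P join_frame.
Proof.
move=> F1 F2 e1 e2; split.
  apply: splitW => x; apply: splitW => y; rewrite ?join_frame_l ?join_frame_r => /eqP;
  rewrite ?(eq_lshift, eq_rshift, eq_lrshift, eq_rlshift) // => /eqP.
    by move/(frame_inj F1) => ->.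
  by move/(frame_inj F2) => ->.
apply: splitW => z; rewrite ?e1 ?e2 ?(frameP F1) ?(frameP F2).
  apply/codomP/codomP => [[x ->]|[]]; first by exists (lshift _ x); rewrite join_frame_l.
  apply: splitW => x /eqP; rewrite ?join_frame_l ?join_frame_r ?eq_lshift ?eq_lrshift // => /eqP->.
  by exists x.
apply/codomP/codomP => [[x ->]|[]]; first by exists (rshift _ x); rewrite join_frame_r.
apply: splitW => x /eqP; rewrite ?join_frame_l ?join_frame_r ?eq_rshift ?eq_rlshift // => /eqP->.
by exists x.
Qed.
End Join.

Lemma mxsub_join m1 m2 m1' m2' n1 n2 n1' n2' (f1 : 'I_n1 -> 'I_m1) (f2 : 'I_n2 -> 'I_m2)
    (g1 : 'I_n1' -> 'I_m1') (g2 : 'I_n2' -> 'I_m2') (A : 'M[R]_(m1, m1')) B C D :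
  mxsub (join_frame f1 f2) (join_frame g1 g2) (block_mx A B C D) =
  block_mx (mxsub f1 g1 A) (mxsub f1 g2 B) (mxsub f2 g1 C) (mxsub f2 g2 D).
Proof.
apply/matrixP; apply: splitW => i; apply: splitW => j;
by rewrite [LHS]mxE ?join_frame_l ?join_frame_r
  ?block_mxE4 mxE.
Qed.

(** The torsion of -1 counts the even basis elements: the fold of its cone is
    triangular with diagonal entries 1 in odd degrees and -1 in even degrees. *)
Lemma has_torsion_opp1 n (B : based_complex n) : is_complex B ->
  has_torsion B B (- 1%:M)
    (tN1 *+ #|[pred x | ~~ oddz (bdeg B x)]|).
Proof.
move=> cB; split=> //.
pose eps : 'M[R]_n := sgnmx (bdeg B).
pose G : 'M[R]_(n + n) := block_mx 0 0 (- eps) 0.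
have cf : is_chain B B (- 1%:M).
  by split; [apply/homogN/homog1 | rewrite mulmxN mulNmx mulmx1 mul1mx].
have [hd dd] := cone_complex cB cB cf.
exists G.
  split=> //.
    apply: homog_block; [exact: homog0 | exact: homog0 | | exact: homog0].
    move=> i j; rewrite mxE oppr_eq0 mxE; have [->//|_] := eqVneq i j.
    by rewrite mulr0n eqxx.
  rewrite /cone_d !mulmx_block !mx0E add_block_mx !mulNmx !mul1mx.
  rewrite !mulmxN !opprK /eps sgnmxK (sgn_bd cB) opprK !(addr0, add0r).
  by rewrite addNr -scalar_mx_block.
set M := mxsub _ _ _.
have ME i j : M i j = ((-1) ^+ (~~ oddz (bdeg B i))) *+ (i == j) +
    (if oddz (bdeg B i) == oddz (bdeg B j) then 0 else bd B i j).
  rewrite mxE /cone_d /G add_block_mx !addr0 !add0r mulNmx mul1mx /cone_even /cone_odd.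
  case: ifP => oi; case: ifP => oj;
  rewrite ?block_mxE4 ?mxE ?oi ?oj.
  - by rewrite eqxx addr0; case: (i == j); rewrite ?mulr1n ?mulr0n ?oppr0 ?opprK.
  - by have [ij|_] := eqVneq i j; [rewrite -ij oi in oj | rewrite mulr0n add0r].
  - by have [ij|_] := eqVneq i j; [rewrite ij oj in oi | rewrite mulr0n add0r].
  - by rewrite eqxx addr0; case: (i == j); rewrite ?mulr1n ?mulr0n ?oppr0.
have [_ -> //] : mx_invertible M /\ torsion M =
    tN1 *+ #|[pred x | ~~ oddz (bdeg B x)]|.
apply: (torsion_triangular_signs (h := fun x => - bdeg B x)) => [i|i j /negPf nij].
  by rewrite ME !eqxx addr0.
rewrite ME nij mulr0n add0r; case: ifP => _; first by rewrite eqxx.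
by move=> /(bd_homog cB)->; lia.
Qed.

Section Composition.
Variables (n : nat) (A B C : based_complex n) (f g : 'M[R]_n).

Let eps : 'M[R]_n := sgnmx (bdeg B).
Let K : 'M[R]_(n + n) := block_mx 0 (- eps) 0 0.

(** The extension of [cone g] by [cone f] through the identity of [B], with
    basis in the order [B, SA, C, SB]. *)
Let D2 : 'M[R]_((n + n) + (n + n)) := block_mx (cone_d B A f) K 0 (cone_d C B g).

Let deg2 := degs (cone_deg B A) (cone_deg C B).
Let deg1 := degs (cone_deg C A) (cone_deg B B).

(** [B] and [C] are the left halves of the two cones. *)
Let s : 'I_((n + n) + (n + n)) -> 'I_((n + n) + (n + n)) :=
  exchange (fun z : 'I_(n + n) => if split z is inl _ then true else false).

(** The same complex with basis in the order [C, SA, B, SB]. *)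
Let D1 : 'M[R]_((n + n) + (n + n)) :=
  block_mx (block_mx (bd C) 0 0 (bd A)) (block_mx 0 (g *m eps) 0 0)
           (block_mx 0 (f *m eps) 0 0) (block_mx (bd B) (- eps) 0 (bd B)).

Let D0 : 'M[R]_((n + n) + (n + n)) :=
  block_mx (cone_d C A (g *m f)) 0 0 (cone_d B B (- 1%:M)).

Let a : 'M[R]_((n + n) + (n + n)) :=
  block_mx 0 (block_mx g 0 0 0) (block_mx 0 0 0 (- f)) 0.

Hypotheses (cA : is_complex A) (cB : is_complex B) (cC : is_complex C).
Hypotheses (cf : is_chain B A f) (cg : is_chain C B g).
Hypotheses (pBA : same_parity B A) (pCB : same_parity C B).

Let epsA : sgnmx (bdeg A) = eps.
Proof. by apply: eq_sgnmx => x; rewrite pBA. Qed.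

Let sl x : s (lshift _ (lshift _ x)) = rshift _ (lshift _ x).
Proof. by rewrite /s exchange_l (unsplitK (inl x)). Qed.
Let sl' x : s (lshift _ (rshift _ x)) = lshift _ (rshift _ x).
Proof. by rewrite /s exchange_l (unsplitK (inr x)). Qed.
Let sr x : s (rshift _ (lshift _ x)) = lshift _ (lshift _ x).
Proof. by rewrite /s exchange_r (unsplitK (inl x)). Qed.
Let sr' x : s (rshift _ (rshift _ x)) = rshift _ (rshift _ x).
Proof. by rewrite /s exchange_r (unsplitK (inr x)). Qed.

Let reorder : mxsub s s D2 = D1.
Proof.
apply/matrixP; apply: splitW; apply: splitW => i; apply: splitW; apply: splitW => j;
rewrite mxE ?(sl, sl', sr, sr') /D1 /D2 /K /cone_d epsA
  ?block_mxE4 //;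
by rewrite !mxE.
Qed.

Let aa : a *m a = 0.
Proof. by rewrite /a !mulmx_block !(mx0E, mulmx_block, block_mx0). Qed.

Let a_D1 : (1%:M + a) *m D1 = D0 *m (1%:M + a).
Proof.
rewrite mulmxDl mul1mx mulmxDr mulmx1 /a /D1 /D0 /cone_d epsA.
rewrite !mulmx_block !(mx0E, mulmx_block).
rewrite !(add_block_mx, block_mx0, mx0E) !mulNmx !mulmxN !mul1mx ?mulNmx.
rewrite (chain_comm cf) (chain_comm cg) !mulmxA addrN opprK.
have -> : eps *m f = f *m eps; last by rewrite ?subrr.
rewrite (sgnmx_comm (ds := bdeg A) (k := 0)) ?epsA ?expr0 ?scale1r // => i j.
by move=> /(chain_homog cf)->; rewrite oddzD.
Qed.

Let a_homog : homog deg1 deg1 0 a.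
Proof.
apply: homog_block; [exact: homog0 | | | exact: homog0];
  apply: homog_block; try exact: homog0.
  exact: (chain_homog cg).
by apply: homogN => i j /(chain_homog cf)->; rewrite addrAC.
Qed.

Let h : 'I_((n + n) + (n + n)) -> int :=
  degs (degs (fun=> 1 : int) (fun=> 0)) (degs (fun=> 0) (fun=> 1)).

Let a_low i j : a i j != 0 -> h j < h i.
Proof.
move: i j; rewrite /h /a; apply: splitW; apply: splitW => i; apply: splitW; apply: splitW => j;
by rewrite ?block_mxE4 !(degs_l, degs_r) // mxE ?eqxx.
Qed.

Lemma has_torsion_comp_aux u v : has_torsion B A f u -> has_torsion C B g v ->
  has_torsion C A (g *m f)
    (u + v + tN1 *+ #|[pred x | oddz (bdeg C x)]|).
Proof.
move=> [_ [Gf cGf uE]] [_ [Gg cGg vE]].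
have pCA : same_parity C A by move=> x; rewrite pCB pBA.
have eCB : cone_even (bdeg C) = cone_even (bdeg B).
  by apply/funext => x; rewrite /cone_even pCB.
have oCB : cone_odd (bdeg C) = cone_odd (bdeg B).
  by apply/funext => x; rewrite /cone_odd pCB.
have c2 : contraction deg2 D2 (block_mx Gf (- (Gf *m K *m Gg)) 0 Gg).
  apply: contraction_ext => //.
    apply: homog_block; try exact: homog0.
    apply: homogN => i j; rewrite mxE; have [->|_] := eqVneq i j; first by move=> _; lia.
    by rewrite mulr0n eqxx.
  rewrite /K /cone_d epsA !mulmx_block !mx0E add_block_mx !addr0.
  by rewrite mulmxN mulNmx (sgn_bd cB) opprK addNr block_mx0.
set G2 := block_mx Gf _ 0 Gg in c2.
have c1 : contraction deg1 D1 (mxsub s s G2).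
  rewrite -reorder; apply: contraction_reindex c2; first exact: exchangeK.
  rewrite /deg1 /deg2 /s; apply: splitW; apply: splitW => x; rewrite ?(exchange_l, exchange_r);
  by rewrite ?(unsplitK (inl x)) ?(unsplitK (inr x)) /cone_deg !(degs_l, degs_r).
set G1 := mxsub s s G2 in c1.
have aK : mx_inverse (1%:M + a) (1%:M + - a).
  split; rewrite mulmxDl mul1mx mulmxDr mulmx1 ?mulmxN ?mulNmx aa ?oppr0 addr0.
    by rewrite -addrA addNr addr0.
  by rewrite -addrA addrN addr0.
have D0E : (1%:M + a) *m D1 *m (1%:M + - a) = D0.
  by rewrite a_D1 -mulmxA aK.1 mulmx1.
have c0 : contraction deg1 D0 ((1%:M + a) *m G1 *m (1%:M + - a)).
  rewrite -D0E; apply: contraction_conj c1 => //.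
    by apply: homogD; first exact: homog1.
  by apply: homogD; [exact: homog1 | exact: homogN].
set G0 := _ *m G1 *m _ in c0.
have cgf := contraction_summand c0.
split=> //; exists (ulsubmx G0) => //.
have [_ [Go cGo oE]] := has_torsion_opp1 cB.
have c0' : contraction deg1 D0 (block_mx (ulsubmx G0) 0 0 Go).
  have := contraction_ext cgf cGo (K := 0) (@homog0 _ _ _ _ _ _).
  by rewrite !mulmx0 !mul0mx oppr0 addr0 => /(_ erefl).
pose e := cone_even (bdeg B); pose o := cone_odd (bdeg B).
pose e4 := join_frame e e; pose o4 := join_frame o o.
have join_even deg : (forall x, oddz (deg (lshift _ x)) = oddz (cone_deg C B x)) ->
    (forall x, oddz (deg (rshift _ x)) = oddz (cone_deg C B x)) ->
    frame (fun z => ~~ oddz (deg z)) e4 /\ frame (fun z => oddz (deg z)) o4.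
  have [eP oP] := (cone_evenP pCB, cone_oddP pCB); rewrite eCB oCB in eP oP.
  by move=> hl hr; split; apply: join_frameP => [||x|x]; try exact: eP; try exact: oP; rewrite ?hl ?hr.
have par X Y : same_parity X B -> same_parity B Y ->
    forall x, oddz (cone_deg X Y x) = oddz (cone_deg C B x).
  by move=> pX pY; apply: splitW => x; rewrite /cone_deg !(degs_l, degs_r) ?oddzD ?pCB ?pX ?pY.
have pBB : same_parity B B by [].
have [e1P o1P] : frame (fun z => ~~ oddz (deg1 z)) e4 /\ frame (fun z => oddz (deg1 z)) o4.
  by apply: join_even => x; rewrite /deg1 !(degs_l, degs_r) par.
have [e2P o2P] : frame (fun z => ~~ oddz (deg2 z)) e4 /\ frame (fun z => oddz (deg2 z)) o4.
  by apply: join_even => x; rewrite /deg2 !(degs_l, degs_r) // par.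
have [iM _] := fold_invertible (cone_evenP pCA) (cone_oddP pCA) cgf.
have [iMo _] := fold_invertible (cone_evenP pBB) (cone_oddP pBB) cGo.
have [iMf _] := fold_invertible (cone_evenP pBA) (cone_oddP pBA) cGf.
have [iMg _] := fold_invertible (cone_evenP pCB) (cone_oddP pCB) cGg.
rewrite eCB oCB in vE iM iMg *.
have t0 : torsion (mxsub e4 o4 (D0 + G0)) =
    torsion (mxsub e o (cone_d C A (g *m f) + ulsubmx G0)) +
    torsion (mxsub e o (cone_d B B (- 1%:M) + Go)).
  rewrite (torsion_fold_indep e1P o1P c0 c0') /D0 add_block_mx !addr0 mxsub_join !raddf0.
  exact: torsion_block_diag.
have t1 : torsion (mxsub e4 o4 (D0 + G0)) = torsion (mxsub e4 o4 (D1 + G1)).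
  rewrite -D0E /G0 -mulmxDl -mulmxDr.
  apply: (fold_conj_unitriangular e1P o1P c1 a_homog (homogN a_homog) a_low) => i j.
  by rewrite mxE oppr_eq0; apply: a_low.
have t2 : torsion (mxsub e4 o4 (D1 + G1)) = torsion (mxsub e4 o4 (D2 + G2)) +
    tN1 *+ (#|[pred x | ~~ oddz (bdeg B x)]| + #|[pred x | oddz (bdeg B x)]|).
  have [iM2 _] := fold_invertible e2P o2P c2.
  rewrite -reorder /G1 -raddfD /= -(torsion_mxsub_exchange _ _ iM2); congr torsion.
  have sE : forall z, s (e4 z) = e4 (exchange (fun x => ~~ oddz (bdeg B x)) z).
    apply: splitW => x; rewrite ?(exchange_l, exchange_r) /e4 ?(join_frame_l, join_frame_r) /e /cone_even;
    by case: ifP => px; rewrite ?(join_frame_l, join_frame_r) px ?(sl, sl', sr, sr').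
  have sO : forall z, s (o4 z) = o4 (exchange (fun x => oddz (bdeg B x)) z).
    apply: splitW => x; rewrite ?(exchange_l, exchange_r) /o4 ?(join_frame_l, join_frame_r) /o /cone_odd;
    by case: ifP => px; rewrite ?(join_frame_l, join_frame_r) px ?(sl, sl', sr, sr').
  by apply/matrixP => i j; rewrite !mxE sE sO.
have t3 : torsion (mxsub e4 o4 (D2 + G2)) = u + v.
  by rewrite /D2 /G2 add_block_mx addr0 mxsub_join raddf0 uE vE; case: (torsion_block_ut
    (mxsub e o (K + - (Gf *m K *m Gg))) iMf iMg).
apply: (addIr (torsion (mxsub e o (cone_d B B (- 1%:M) + Go)))).
rewrite -t0 t1 t2 t3 -oE -!addrA -mulrnDr; congr (_ + (_ + _ *+ _)).
by rewrite addnC; congr (_ + _)%N; apply: eq_card => x; rewrite !inE pCB.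
Qed.
End Composition.

(** The cone of [g f] and the cone of [- 1_B] together form an extension of the
    cone of [g] by the cone of [f], up to a unitriangular change of basis. *)
Lemma has_torsion_comp n (A B C : based_complex n) (f g : 'M[R]_n) u v :
  has_torsion B A f u -> has_torsion C B g v ->
  has_torsion C A (g *m f)
    (u + v + tN1 *+ #|[pred x | oddz (bdeg C x)]|).
Proof.
move=> tf tg; have [cB cA cf] := has_torsion_parts tf; have [cC _ cg] := has_torsion_parts tg.
by apply: has_torsion_comp_aux (tf) (tg) => //; [case: tf | case: tg].
Qed.

(** [T] commutes with [d], and [1 - T] is inverse to [1 + T]. *)
Lemma contraction_correct w (deg : 'I_w -> int) (d G T : 'M[R]_w) :
  homog deg deg (-1) d -> d *m d = 0 -> homog deg deg 1 G -> homog deg deg 0 T ->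
  T *m T = 0 -> d *m G + G *m d = 1%:M + T -> contraction deg d (G *m (1%:M - T)).
Proof.
move=> hd dd hG hT TT dG; split=> //.
  have hV : homog deg deg 0 (1%:M - T) by apply: homogD; [exact: homog1 | exact: homogN].
  exact: homogM hG hV.
have dT : d *m T = T *m d.
  have: d *m (1%:M + T) = (1%:M + T) *m d.
    by rewrite -dG mulmxDr mulmxDl !mulmxA dd mul0mx add0r -(mulmxA G) dd mulmx0 addr0.
  by rewrite mulmxDr mulmxDl mulmx1 mul1mx => /addrI.
have -> : G *m (1%:M - T) *m d = G *m d *m (1%:M - T).
  by rewrite -!mulmxA; congr (_ *m _); rewrite mulmxBl mulmxBr mulmx1 mul1mx dT.
rewrite mulmxA -mulmxDl dG mulmxDl mul1mx mulmxBr mulmx1 TT subr0.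
by rewrite subrK.
Qed.

(** The inverse equivalence and the homotopies assemble to a contraction of the
    cone up to an error [T] with [T T = 0]. *)
Lemma cone_contractible n (C B : based_complex n) (f g h k : 'M[R]_n) :
  is_complex C -> is_complex B -> is_chain C B f -> is_chain B C g ->
  homog (bdeg C) (bdeg C) 1 h -> homog (bdeg B) (bdeg B) 1 k ->
  f *m g - 1%:M = bd C *m h + h *m bd C -> g *m f - 1%:M = bd B *m k + k *m bd B ->
  exists G, contraction (cone_deg C B) (cone_d C B f) G.
Proof.
move=> cC cB cf cg hh hk fg gf; pose eps : 'M[R]_n := sgnmx (bdeg B).
have [hd dd] := cone_complex cC cB cf.
pose Z : 'M[R]_n := - (f *m eps *m k) - h *m f *m eps.
have epsg : eps *m g = g *m sgnmx (bdeg C).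
  rewrite /eps (sgnmx_comm (ds := bdeg C) (k := 0)) ?expr0 ?scale1r // => i j.
  by move=> /(chain_homog cg)->; rewrite oddzD.
have epsf : f *m eps = sgnmx (bdeg C) *m f.
  rewrite (sgnmx_comm (ds := bdeg B) (k := 0)) ?expr0 ?scale1r // => i j.
  by move=> /(chain_homog cf)->; rewrite oddzD.
have hZ : homog (bdeg C) (bdeg B) 1 Z.
  apply: homogD; apply: homogN.
    by have := homogM (homogM (chain_homog cf) (homog_sgnmx (bdeg B))) hk.
  by have := homogM (homogM hh (chain_homog cf)) (homog_sgnmx (bdeg B)).
have cG : contraction (cone_deg C B) (cone_d C B f)
    (block_mx (- h) 0 (eps *m g) (- k) *m (1%:M - block_mx 0 Z 0 0)).
  apply: contraction_correct => //.
  - apply: homog_block; [exact: homogN | exact: homog0 | |].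
      move=> i j; rewrite mul_sgnmx => nz; rewrite (chain_homog cg (i := i) (j := j)) ?addr0 //.
      by apply: contraNneq nz => ->; rewrite mulr0.
    by apply: homogN => i j /hk->; rewrite addrAC.
  - by apply: homog_anti_diag => i j /hZ->; rewrite addr0.
  - by rewrite mulmx_block !mx0E block_mx0.
  rewrite /cone_d -/eps !mulmx_block !mx0E scalar_mx_block !add_block_mx.
  have -> : f *m eps *m (eps *m g) = 1%:M + (bd C *m h + h *m bd C).
    by rewrite -fg addrC subrK mulmxA -(mulmxA f) sgnmxK mulmx1.
  have -> : eps *m g *m (f *m eps) = 1%:M + (bd B *m k + k *m bd B).
    rewrite -gf addrC subrK epsg -mulmxA epsf (mulmxA (sgnmx _)) sgnmxK mul1mx //.
  have -> : bd B *m (eps *m g) = - (eps *m g *m bd C).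
    rewrite mulmxA -[bd B *m eps]opprK -(sgn_bd cB) mulNmx -!mulmxA.
    by rewrite (chain_comm cg).
  rewrite /Z !mulmxN !mulNmx !mulmxA; congr block_mx; zmodule.
by exists (block_mx (- h) 0 (eps *m g) (- k) *m (1%:M - block_mx 0 Z 0 0)).
Qed.
End Cones.

(** * Torsions of tensor products *)

Lemma map_mx_invertible (R S : pzRingType) (f : {rmorphism R -> S}) n (A : 'M[R]_n) :
  mx_invertible A -> mx_invertible (map_mx f A).
Proof. by move=> [B AB]; exists (map_mx f B); apply: map_mx_inverse. Qed.

Lemma K1_mapD (R S : pzRingType) (f : {rmorphism R -> S}) : {morph K1_map f : x y / x + y}.
Proof.
move=> x y; apply: (K1_ind3 (P := fun x y _ => K1_map f (x + y) = K1_map f x + K1_map f y) _ x y x).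
move=> n A B _ iA iB _.
rewrite -torsionM // !K1_map_torsion ?map_mxM ?torsionM //; try exact: map_mx_invertible.
exact: mx_invertibleM.
Qed.

Lemma K1_map0 (R S : pzRingType) (f : {rmorphism R -> S}) : K1_map f 0 = 0.
Proof. by apply: (addrI (K1_map f 0)); rewrite -K1_mapD !addr0. Qed.

Lemma K1_mapN (R S : pzRingType) (f : {rmorphism R -> S}) : {morph K1_map f : x / - x}.
Proof. by move=> x; apply: (addrI (K1_map f x)); rewrite -K1_mapD !subrr K1_map0. Qed.

Section Tensor.
Variables R S : invRingType.
Local Notation T := (tensor_ring R S).
Local Notation tN1 := (torsion ((-1)%:M : 'M[T]_1)).

Lemma tens0l (y : S) : tens (0 : R) y = 0.
Proof. by apply: (addrI (tens 0 y)); rewrite -tensDl !addr0. Qed.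

Lemma tens0r (x : R) : tens x (0 : S) = 0.
Proof. by apply: (addrI (tens x 0)); rewrite -tensDr !addr0. Qed.

Lemma tensNl (x : R) (y : S) : tens (- x) y = - tens x y.
Proof. by apply: (addrI (tens x y)); rewrite -tensDl !subrr tens0l. Qed.

Lemma tensNr (x : R) (y : S) : tens x (- y) = - tens x y.
Proof. by apply: (addrI (tens x y)); rewrite -tensDr !subrr tens0r. Qed.

Lemma tens_suml I (r : seq I) (F : I -> R) (y : S) :
  tens (\sum_(i <- r) F i) y = \sum_(i <- r) tens (F i) y.
Proof.
by apply: (big_morph (fun x : R => tens x y)); [move=> *; rewrite tensDl | rewrite tens0l].
Qed.

Lemma tens_sumr I (r : seq I) (F : I -> S) (x : R) :
  tens x (\sum_(i <- r) F i) = \sum_(i <- r) tens x (F i).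
Proof.
by apply: (big_morph (fun y : S => tens x y)); [move=> *; rewrite tensDr | rewrite tens0r].
Qed.

Section TensorIndex.
Variables (w n m : nat) (c : 'I_w -> 'I_n * 'I_m).
Hypothesis c_bij : bijective c.

(** The Kronecker product for an arbitrary numbering of the pairs. *)
Definition tensor_mx (A : 'M[R]_n) (B : 'M[S]_m) : 'M[T]_w :=
  \matrix_(i, j) tens (A (c i).1 (c j).1) (B (c i).2 (c j).2).

Lemma tensor_mxM A B A' B' :
  tensor_mx A B *m tensor_mx A' B' = tensor_mx (A *m A') (B *m B').
Proof.
apply/matrixP => i j; have [b cK bK] := c_bij.
rewrite !mxE (reindex b); last by apply: onW_bij; exists c.
transitivity (\sum_x \sum_y tens (A (c i).1 x) (B (c i).2 y) * tens (A' x (c j).1) (B' y (c j).2)).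
  by rewrite pair_bigA; apply: eq_bigr => p _; rewrite !mxE bK.
rewrite tens_suml; apply: eq_bigr => x _; rewrite tens_sumr; apply: eq_bigr => y _.
by rewrite tensM.
Qed.

Lemma tensor_mx1 : tensor_mx 1%:M 1%:M = 1%:M.
Proof.
apply/matrixP => i j; rewrite !mxE -(inj_eq (bij_inj c_bij)) -pair_eqE /pair_eq.
by case: (_ == _); case: (_ == _); rewrite /= ?tens0l ?tens0r.
Qed.

Lemma tensor_mxDl A A' B : tensor_mx (A + A') B = tensor_mx A B + tensor_mx A' B.
Proof. by apply/matrixP => i j; rewrite !mxE tensDl. Qed.

Lemma tensor_mxDr A B B' : tensor_mx A (B + B') = tensor_mx A B + tensor_mx A B'.
Proof. by apply/matrixP => i j; rewrite !mxE tensDr. Qed.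

Lemma tensor_mxNr A B : tensor_mx A (- B) = - tensor_mx A B.
Proof. by apply/matrixP => i j; rewrite !mxE tensNr. Qed.

Lemma tensor_mxNl A B : tensor_mx (- A) B = - tensor_mx A B.
Proof. by apply/matrixP => i j; rewrite !mxE tensNl. Qed.

Lemma tensor_mx0l B : tensor_mx 0 B = 0.
Proof. by apply/matrixP => i j; rewrite !mxE tens0l. Qed.

Lemma tensor_mx0r A : tensor_mx A 0 = 0.
Proof. by apply/matrixP => i j; rewrite !mxE tens0r. Qed.

Lemma homog_tensor (d1 : 'I_n -> int) (d2 : 'I_m -> int) (d1' : 'I_n -> int) (d2' : 'I_m -> int)
    k l A B : homog d1 d1' k A -> homog d2 d2' l B ->
  homog (fun i => d1 (c i).1 + d2 (c i).2) (fun i => d1' (c i).1 + d2' (c i).2) (k + l)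
    (tensor_mx A B).
Proof.
move=> hA hB i j; rewrite mxE => nz.
have nzA : A (c i).1 (c j).1 != 0 by apply: contraNneq nz => ->; rewrite tens0l.
have nzB : B (c i).2 (c j).2 != 0 by apply: contraNneq nz => ->; rewrite tens0r.
by rewrite (hA _ _ nzA) (hB _ _ nzB) addrACA.
Qed.

Lemma sgnmx_tensor (d1 : 'I_n -> int) (d2 : 'I_m -> int) :
  sgnmx (fun i => d1 (c i).1 + d2 (c i).2) = tensor_mx (sgnmx d1) (sgnmx d2).
Proof.
apply/matrixP => i j; rewrite !mxE -(inj_eq (bij_inj c_bij)) -pair_eqE /pair_eq oddzD.
case: ((c i).1 == _); last by rewrite !mulr0n tens0l.
case: ((c i).2 == _); last by rewrite !mulr0n tens0r.
rewrite !mulr1n; case: oddz; case: oddz; rewrite /= ?expr0 ?expr1 ?tensNl ?tensNr ?opprK //.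
Qed.
End TensorIndex.

Section Unindex.
Variables n m : nat.

Definition pair_of (k : 'I_(n * m)) : 'I_n * 'I_m := mxtens_unindex k.
Definition of_pair (p : 'I_n * 'I_m) : 'I_(n * m) := mxtens_index p.

Lemma of_pairK : cancel of_pair pair_of. Proof. exact: mxtens_indexK. Qed.
Lemma pair_ofK : cancel pair_of of_pair. Proof. exact: mxtens_unindexK. Qed.

Lemma pair_of_bij : bijective pair_of.
Proof. by exists of_pair; [exact: pair_ofK|exact: of_pairK]. Qed.

Lemma tmxE (A : 'M[R]_n) (B : 'M[S]_m) : tmx A B = tensor_mx pair_of A B.
Proof.
by apply/matrixP => i j; rewrite !mxE tensM mulr1 mul1r.
Qed.

(** In this numbering the cone of [f (x) 1] is the product of the cone of [f] with
    a complex. *)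
Definition conel_pair (z : 'I_(n * m + n * m)) : 'I_(n + n) * 'I_m :=
  match split z with
  | inl k => (lshift n (pair_of k).1, (pair_of k).2)
  | inr k => (rshift n (pair_of k).1, (pair_of k).2)
  end.

Lemma conel_l k : conel_pair (lshift _ k) = (lshift n (pair_of k).1, (pair_of k).2).
Proof. by rewrite /conel_pair (unsplitK (inl k)). Qed.
Lemma conel_r k : conel_pair (rshift _ k) = (rshift n (pair_of k).1, (pair_of k).2).
Proof. by rewrite /conel_pair (unsplitK (inr k)). Qed.

Lemma conel_bij : bijective conel_pair.
Proof.
apply: inj_card_bij; last by rewrite card_prod !card_ord mulnDl.
apply: splitW => k; apply: splitW => k'; rewrite ?(conel_l, conel_r) => /eqP;
rewrite xpair_eqE ?(eq_lshift, eq_rshift, eq_lrshift, eq_rlshift) ?andbF // -xpair_eqE;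
by rewrite -!surjective_pairing => /eqP/(can_inj pair_ofK) ->.
Qed.

(** In this numbering the cone of [1 (x) g] is, up to signs, the product of a
    complex with the cone of [g]. *)
Definition coner_pair (z : 'I_(n * m + n * m)) : 'I_n * 'I_(m + m) :=
  match split z with
  | inl k => ((pair_of k).1, lshift m (pair_of k).2)
  | inr k => ((pair_of k).1, rshift m (pair_of k).2)
  end.

Lemma coner_l k : coner_pair (lshift _ k) = ((pair_of k).1, lshift m (pair_of k).2).
Proof. by rewrite /coner_pair (unsplitK (inl k)). Qed.
Lemma coner_r k : coner_pair (rshift _ k) = ((pair_of k).1, rshift m (pair_of k).2).
Proof. by rewrite /coner_pair (unsplitK (inr k)). Qed.

Lemma coner_bij : bijective coner_pair.
Proof.
apply: inj_card_bij; last by rewrite card_prod !card_ord mulnDr.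
apply: splitW => k; apply: splitW => k'; rewrite ?(coner_l, coner_r) => /eqP;
rewrite xpair_eqE ?(eq_lshift, eq_rshift, eq_lrshift, eq_rlshift) ?andbF // -xpair_eqE;
by rewrite -!surjective_pairing => /eqP/(can_inj pair_ofK) ->.
Qed.

Lemma block_tensorl (A B C D : 'M[R]_n) (Y : 'M[S]_m) :
  block_mx (tensor_mx pair_of A Y) (tensor_mx pair_of B Y)
           (tensor_mx pair_of C Y) (tensor_mx pair_of D Y) =
  tensor_mx conel_pair (block_mx A B C D) Y.
Proof.
apply/matrixP; apply: splitW => i; apply: splitW => j;
by rewrite [RHS]mxE ?(conel_l, conel_r) /= ?block_mxE4 mxE.
Qed.

Lemma block_tensorr (X : 'M[R]_n) (A B C D : 'M[S]_m) :
  block_mx (tensor_mx pair_of X A) (tensor_mx pair_of X B)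
           (tensor_mx pair_of X C) (tensor_mx pair_of X D) =
  tensor_mx coner_pair X (block_mx A B C D).
Proof.
apply/matrixP; apply: splitW => i; apply: splitW => j;
by rewrite [RHS]mxE ?(coner_l, coner_r) /= ?block_mxE4 mxE.
Qed.
End Unindex.

Arguments pair_of : simpl never.
Arguments of_pair : simpl never.

Lemma torsion_opp (U : pzRingType) n (A : 'M[U]_n) : mx_invertible A ->
  mx_invertible (- A) /\ torsion (- A) = torsion A + torsion ((-1)%:M : 'M[U]_1) *+ n.
Proof.
move=> iA; pose D : 'M[U]_n := \matrix_(i, j) ((-1) ^+ true *+ (i == j)).
have [iD tD] := torsion_diag_sign (erefl D).
have -> : - A = A *m D.
  have -> : D = - 1%:M by apply/matrixP => i j; rewrite !mxE expr1 mulNrn.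
  by rewrite mulmxN mulmx1.
split; first exact: mx_invertibleM.
rewrite torsionM // tD; congr (_ + _ *+ _).
by rewrite -[RHS]card_ord; apply: eq_card.
Qed.

Definition tensor_based n m (C : based_complex R n) (D : based_complex S m) :
    based_complex T (n * m) :=
  BasedComplex (fun k => bdeg C (pair_of k).1 + bdeg D (pair_of k).2)
    (tmx 1%:M (bd D) + tmx (bd C) (sgnmx (bdeg D))).

Definition odd_rank (U : pzRingType) n (C : based_complex U n) := #|[pred x | oddz (bdeg C x)]|.
Definition even_rank (U : pzRingType) n (C : based_complex U n) := #|[pred x | ~~ oddz (bdeg C x)]|.

Lemma sum_by_parity (U : pzRingType) (V : zmodType) m (D : based_complex U m)
    (F : 'I_m -> V) (a t : V) k :
  (forall y, F y = if oddz (bdeg D y) then - a + t *+ k else a) ->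
  \sum_y F y = a *+ even_rank D - a *+ odd_rank D + t *+ (k * odd_rank D).
Proof.
move=> FE; rewrite (bigID (fun y => oddz (bdeg D y))) /= addrC.
rewrite (eq_bigr (fun=> a)) => [|y /negPf oy]; last by rewrite FE oy.
rewrite [X in _ + X](eq_bigr (fun=> - a + t *+ k)) => [|y oy]; last by rewrite FE oy.
by rewrite !sumr_const mulrnDl mulNrn mulrnA addrA.
Qed.

Lemma tensor_deg n m (C : based_complex R n) (D : based_complex S m) x y :
  bdeg (tensor_based C D) (of_pair (x, y)) = bdeg C x + bdeg D y.
Proof.
rewrite -[LHS]/(bdeg C (pair_of (of_pair (x, y))).1 + bdeg D (pair_of (of_pair (x, y))).2).
by rewrite of_pairK.
Qed.

Section TensorLeft.
Variables (n m : nat) (C C' : based_complex R n) (D : based_complex S m).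
Variables (f : 'M[R]_n) (u : K1 R).

(** With a contraction [G] of the cone of [f] one obtains the contraction
    [G (x) eps] of the tensor product; the fold is block triangular for the
    degree in [D], and in odd degrees the odd and even parts of the cone are
    exchanged, so that the block there is inverse, up to sign, to the one in
    even degrees. *)
Lemma has_torsion_tensorl : has_torsion C C' f u -> is_complex D ->
  has_torsion (tensor_based C D) (tensor_based C' D) (tmx f 1%:M)
    (K1_map (@tensl R S) u *+ even_rank D - K1_map (@tensl R S) u *+ odd_rank D
     + tN1 *+ (n * odd_rank D)).
Proof.
move=> [pC [G cG ->]] cD.
pose eps : 'M[S]_m := sgnmx (bdeg D).
have coneE : cone_d (tensor_based C D) (tensor_based C' D) (tmx f 1%:M) =
    tensor_mx (@conel_pair n m) (cone_d C C' f) eps + tensor_mx (@conel_pair n m) 1%:M (bd D).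
  rewrite /cone_d scalar_mx_block -!block_tensorl add_block_mx !tensor_mx0l !addr0.
  congr block_mx; rewrite /= !tmxE //; try by rewrite addrC.
  rewrite (sgnmx_tensor (pair_of_bij n m)) (tensor_mxM (pair_of_bij n m)).
  by rewrite mul1mx.
have degE z : cone_deg (tensor_based C D) (tensor_based C' D) z =
    cone_deg C C' (conel_pair z).1 + bdeg D (conel_pair z).2.
  move: z; apply: splitW => k; rewrite ?(conel_l, conel_r) /cone_deg !(degs_l, degs_r) //=.
  by rewrite addrAC.
have pT : same_parity (tensor_based C D) (tensor_based C' D) by move=> k /=; rewrite !oddzD pC.
have M4 := tensor_mxM (conel_bij n m).
pose GT := tensor_mx (@conel_pair n m) G eps.
have epsd : eps *m bd D = - (bd D *m eps) := sgn_bd cD.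
have cGT : contraction (cone_deg (tensor_based C D) (tensor_based C' D))
    (cone_d (tensor_based C D) (tensor_based C' D) (tmx f 1%:M)) GT.
  rewrite coneE; have e2 := @sgnmxK S m (bdeg D); split.
  - apply: homogD => i j; rewrite !degE => nz.
      by rewrite (homog_tensor (contr_d cG) (homog_sgnmx (bdeg D)) nz); lia.
    by rewrite (homog_tensor (homog1 (cone_deg C C')) (bd_homog cD) nz); lia.
  - rewrite mulmxDl !mulmxDr !M4 (contr_dd cG) (bd_bd cD) tensor_mx0l tensor_mx0r.
    by rewrite mul1mx mulmx1 epsd tensor_mxNr add0r addr0 addNr.
  - by move=> i j; rewrite !degE => nz; rewrite (homog_tensor (contr_G cG) (homog_sgnmx (bdeg D)) nz); lia.
  - rewrite mulmxDl mulmxDr !M4 e2 mul1mx mulmx1 epsd tensor_mxNr addrACA addrN addr0.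
    by rewrite -tensor_mxDl (contr_dG cG) (tensor_mx1 (conel_bij n m)).
split=> //; exists GT => //.
pose M := mxsub (cone_even (bdeg C)) (cone_odd (bdeg C)) (cone_d C C' f + G).
pose M' := mxsub (cone_odd (bdeg C)) (cone_even (bdeg C)) (cone_d C C' f + G).
have [iM iM'] := fold_invertible (cone_evenP pC) (cone_oddP pC) cG.
have tM' : torsion M' = - torsion M := torsion_fold_oe (cone_evenP pC) (cone_oddP pC) cG.
have imap := @map_mx_invertible _ _ (@tensl R S).
pose F y := if oddz (bdeg D y) then - map_mx (@tensl R S) M' else map_mx (@tensl R S) M.
have iF y : mx_invertible (F y).
  by rewrite /F; case: ifP => _; [case: (torsion_opp (imap _ _ iM')) | apply: imap].
pose c (k : 'I_(n * m)) := ((pair_of k).2, (pair_of k).1).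
pose b (p : 'I_m * 'I_n) := of_pair (p.2, p.1).
have bK' : cancel b c by case=> y x; rewrite /c /b of_pairK.
have cK' : cancel c b by move=> k; rewrite /c /b; case e: (pair_of k) => [x y]; rewrite -e pair_ofK.
have evenE x y : conel_pair (cone_even (bdeg (tensor_based C D)) (of_pair (x, y))) =
    ((if oddz (bdeg D y) then cone_odd (bdeg C) x else cone_even (bdeg C) x), y).
  rewrite /cone_even /cone_odd tensor_deg oddzD.
  by case: (oddz (bdeg C x)); case: (oddz (bdeg D y)); rewrite /= ?(conel_l, conel_r) of_pairK.
have oddE x y : conel_pair (cone_odd (bdeg (tensor_based C D)) (of_pair (x, y))) =
    ((if oddz (bdeg D y) then cone_even (bdeg C) x else cone_odd (bdeg C) x), y).
  rewrite /cone_even /cone_odd tensor_deg oddzD.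
  by case: (oddz (bdeg C x)); case: (oddz (bdeg D y)); rewrite /= ?(conel_l, conel_r) of_pairK.
rewrite coneE; set B := (X in _ = torsion X).
have BE x y x' y' : B (of_pair (x, y)) (of_pair (x', y')) =
  tens ((cone_d C C' f + G) (if oddz (bdeg D y) then cone_odd (bdeg C) x else cone_even (bdeg C) x)
     (if oddz (bdeg D y') then cone_even (bdeg C) x' else cone_odd (bdeg C) x')) (eps y y') +
  tens ((1%:M : 'M_(n + n)) (if oddz (bdeg D y) then cone_odd (bdeg C) x else cone_even (bdeg C) x)
     (if oddz (bdeg D y') then cone_even (bdeg C) x' else cone_odd (bdeg C) x')) (bd D y y').
  rewrite /B addrAC -tensor_mxDl mxE [LHS]mxE mxE [X in _ + X]mxE.
  by rewrite !evenE !oddE.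
have dyy y : bd D y y = 0.
  by apply/eqP; apply: contraTT isT => /(bd_homog cD); lia.
have [|y x y' x' nyy|_ ->] := torsion_block_triangular (B := B) (F := F)
   (h := fun y => - bdeg D y) bK' cK' iF.
- have eyy y : eps y y = (-1) ^+ oddz (bdeg D y) by rewrite mxE eqxx mulr1n.
  move=> y x x'; rewrite /b BE dyy tens0r addr0 eyy /F /M /M'.
  by case: ifP => oy; rewrite ?expr0 ?expr1 ?tensNr !mxE.
- rewrite /b /= BE [eps _ _]mxE (negPf nyy) mulr0n tens0r add0r => nz.
  rewrite (bd_homog cD (i := y) (j := y')) ?opprB; first by lia.
  by apply: contraNneq nz => ->; rewrite tens0r.
symmetry; apply: sum_by_parity => y; rewrite /F; case: ifP => oy; last by rewrite K1_map_torsion.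
have [_ ->] := torsion_opp (imap _ _ iM'); congr (_ + _).
by rewrite -K1_map_torsion // tM' K1_mapN.
Qed.
End TensorLeft.

Section TensorRight.
Variables (n m : nat) (C : based_complex R n) (D D' : based_complex S m).
Variables (g : 'M[S]_m) (u : K1 S).

(** As for [has_torsion_tensorl], after the change of signs by [diag(1, eps (x) 1)]
    which identifies the cone of [1 (x) g] with the product of [C] and the cone
    of [g]. *)
Lemma has_torsion_tensorr : has_torsion D D' g u -> is_complex C ->
  has_torsion (tensor_based C D) (tensor_based C D') (tmx 1%:M g)
    (K1_map (@tensr R S) u *+ even_rank C - K1_map (@tensr R S) u *+ odd_rank C
     + tN1 *+ (m * odd_rank C)).
Proof.
move=> [pD [G cG ->]] cC.
have imapr k := @map_mx_invertible _ _ (@tensr R S) k.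
have [bK2 cK2] := (@of_pairK n m, @pair_ofK n m).
pose epsC : 'M[R]_n := sgnmx (bdeg C); pose epsD : 'M[S]_m := sgnmx (bdeg D).
have epsD' : sgnmx (bdeg D') = epsD by apply: eq_sgnmx.
pose epsc : 'M[S]_(m + m) := sgnmx (cone_deg D D').
have epscE : epsc = block_mx epsD 0 0 (- epsD).
  apply/matrixP; apply: splitW => i; apply: splitW => j;
  rewrite ?block_mxE4 !mxE
    /cone_deg !(degs_l, degs_r) ?(eq_lshift, eq_rshift, eq_lrshift, eq_rlshift) //.
  by rewrite oddzD addbT -pD signrN mulNrn.
pose Q : 'M[T]_(n * m + n * m) := block_mx 1%:M 0 0 (tmx epsC 1%:M).
pose sq (z : 'I_(n * m + n * m)) :=
  match split z with inl _ => false | inr k => oddz (bdeg C (pair_of k).1) end.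
have QE : Q = signs_mx T sq.
  apply/matrixP; apply: splitW => i; apply: splitW => j;
  rewrite ?block_mxE4 [RHS]mxE
     ?(eq_lshift, eq_rshift, eq_lrshift, eq_rlshift) ?tmxE ?mxE ?mulr0n //.
    by rewrite /sq (unsplitK (inl i)).
  rewrite /sq (unsplitK (inr i)) ?mxE -[i == j](inj_eq (can_inj cK2)) -pair_eqE /pair_eq.
  case: (_ == _); last by rewrite !mulr0n tens0l.
  case: (_ == _); last by rewrite !mulr0n tens0r.
  by rewrite !mulr1n; case: oddz; rewrite ?expr0 ?expr1 ?tensNl.
have QQ : Q *m Q = 1%:M by rewrite QE signs_mxK.
pose D0 := tensor_mx (@coner_pair n m) 1%:M (cone_d D D' g) + tensor_mx (@coner_pair n m) (bd C) epsc.
have coneE : Q *m D0 *m Q = cone_d (tensor_based C D) (tensor_based C D') (tmx 1%:M g).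
  rewrite /D0 /cone_d epscE -!block_tensorr add_block_mx !tensor_mx0r !addr0 ?add0r /Q !mulmx_block.
  rewrite !(mx0E, mul1mx, mulmx1) /=.
  have M2 := tensor_mxM (pair_of_bij n m).
  rewrite (sgnmx_tensor (pair_of_bij n m)) !tmxE epsD' !M2 mulmxDr mulmxDl !M2.
  rewrite !mul1mx !mulmx1 (sgn_bd cC) sgnmxK.
  by rewrite mulNmx -mulmxA sgnmxK mulmx1 tensor_mxNr tensor_mxNl opprK.
pose G0 := tensor_mx (@coner_pair n m) 1%:M G.
have degE z : cone_deg (tensor_based C D) (tensor_based C D') z =
    bdeg C (coner_pair z).1 + cone_deg D D' (coner_pair z).2.
  move: z; apply: splitW => k; rewrite ?(coner_l, coner_r) /cone_deg !(degs_l, degs_r) //=.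
  by rewrite addrA.
have pT : same_parity (tensor_based C D) (tensor_based C D') by move=> k /=; rewrite !oddzD pD.
have M4 := tensor_mxM (coner_bij n m).
have epsd X k : homog (cone_deg D D') (cone_deg D D') k X -> oddz k -> epsc *m X = - (X *m epsc).
  move=> hX ok; rewrite /epsc (sgnmx_comm (ds := cone_deg D D') (k := k)) ?ok ?expr1 ?scaleN1r //.
  by move=> i j /hX->; rewrite oddzD ok.
pose degT := cone_deg (tensor_based C D) (tensor_based C D').
have cG0 : contraction degT D0 G0.
  split.
  - apply: homogD => i j; rewrite /degT !degE => nz.
      by rewrite (homog_tensor (homog1 (bdeg C)) (contr_d cG) nz); lia.
    by rewrite (homog_tensor (bd_homog cC) (homog_sgnmx _) nz); lia.
  - rewrite mulmxDl !mulmxDr !M4 (contr_dd cG) (bd_bd cC) tensor_mx0l tensor_mx0r.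
    by rewrite mul1mx mulmx1 (epsd _ _ (contr_d cG)) // tensor_mxNr add0r addr0 addrN.
  - by move=> i j; rewrite /degT !degE => nz; rewrite (homog_tensor (homog1 (bdeg C)) (contr_G cG) nz); lia.
  - rewrite mulmxDl mulmxDr !M4 !mul1mx mulmx1 (epsd _ _ (contr_G cG)) // tensor_mxNr addrACA.
    by rewrite addNr addr0 -tensor_mxDr (contr_dG cG) (tensor_mx1 (coner_bij n m)).
have hQ : homog degT degT 0 Q.
  move=> i j; rewrite QE mxE addr0; have [->//|_] := eqVneq i j.
  by rewrite mulr0n eqxx.
have cGT := contraction_conj (conj QQ QQ) hQ hQ cG0.
rewrite coneE in cGT.
split=> //; exists (Q *m G0 *m Q) => //.
rewrite -coneE -mulmxDl -mulmxDr.
pose M := mxsub (cone_even (bdeg D)) (cone_odd (bdeg D)) (cone_d D D' g + G).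
pose M' := mxsub (cone_odd (bdeg D)) (cone_even (bdeg D)) (cone_d D D' g + G).
have [iM iM'] := fold_invertible (cone_evenP pD) (cone_oddP pD) cG.
have tM' : torsion M' = - torsion M := torsion_fold_oe (cone_evenP pD) (cone_oddP pD) cG.
have [iE _] := torsion_sgnmx S (bdeg D).
have iEM : mx_invertible (epsD *m M' *m epsD) by do !apply: mx_invertibleM.
have tEM : torsion (epsD *m M' *m epsD) = - torsion M.
  by rewrite torsion_conj //; split; apply: sgnmxK.
pose F x := if oddz (bdeg C x) then - map_mx (@tensr R S) (epsD *m M' *m epsD)
            else map_mx (@tensr R S) M.
have iF x : mx_invertible (F x).
  by rewrite /F; case: ifP => _; [case: (torsion_opp (imapr _ _ iEM)) | apply: imapr].
have evenE x y : coner_pair (cone_even (bdeg (tensor_based C D)) (of_pair (x, y))) =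
    (x, if oddz (bdeg C x) then cone_odd (bdeg D) y else cone_even (bdeg D) y).
  rewrite /cone_even /cone_odd tensor_deg oddzD.
  by case: (oddz (bdeg C x)); case: (oddz (bdeg D y)); rewrite /= ?(coner_l, coner_r) of_pairK.
have oddE x y : coner_pair (cone_odd (bdeg (tensor_based C D)) (of_pair (x, y))) =
    (x, if oddz (bdeg C x) then cone_even (bdeg D) y else cone_odd (bdeg D) y).
  rewrite /cone_even /cone_odd tensor_deg oddzD.
  by case: (oddz (bdeg C x)); case: (oddz (bdeg D y)); rewrite /= ?(coner_l, coner_r) of_pairK.
have sq_even x y : sq (cone_even (bdeg (tensor_based C D)) (of_pair (x, y))) =
    oddz (bdeg C x) && ~~ oddz (bdeg D y).
  rewrite /sq /cone_even tensor_deg oddzD -/(of_pair (x, y)); set k := of_pair (x, y).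
  have xk : (pair_of k).1 = x by rewrite of_pairK.
  case ox: (oddz (bdeg C x)); case: (oddz (bdeg D y)); cbn [addb andb negb];
  by rewrite ?(unsplitK (inl k)) ?(unsplitK (inr k)) ?xk ?ox.
have sq_odd x y : sq (cone_odd (bdeg (tensor_based C D)) (of_pair (x, y))) =
    oddz (bdeg C x) && oddz (bdeg D y).
  rewrite /sq /cone_odd tensor_deg oddzD -/(of_pair (x, y)); set k := of_pair (x, y).
  have xk : (pair_of k).1 = x by rewrite of_pairK.
  case ox: (oddz (bdeg C x)); case: (oddz (bdeg D y)); cbn [addb andb negb];
  by rewrite ?(unsplitK (inl k)) ?(unsplitK (inr k)) ?xk ?ox.
set B := (X in _ = torsion X).
have BE x y x' y' : B (of_pair (x, y)) (of_pair (x', y')) =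
  (-1) ^+ (oddz (bdeg C x') && oddz (bdeg D y')) *
  ((-1) ^+ (oddz (bdeg C x) && ~~ oddz (bdeg D y)) *
  (tens ((1%:M : 'M_n) x x')
    ((cone_d D D' g + G) (if oddz (bdeg C x) then cone_odd (bdeg D) y else cone_even (bdeg D) y)
     (if oddz (bdeg C x') then cone_even (bdeg D) y' else cone_odd (bdeg D) y')) +
  tens (bd C x x')
    (epsc (if oddz (bdeg C x) then cone_odd (bdeg D) y else cone_even (bdeg D) y)
     (if oddz (bdeg C x') then cone_even (bdeg D) y' else cone_odd (bdeg D) y')))).
  rewrite /B /D0 /G0 addrAC -tensor_mxDr [LHS]mxE QE mulmx_signs signs_mulmx sq_even sq_odd.
  by rewrite mxE mxE [X in _ + X]mxE !evenE !oddE.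
have dxx x : bd C x x = 0.
  by apply/eqP; apply: contraTT isT => /(bd_homog cC); lia.
have [|x y x' y' nxx|_ ->] := torsion_block_triangular (B := B) (F := F)
   (h := fun x => - bdeg C x) bK2 cK2 iF.
- move=> x y y'; rewrite BE dxx tens0l addr0 mxE eqxx /F.
  case: ifP => ox /=; last by rewrite !mul1r !mxE.
  have oppE (X : 'M[S]_m) : (- map_mx (@tensr R S) X) y y' = - tens 1 (X y y') by rewrite !mxE.
  rewrite oppE mulmx_sgn mul_sgnmx [M' y y']mxE.
  case: (oddz (bdeg D y)); case: (oddz (bdeg D y'));
  by rewrite /= ?expr0 ?expr1 ?mul1r ?mulr1 ?mulN1r ?mulrN1 ?opprK ?tensNr ?opprK.
- rewrite BE [_%:M _ _]mxE (negPf nxx) mulr0n tens0l add0r => nz.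
  rewrite (bd_homog cC (i := x) (j := x')) ?opprB; first by lia.
  by apply: contraNneq nz => ->; rewrite tens0l !mulr0.
symmetry; apply: sum_by_parity => x; rewrite /F; case: ifP => ox; last by rewrite K1_map_torsion.
have [_ ->] := torsion_opp (imapr _ _ iEM); congr (_ + _).
by rewrite -K1_map_torsion // tEM K1_mapN.
Qed.
End TensorRight.

Lemma card_predE (I : finType) (P : pred I) : #|[pred x | P x]| = (\sum_x P x)%N.
Proof. by rewrite -sum1_card big_mkcond; apply: eq_bigr => x _; rewrite inE; case: (P x). Qed.

Lemma odd_rank_tensor n m (C : based_complex R n) (D : based_complex S m) :
  odd_rank (tensor_based C D) = (even_rank C * odd_rank D + odd_rank C * even_rank D)%N.
Proof.
pose P (p : 'I_n * 'I_m) := oddz (bdeg C p.1) (+) oddz (bdeg D p.2).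
have -> : odd_rank (tensor_based C D) = (\sum_x \sum_y P (x, y))%N.
  rewrite /odd_rank card_predE (reindex (@of_pair n m)); last first.
    by apply: onW_bij; exists (@pair_of n m); [apply: of_pairK | apply: pair_ofK].
  by rewrite pair_bigA; apply: eq_bigr => -[x y] _; rewrite tensor_deg oddzD.
rewrite /even_rank /odd_rank !card_predE !big_distrlr -big_split; apply: eq_bigr => x _ /=.
rewrite -big_split; apply: eq_bigr => y _ /=.
by rewrite /P /=; case: oddz; case: oddz.
Qed.

Lemma eq_odd_rank (U : pzRingType) n (C D : based_complex U n) :
  same_parity C D -> odd_rank C = odd_rank D.
Proof. by move=> pCD; apply: eq_card => x; rewrite !inE pCD. Qed.

Lemma eq_even_rank (U : pzRingType) n (C D : based_complex U n) :
  same_parity C D -> even_rank C = even_rank D.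
Proof. by move=> pCD; apply: eq_card => x; rewrite !inE pCD. Qed.

(** [f (x) g = (f (x) 1) (1 (x) g)]. *)
Lemma has_torsion_tensor n m (C C' : based_complex R n) (D D' : based_complex S m) f g u v :
  has_torsion C C' f u -> has_torsion D D' g v ->
  has_torsion (tensor_based C D) (tensor_based C' D') (tmx f g)
    (K1_map (@tensl R S) u *+ even_rank D - K1_map (@tensl R S) u *+ odd_rank D
     + (K1_map (@tensr R S) v *+ even_rank C - K1_map (@tensr R S) v *+ odd_rank C)
     + tN1 *+ (n * odd_rank D + m * odd_rank C
               + (even_rank C * odd_rank D + odd_rank C * even_rank D))).
Proof.
move=> tf tg; have [pC _] := tf.
have [cC cC' _] := has_torsion_parts tf; have [cD cD' _] := has_torsion_parts tg.
have := has_torsion_comp (has_torsion_tensorr tg cC') (has_torsion_tensorl tf cD).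
rewrite !tmxE (tensor_mxM (pair_of_bij n m)) mulmx1 mul1mx.
rewrite -[#|_|]/(odd_rank (tensor_based C D)) odd_rank_tensor.
rewrite -(eq_odd_rank pC) -(eq_even_rank pC); congr has_torsion.
rewrite !mulrnDr; move: tN1 (K1_map _ u) (K1_map _ v) => t a b; zmodule.
Qed.
End Tensor.

(** * Families of morphisms as matrices *)

Lemma sgn_oddz (R : pzRingType) (k : int) : sgn k = (-1) ^+ oddz k :> R.
Proof. by rewrite /sgn -signr_odd. Qed.

Section Models.
Variable R : invRingType.
Implicit Types B C D E : signed_complex R.

(** The order of the basis elements is left free: duals, cones and products are then
    numbered so that their matrices are given by [mxsub], [cone_d] and [tensor_mx]. *)
Record model C n := Model {
  menc : forall r, 'I_(crk C r) -> 'I_n;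
  mdec : 'I_n -> {r : int & 'I_(crk C r)};
  mencK : forall r a, mdec (@menc r a) = Tagged (fun r => 'I_(crk C r)) a;
  mdecK : forall x, menc (tagged (mdec x)) = x
}.
Arguments menc {C n} m {r} a.

Definition mdeg C n (M : model C n) x : int := tag (mdec M x).

Lemma mdeg_enc C n (M : model C n) r a : mdeg M (@menc _ _ M r a) = r.
Proof. by rewrite /mdeg mencK. Qed.

Lemma modelW C n (M : model C n) (P : 'I_n -> Prop) :
  (forall r a, P (@menc _ _ M r a)) -> forall x, P x.
Proof. by move=> H x; rewrite -(mdecK M x). Qed.

Lemma menc_inj C n (M : model C n) r : injective (@menc _ _ M r).
Proof. by move=> a b /(congr1 (mdec M)); rewrite !mencK => /eqP; rewrite eq_Tagged => /eqP. Qed.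

Lemma model_bij C n (enc : {r : int & 'I_(crk C r)} -> 'I_n) :
  injective enc -> (forall x, exists p, enc p = x) ->
  exists M : model C n, forall r a, @menc _ _ M r a = enc (Tagged (fun r => 'I_(crk C r)) a).
Proof.
move=> inj surj; pose dec x := projT1 (cid (surj x)).
have decK x : enc (dec x) = x by rewrite /dec; case: cid.
have encK p : dec (enc p) = p by apply: inj; rewrite decK.
exists (@Model C n (fun r a => enc (Tagged (fun r => 'I_(crk C r)) a)) dec (fun r a => encK _)
  (fun x => etrans (f_equal enc (taggedK _)) (decK x))).
by [].
Qed.

Lemma sum_degree (V : zmodType) C n (M : model C n) s (F : 'I_n -> V) :
  (forall x, mdeg M x != s -> F x = 0) -> \sum_x F x = \sum_b F (@menc _ _ M s b).
Proof.
move=> F0; rewrite (bigID (fun x => mdeg M x == s)) /= [X in _ + X]big1 // addr0.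
rewrite -big_filter -(big_map (@menc _ _ M s) predT F); apply: perm_big.
apply: uniq_perm.
- by rewrite filter_uniq // index_enum_uniq.
- by rewrite map_inj_uniq ?index_enum_uniq //; exact: menc_inj.
move=> x; rewrite mem_filter mem_index_enum andbT; apply/eqP/mapP.
  elim/(@modelW _ _ M): x => r a; rewrite mdeg_enc => rs.
  by subst s; exists a; rewrite ?mem_index_enum.
by move=> [b _ ->]; rewrite mdeg_enc.
Qed.

Lemma crk_mdeg C n (M : model C n) r : crk C r = (\sum_x (mdeg M x == r))%N.
Proof.
rewrite -card_predE -[LHS]card_ord -(card_image (@menc_inj _ _ M r) predT).
apply: eq_card => x; rewrite [RHS]inE; apply/fintype.imageP/eqP.
  by move=> [b _ ->]; rewrite mdeg_enc.
elim/(@modelW _ _ M): x => s a; rewrite mdeg_enc => rs.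
by subst s; exists a.
Qed.

Definition flat C D n m (M : model C n) (M' : model D m) (f : gmap C D) : 'M[R]_(m, n) :=
  \matrix_(y, x) f (tag (mdec M x)) (tag (mdec M' y)) (tagged (mdec M' y)) (tagged (mdec M x)).

Definition unflat C D n m (M : model C n) (M' : model D m) (A : 'M[R]_(m, n)) : gmap C D :=
  fun r s => \matrix_(b, a) A (menc M' b) (menc M a).

Lemma flatE C D n m (M : model C n) (M' : model D m) (f : gmap C D) r s a b :
  flat M M' f (@menc _ _ M' s b) (@menc _ _ M r a) = f r s b a.
Proof. by rewrite mxE !mencK. Qed.

Lemma flatP C D n m (M : model C n) (M' : model D m) (f : gmap C D) (A : 'M[R]_(m, n)) :
  (forall r s a b, A (@menc _ _ M' s b) (@menc _ _ M r a) = f r s b a) <-> A = flat M M' f.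
Proof.
split=> [Af|->]; last by move=> *; rewrite flatE.
apply/matrixP => y x; elim/(@modelW _ _ M): x => r a; elim/(@modelW _ _ M'): y => s b.
by rewrite flatE.
Qed.

Lemma flat_unflat C D n m (M : model C n) (M' : model D m) (A : 'M[R]_(m, n)) :
  flat M M' (unflat M M' A) = A.
Proof. by apply/esym/flatP => r s a b; rewrite mxE. Qed.

Lemma flat_inj C D n m (M : model C n) (M' : model D m) (f g : gmap C D) :
  flat M M' f = flat M M' g <-> forall r s, f r s = g r s.
Proof.
split=> [/flatP fg r s|fg]; last by apply/flatP => *; rewrite flatE fg.
by apply/matrixP => b a; rewrite -fg flatE.
Qed.

Lemma flatD C D n m (M : model C n) (M' : model D m) (f g : gmap C D) :
  flat M M' f + flat M M' g = flat M M' (fun r s => f r s + g r s).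
Proof. by apply/flatP => r s a b; rewrite mxE !flatE mxE. Qed.

Lemma flatN C D n m (M : model C n) (M' : model D m) (f : gmap C D) :
  - flat M M' f = flat M M' (fun r s => - f r s).
Proof. by apply/flatP => r s a b; rewrite mxE !flatE mxE. Qed.

Lemma flat_degree C D n m (M : model C n) (M' : model D m) (f : gmap C D) k :
  has_degree k f <-> homog (mdeg M') (mdeg M) k (flat M M' f).
Proof.
split=> [fk y x|fk r s rs].
  elim/(@modelW _ _ M): x => r a; elim/(@modelW _ _ M'): y => s b.
  rewrite flatE !mdeg_enc => nz; apply/eqP; apply: contraNT nz => /fk ->.
  by rewrite mxE.
apply/matrixP => b a; rewrite -(flatE M M') [RHS]mxE; apply/eqP.
by apply: contraNT rs => nz; have := fk _ _ nz; rewrite !mdeg_enc => ->.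
Qed.

Lemma flat_mul_at C D E n m p (M : model C n) (M' : model D m) (M'' : model E p)
    (f : gmap C D) (g : gmap D E) (k : int -> int) : (forall r s, s != k r -> f r s = 0) ->
  flat M' M'' g *m flat M M' f = flat M M'' (fun r s => g (k r) s *m f r (k r)).
Proof.
move=> fk; apply/flatP => r s a b; rewrite !mxE (sum_degree (M := M') (s := k r)).
  by apply: eq_bigr => x _; rewrite !flatE.
move=> x; elim/(@modelW _ _ M'): x => t c; rewrite mdeg_enc => ne.
by rewrite !flatE (fk _ _ ne) mxE mulr0.
Qed.

Lemma flat_mul C D E n m p (M : model C n) (M' : model D m) (M'' : model E p)
    (f : gmap C D) (g : gmap D E) k : has_degree k f ->
  flat M' M'' g *m flat M M' f = flat M M'' (fun r s => g (r + k) s *m f r (r + k)).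
Proof. exact: (@flat_mul_at _ _ _ _ _ _ _ _ _ _ _ (fun r => r + k)). Qed.

Lemma flat_gid C n (M : model C n) : flat M M (@gid _ C) = 1%:M.
Proof.
apply/esym/flatP => r s a b; rewrite mxE /gid; case: eqVneq => [e|ne].
  have rs : r = s by rewrite -(mdeg_enc M a) -(mdeg_enc M b) e.
  subst s; rewrite eqxx; move: e => /menc_inj ->; rewrite mxE eqxx ltn_ord //.
case: eqVneq => [rs|]; last by rewrite mxE.
subst s; rewrite mxE; case: eqVneq => // ab; case/eqP: ne; congr menc.
exact/val_inj.
Qed.

Definition based C n (M : model C n) : based_complex R n :=
  BasedComplex (mdeg M) (flat M M (@cd _ C)).

Lemma based_is_complex C n (M : model C n) : is_signed_complex C -> is_complex (based M).
Proof.
move=> cC; split; first by apply/flat_degree; exact: (cd_degree cC).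
rewrite /= (flat_mul _ _ _ _ (cd_degree cC)) -[RHS](flat_unflat M M); apply/flat_inj => r s.
have -> : unflat M M 0 r s = 0 by apply/matrixP => i j; rewrite !mxE.
have [e|ne] := eqVneq s (r - 1 - 1); last by rewrite (cd_degree cC) ?mul0mx.
have -> : r - 1 = s + 1 by rewrite e subrK.
have -> : r = s + 2 by rewrite e; lia.
exact: (cd_cd cC).
Qed.

Lemma flat_contraction C n (M : model C n) (G0 : 'M[R]_n) (G : gmap C C) :
  contraction (mdeg M) (flat M M (@cd _ C)) G0 ->
  is_contraction G -> contraction (mdeg M) (flat M M (@cd _ C)) (flat M M G).
Proof.
move=> [dh dd _ _] [G1 GE]; split=> //; first exact/flat_degree.
have d1 : has_degree (-1) (@cd _ C) by apply/(flat_degree M M).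
rewrite (flat_mul _ _ _ _ G1) (flat_mul _ _ _ _ d1) flatD -(flat_gid M); apply/flat_inj => r s.
have [e|ne] := eqVneq s r.
  by subst s; rewrite GE /gid eqxx; apply/matrixP => i j; rewrite !mxE ltn_ord andbT.
rewrite /gid (eq_sym r) (negbTE ne) d1; last by rewrite addrK.
by rewrite (G1 (r - 1)) ?subrK // !mul0mx addr0.
Qed.

Lemma unflat_contraction C n (M : model C n) (G : 'M[R]_n) :
  contraction (mdeg M) (flat M M (@cd _ C)) G -> is_contraction (unflat M M G).
Proof.
move=> [dh _ Gh dG].
have d1 : has_degree (-1) (@cd _ C) by apply/(flat_degree M M).
have G1 : has_degree 1 (unflat M M G) by apply/(flat_degree M M); rewrite flat_unflat.
split=> // r; move: dG; rewrite -{1 2}(flat_unflat M M G) (flat_mul _ _ _ _ G1).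
rewrite (flat_mul _ _ _ _ d1) flatD -(flat_gid M) => /flat_inj/(_ r r) ->.
by rewrite /gid eqxx; apply/matrixP => i j; rewrite !mxE ltn_ord andbT.
Qed.

Lemma flat_chain C D n (M : model C n) (M' : model D n) (f : gmap D C) :
  is_signed_complex C -> is_signed_complex D ->
  is_chain_map f -> is_chain (based M) (based M') (flat M' M f).
Proof.
move=> cC cD [f0 fd]; split; first exact/flat_degree.
rewrite /= (flat_mul _ _ _ _ f0) (flat_mul _ _ _ _ (cd_degree cD)); apply/flat_inj => r s.
have [e|ne] := eqVneq s (r - 1); last first.
  by rewrite addr0 (@cd_degree _ _ cC _ _ ne) (f0 (r - 1)) ?addr0 // !mul0mx.
have -> : r = s + 1 by rewrite e subrK.
by rewrite addr0 addrK fd.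
Qed.

Lemma flat_homotopic C D n m (M : model C n) (M' : model D m) (f g : gmap C D) :
  is_signed_complex C -> is_signed_complex D ->
  has_degree 0 f -> has_degree 0 g -> chain_homotopic f g ->
  exists2 h, homog (mdeg M') (mdeg M) 1 h &
    flat M M' f - flat M M' g = bd (based M') *m h + h *m bd (based M).
Proof.
move=> cC cD f0 g0 [h h1 hE]; exists (flat M M' h); first exact/flat_degree.
rewrite /= (flat_mul _ _ _ _ h1) (flat_mul _ _ _ _ (cd_degree cC)) flatN !flatD.
apply/flat_inj => r s; have [e|ne] := eqVneq s r; first by subst s; rewrite hE.
rewrite f0 ?addr0 // g0 ?addr0 // (@cd_degree _ _ cD (r + 1)) ?addrK // (h1 (r - 1)) ?subrK //.
by rewrite !mul0mx subrr addr0.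
Qed.

Lemma flat_equivalence C D n (M : model C n) (M' : model D n) (f : gmap D C) :
  is_signed_complex C -> is_signed_complex D -> is_chain_equivalence f ->
  exists G, contraction (cone_deg (based M) (based M'))
    (cone_d (based M) (based M') (flat M' M f)) G.
Proof.
move=> cC cD [cf [g [cg gf fg]]]; have [f0 g0] := (cf.1, cg.1).
have comp0 (A B E : signed_complex R) (k : gmap A B) (l : gmap B E) :
    has_degree 0 k -> has_degree 0 l -> has_degree 0 (gcomp l k).
  by move=> k0 l0 r s; rewrite addr0 => rs; rewrite /gcomp k0 ?mulmx0 // addr0.
have id0 A : has_degree 0 (@gid R A).
  by move=> r s; rewrite addr0 /gid eq_sym => /negbTE ->.
have flat_comp (A B E : signed_complex R) (MA : model A n) (MB : model B n) (ME : model E n)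
    (k : gmap A B) (l : gmap B E) : has_degree 0 k -> has_degree 0 l ->
    flat MA ME (gcomp l k) = flat MB ME l *m flat MA MB k.
  move=> k0 l0; rewrite (flat_mul _ _ _ _ k0); apply/flat_inj => r s; rewrite /gcomp addr0.
  by have [->//|ne] := eqVneq s r; rewrite k0 ?mulmx0 ?l0 ?mul0mx // addr0.
have [k k1 kE] := flat_homotopic M' M' cD cD (comp0 _ _ _ _ _ f0 g0) (id0 D) gf.
have [h h1 hE] := flat_homotopic M M cC cC (comp0 _ _ _ _ _ g0 f0) (id0 C) fg.
rewrite (flat_comp _ _ _ _ M) // flat_gid in kE.
rewrite (flat_comp _ _ _ _ M') // flat_gid in hE.
apply: (@cone_contractible _ _ _ _ _ (flat M M' g) h k) hE kE => //.
- exact: based_is_complex.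
- exact: based_is_complex.
- exact: flat_chain.
- exact: flat_chain.
Qed.

(** * Numberings of a complex, of duals and of cones *)

Lemma model_exists C : (forall r : int, (r < 0) || ((cdim C)%:Z < r) -> crk C r = 0%N) ->
  exists n, exists M : model C n, True.
Proof.
move=> out; pose p (i : 'I_(cdim C).+1) := crk C i.
pose f (q : {i & 'I_(p i)}) : {r : int & 'I_(crk C r)} :=
  Tagged (fun r : int => 'I_(crk C r)) (tagged q).
have f_inj : injective f.
  move=> [i a] [j b] e; have ij : i = j by apply/val_inj; case: (congr1 tag e).
  by subst j; move/eqP: e; rewrite eq_Tagged => /eqP /= ->.
have f_surj y : exists q, f q = y.
  case: y => r a; have : ~~ ((r < 0) || ((cdim C)%:Z < r)).
    by apply/negP => /out r0; move: a; rewrite r0; case.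
  rewrite negb_or -!leNgt; case: r a => // r a /andP[_]; rewrite lez_nat -ltnS => lt_r.
  by exists (existT (fun i => 'I_(p i)) (Ordinal lt_r) a).
pose g y := projT1 (cid (f_surj y)).
have gK y : f (g y) = y by rewrite /g; case: cid.
have [||M _] := @model_bij C _ (fun y => tagnat.rank (g y)); last by exists (\sum_i p i)%N, M.
  by move=> y z /tagnat.rank_inj e; rewrite -(gK y) e gK.
move=> x; exists (f (tagnat.sig x)); rewrite -[RHS]tagnat.sigK; congr tagnat.rank.
by apply: f_inj; rewrite gK.
Qed.

(** The involution [s] serves to number the dual so that degrees have the same parity
    in [C] and in its dual; the identity achieves this only in even dimension. *)
Definition dual_numbering C n (M : model C n) (s : 'I_n -> 'I_n)
    (M' : model (dual_complex C) n) : Prop :=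
  forall (r : int) (a : 'I_(crk (dual_complex C) r)),
    menc M' a = s (@menc _ _ M ((cdim C)%:Z - r) a).

Lemma dual_model_exists C n (M : model C n) (s : 'I_n -> 'I_n) : involutive s ->
  exists M', dual_numbering M s M'.
Proof.
move=> sK; pose enc (q : {r : int & 'I_(crk (dual_complex C) r)}) : 'I_n :=
  s (@menc _ _ M ((cdim C)%:Z - tag q) (tagged q)).
have [||M' M'E] := @model_bij (dual_complex C) n enc; last by exists M'.
  move=> [r a] [t b] /(can_inj sK) /= /(congr1 (mdec M)); rewrite !mencK => e.
  have rt : r = t by move: (congr1 tag e) => /= /addrI /oppr_inj.
  by subst t; move/eqP: e; rewrite eq_Tagged => /eqP /= ->.
move=> x; rewrite -(sK x); elim/(@modelW _ _ M): (s x) => p a.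
have [r pr] : exists r, p = (cdim C)%:Z - r by exists ((cdim C)%:Z - p); rewrite subKr.
by subst p; exists (existT _ r a).
Qed.

Definition cone_numbering C D n m (M : model C n) (M' : model D m) (f : gmap C D)
    (N : model (mapping_cone f) (m + n)) : Prop :=
  forall (r : int) (c : 'I_(crk (mapping_cone f) r)), menc N c =
    match split c with
    | inl b => lshift n (@menc _ _ M' r b)
    | inr a => rshift m (@menc _ _ M (r - 1) a)
    end.

Lemma cone_model_exists C D n m (M : model C n) (M' : model D m) (f : gmap C D) :
  exists N : model (mapping_cone f) (m + n), cone_numbering M M' N.
Proof.
pose enc (q : {r : int & 'I_(crk (mapping_cone f) r)}) : 'I_(m + n) :=
  match split (tagged q : 'I_(crk D (tag q) + crk C (tag q - 1))) with
  | inl b => lshift n (@menc _ _ M' (tag q) b)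
  | inr a => rshift m (@menc _ _ M (tag q - 1) a)
  end.
have [||N NE] := @model_bij (mapping_cone f) (m + n) enc; last by exists N.
  move=> [r c] [t c'] /=; rewrite /enc /=.
  case: (@splitP _ _ c) => b cb; case: (@splitP _ _ c') => b' cb' e.
  - move/lshift_inj: e => /(congr1 (mdec M')); rewrite !mencK => e.
    have rt : r = t by exact: (congr1 tag e).
    subst t; move/eqP: e; rewrite eq_Tagged => /eqP /= bb.
    by congr existT; apply/val_inj; rewrite /= cb cb' bb.
  - by move/eqP: e; rewrite eq_lrshift.
  - by move/eqP: e; rewrite eq_rlshift.
  - move/rshift_inj: e => /(congr1 (mdec M)); rewrite !mencK => e.
    have rt : r = t by move: (congr1 tag e) => /= /addIr.
    subst t; move/eqP: e; rewrite eq_Tagged => /eqP /= bb.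
    by congr existT; apply/val_inj; rewrite /= cb cb' bb.
elim/splitW => x.
  elim/(@modelW _ _ M'): x => r b.
  by exists (existT _ r (lshift (crk C (r - 1)) b)); rewrite /enc /= (unsplitK (inl _)).
elim/(@modelW _ _ M): x => r a.
have [t rt] : exists t, r = t - 1 by exists (r + 1); rewrite addrK.
by subst r; exists (existT _ t (rshift (crk D t) a)); rewrite /enc /= (unsplitK (inr _)).
Qed.

Lemma mdeg_dual C n (M : model C n) (s : 'I_n -> 'I_n) (M' : model (dual_complex C) n) :
  involutive s ->
  dual_numbering M s M' ->
  forall x, mdeg M' x = (cdim C)%:Z - mdeg M (s x).
Proof.
move=> sK M'E x; elim/(@modelW _ _ M'): x => r a.
by rewrite mdeg_enc M'E sK mdeg_enc subKr.
Qed.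

Lemma flat_dual C n (M : model C n) (s : 'I_n -> 'I_n) (M' : model (dual_complex C) n) :
  involutive s ->
  dual_numbering M s M' ->
  flat M' M' (@cd _ (dual_complex C)) =
  mxsub s s (adjmx (flat M M (@cd _ C)) *m
    sgnmx (fun x => (cdim C)%:Z - mdeg M x)).
Proof.
move=> sK M'E; apply/esym/flatP => r t a b; rewrite mxE mulmx_sgn.
rewrite !M'E !sK mdeg_enc subKr mxE mxE flatE /= !mxE.
by rewrite sgn_oddz.
Qed.

Lemma flat_duality C n (M : model C n) (s : 'I_n -> 'I_n) (M' : model (dual_complex C) n)
    (phi0 : gmap C C) : involutive s ->
  dual_numbering M s M' ->
  flat M' M (duality_map phi0) = colsub s (flat M M phi0).
Proof.
move=> sK M'E; apply/esym/flatP => r t a b.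
by rewrite mxE M'E sK flatE.
Qed.

Section ConeModel.
Variables (C D : signed_complex R) (n : nat) (M : model C n) (M' : model D n) (f : gmap C D).
Variable N : model (mapping_cone f) (n + n).
Hypothesis NE : cone_numbering M M' N.

Lemma cone_menc_l r b : menc N (lshift (crk C (r - 1)) b) = lshift n (@menc _ _ M' r b).
Proof. by rewrite NE (unsplitK (inl _)). Qed.
Lemma cone_menc_r r a : menc N (rshift (crk D r) a) = rshift n (@menc _ _ M (r - 1) a).
Proof. by rewrite NE (unsplitK (inr _)). Qed.

Lemma mdeg_cone : mdeg N =1 cone_deg (based M') (based M).
Proof.
move=> x; elim/(@modelW _ _ N): x => r c; rewrite mdeg_enc; elim/splitW: c => [b|a].
  by rewrite cone_menc_l /cone_deg degs_l /= mdeg_enc.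
by rewrite cone_menc_r /cone_deg degs_r /= mdeg_enc subrK.
Qed.

Lemma flat_cone : flat N N (@cd _ (mapping_cone f)) =
  cone_d (based M') (based M) (flat M M' f).
Proof.
apply/esym/flatP => r s a b; elim/splitW: a => a; elim/splitW: b => b /=.
- by rewrite !cone_menc_l !block_mxEul flatE.
- by rewrite cone_menc_l cone_menc_r !block_mxEdl !mxE.
- rewrite cone_menc_l cone_menc_r !block_mxEur mulmx_sgn flatE /= mdeg_enc mxE.
  by rewrite sgn_oddz !oddzD.
- by rewrite !cone_menc_r !block_mxEdr flatE.
Qed.

End ConeModel.

End Models.
Arguments menc {R C n} m {r} a.

Arguments pair_of : simpl never.
Arguments of_pair : simpl never.

Lemma oddzM k l : oddz (k * l) = oddz k && oddz l.
Proof. by rewrite /oddz abszM oddM. Qed.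

(** * The numbering of a product *)

Section TensorModel.
Variables R S : invRingType.
Variables (C : signed_complex R) (D : signed_complex S) (eta : K1 (tensor_ring R S)).
Variables (n m : nat) (M : model C n) (M' : model D m).
Local Notation T := (tensor_complex C D eta).

Let p (r : int) (i : 'I_(cdim C).+1) := (crk C i * crk D (r - i%:Z))%N.
Let E (r : int) (q : {i & 'I_(p r i)}) : 'I_(n * m) :=
  of_pair (menc M (pair_of (tagged q)).1, menc M' (pair_of (tagged q)).2).

Let E_inj r r' (q : {i & 'I_(p r i)}) (q' : {i & 'I_(p r' i)}) : E q = E q' ->
  existT (fun r => {i & 'I_(p r i)}) r q = existT (fun r => {i & 'I_(p r i)}) r' q'.
Proof.
case: q q' => [i w] [i' w'] /(can_inj (@of_pairK n m)).
cbn [tagged projT2] => -[/(congr1 (mdec M)) + /(congr1 (mdec M'))].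
rewrite !mencK => e e'; have ii : i = i' by apply/val_inj; case: (congr1 tag e).
subst i'; have rr : r = r' by move: (congr1 tag e') => /= /addIr.
subst r'; move/eqP: e; rewrite eq_Tagged => /eqP {}e.
move/eqP: e'; rewrite eq_Tagged => /eqP {}e'.
have {}e : (pair_of w).1 = (pair_of w').1 by exact: e.
have {}e' : (pair_of w).2 = (pair_of w').2 by exact: e'.
suff -> : w = w' by [].
by rewrite -(pair_ofK w) -(pair_ofK w') [pair_of w]surjective_pairing e e' -surjective_pairing.
Qed.

Definition tensor_numbering (N : model T (n * m)) : Prop :=
  forall (r : int) (z : 'I_(crk T r)),
    menc N z = of_pair (menc M (pair_of (tagnat.sig2 z)).1,
                        menc M' (pair_of (tagnat.sig2 z)).2).

Lemma tensor_model_exists :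
  (forall r : int, (r < 0) || ((cdim C)%:Z < r) -> crk C r = 0%N) ->
  exists N, tensor_numbering N.
Proof.
move=> out; pose enc (q : {r : int & 'I_(crk T r)}) := E (tagnat.sig (tagged q)).
have [||N NE] := @model_bij _ T (n * m) enc; last by exists N.
  move=> [r z] [r' z'] /E_inj /= e.
  have rr : r = r' by exact: (congr1 (@projT1 _ _) e).
  subst r'; congr existT; apply/tagnat.sig_inj/eqP; 
  by move/eqP: e; rewrite eq_Tagged.
move=> k; rewrite -(pair_ofK k); case: (pair_of k) => x y.
elim/(@modelW _ _ _ M): x => i a; elim/(@modelW _ _ _ M'): y => j b.
have : ~~ ((i < 0) || ((cdim C)%:Z < i)) by apply/negP => /out r0; move: a; rewrite r0; case.
rewrite negb_or -!leNgt; case: i a => // i a /andP[_]; rewrite lez_nat -ltnS => lt_i.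
have [r jr] : exists r, j = r - i%:Z by exists (j + i%:Z); rewrite addrK.
subst j; exists (existT _ r (tagnat.rank
  (existT (fun i => 'I_(p r i)) (Ordinal lt_i) (mxtens_index (a, b))))).
by rewrite /enc /= tagnat.rankK /E; cbn [tagged projT2]; rewrite (@of_pairK _ _ (a, b)).
Qed.

Variable N : model T (n * m).
Hypothesis NE : tensor_numbering N.

Lemma mdeg_tensor : mdeg N =1 bdeg (tensor_based (based M) (based M')).
Proof.
move=> x; elim/(@modelW _ _ _ N): x => r z; rewrite mdeg_enc NE /tensor_based.
by cbn [bdeg based]; rewrite of_pairK; cbn [fst snd]; rewrite !mdeg_enc addrC subrK.
Qed.

Lemma tmx_rect k l k' l' (A : 'M[R]_(k, l)) (B : 'M[S]_(k', l')) i j :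
  tmx A B i j = tens (A (pair_of i).1 (pair_of j).1) (B (pair_of i).2 (pair_of j).2).
Proof. by rewrite /tmx !mxE tensM mul1r mulr1. Qed.

Lemma flat_tensor_cd :
  flat N N (@cd _ T) = bd (tensor_based (based M) (based M')).
Proof.
apply/esym/flatP => r s a b; rewrite [bd _]/= mxE !tmx_rect [RHS]mxE [RHS]mxE.
rewrite [X in _ = _ + X]mxE !tmx_rect !NE !of_pairK; cbn [fst snd].
rewrite flatE -(flat_gid M) flatE; congr (_ + _).
rewrite flatE -{1}[sgnmx _]mulmx1 mul_sgnmx -(flat_gid M') flatE mdeg_enc.
rewrite sgn_oddz /gid; case: eqVneq => [rs|ne]; last by rewrite !mxE mulr0 !tens0r mulr0.
have -> : oddz (s - (tagnat.sig1 b)%:Z) = oddz (r - (tagnat.sig1 a)%:Z) by rewrite rs.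
by rewrite !mulr_sign; case: (oddz _); rewrite // tensNr.
Qed.

Lemma flat_tensor_phi0 (phi0 : gmap C C) (theta0 : gmap D D) :
  flat N N (tensor_phi0 eta phi0 theta0) =
  tmx (flat M M phi0) (flat M' M' (transposition theta0)) *m
  signs_mx _ (fun k => oddz ((cdim C)%:Z - mdeg M (pair_of k).1) && oddz (mdeg M' (pair_of k).2)).
Proof.
apply/esym/flatP => r s a b; rewrite mulmx_signs !tmx_rect [RHS]mxE [RHS]mxE !tmx_rect.
rewrite !NE !of_pairK; cbn [fst snd]; rewrite !flatE !mdeg_enc.
by rewrite sgn_oddz oddzM.
Qed.

End TensorModel.

(** * The sign of the order of the basis *)

Lemma frame_card w a b (P : 'I_w -> bool) (f : 'I_a -> 'I_w) (g : 'I_b -> 'I_w) :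
  frame P f -> frame P g -> a = b.
Proof.
move=> fP gP; rewrite -[a]card_ord -[b]card_ord -(card_codom (frame_inj fP)).
rewrite -(card_codom (frame_inj gP)); apply: eq_card => z.
by rewrite -(frameP fP) -(frameP gP).
Qed.

Lemma frame_perm w n (P : 'I_w -> bool) (f g : 'I_n -> 'I_w) :
  frame P f -> frame P g -> exists s : 'S_n, forall i, f i = g (s i).
Proof.
move=> fP gP.
have ex i : exists j, f i == g j.
  by have := frame_mem i fP; rewrite (frameP gP) => /codomP[j ->]; exists j.
pose s i := xchoose (ex i); have sE i : f i = g (s i) by apply/eqP; exact: (xchooseP (ex i)).
have s_inj : injective s by move=> i j e; apply: (frame_inj fP); rewrite !sE e.
by exists (perm s_inj) => i; rewrite permE.
Qed.

(** The two sorted frames differ from [e1] and [o1] by permutations [s] and [t], and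
    the sum counts the inversions of [t s^-1]. *)
Lemma torsion_mxsub_sorted (R : pzRingType) w n a b (lt : rel 'I_w) (P Q : 'I_w -> bool)
    (e : 'I_a -> 'I_w) (o : 'I_b -> 'I_w) (e1 o1 : 'I_n -> 'I_w) (A : 'M[R]_w) :
  frame P e -> frame P e1 -> frame Q o -> frame Q o1 ->
  (forall i j : 'I_a, lt (e i) (e j) = (i < j)%N) ->
  (forall i j : 'I_b, lt (o i) (o j) = (i < j)%N) ->
  mx_invertible (mxsub e1 o1 A) ->
  torsion (mxsub e o A) = torsion (mxsub e1 o1 A) +
    torsion ((-1)%:M : 'M[R]_1) *+ (\sum_x \sum_y (lt (o1 x) (o1 y) && lt (e1 y) (e1 x)))%N.
Proof.
move=> eP e1P oP o1P; have an := frame_card eP e1P; have bn := frame_card oP o1P.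
subst a b => le lo iA; have [s es] := frame_perm eP e1P; have [t ot] := frame_perm oP o1P.
have -> : mxsub e o A = mxsub s t (mxsub e1 o1 A).
  by apply/matrixP => i j; rewrite !mxE es ot.
rewrite (torsion_mxsub_perm s t iA).2; congr (_ + _).
rewrite torsionN1_odd [RHS]torsionN1_odd; congr (_ *+ nat_of_bool _).
rewrite oddD !oddb addbC -(odd_permV s) -odd_permM odd_perm_inversions.
rewrite pair_big card_predE [in RHS](reindex (fun p => (t p.1, t p.2))) /=; last first.
  exists (fun p => (t^-1%g p.1, t^-1%g p.2)) => p _ /=; case: p => x y /=.
    by rewrite !permK.
  by rewrite !permKV.
congr odd; apply: eq_bigr => -[i j] _ /=.
by rewrite !permM -lo -le !es !ot !permKV.
Qed.

Section ModelOrder.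
Variables (R : invRingType) (C : signed_complex R) (n : nat) (M : model C n).

Definition mpos x : nat := tagged (mdec M x).

Lemma mpos_enc r a : mpos (@menc _ _ _ M r a) = a.
Proof. by rewrite /mpos mencK. Qed.

(** The order in which [odd_to_even] lists the bases of [C_odd] and [C_even]. *)
Definition mlt : rel 'I_n := fun x y =>
  (mdeg M x < mdeg M y) || (mdeg M x == mdeg M y) && (mpos x < mpos y)%N.

Lemma mlt_enc r s a b : mlt (@menc _ _ _ M r a) (@menc _ _ _ M s b) =
  (r < s) || (r == s) && (a < b)%N.
Proof. by rewrite /mlt !mdeg_enc !mpos_enc. Qed.

Section DegreeFrame.
Variables (g : nat -> int).
Hypothesis g_inc : forall i j, (g i < g j) = (i < j)%N.

Let p (i : 'I_(cdim C).+1) := crk C (g i).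
Definition degree_frame (z : 'I_(\sum_i p i)) : 'I_n := menc M (tagnat.sig2 z : 'I_(crk C (g (tagnat.sig1 z)))).

Lemma degree_frame_lt y z : mlt (degree_frame y) (degree_frame z) = (y < z)%N.
Proof.
rewrite /degree_frame mlt_enc g_inc -[RHS](tagnat.lt_sig y z) ltEsig.
have g_inj i j : (g i == g j) = (i == j).
  by apply/eqP/eqP => [e|-> //]; case: (ltngtP i j); rewrite // -g_inc e ltxx.
rewrite g_inj /tagnat.sig2 /tagnat.sig1.
case: (tagnat.sig y) => i a; case: (tagnat.sig z) => j b.
rewrite !leEord !ltEord /=; case: (ltngtP i j) => //= /val_inj ij.
by subst j; rewrite tagged_asE.
Qed.

Lemma degree_frameP (P : 'I_n -> bool) :
  (forall x, P x = [exists i : 'I_(cdim C).+1, mdeg M x == g i]) -> frame P degree_frame.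
Proof.
move=> PE; split=> [y z e|x].
  apply/val_inj; have := degree_frame_lt y z; have := degree_frame_lt z y.
  by rewrite e /mlt ltxx eqxx ltnn; case: ltngtP.
rewrite PE; apply/existsP/codomP => [[i]|[z ->]].
  elim/(@modelW _ _ _ M): x => r a; rewrite mdeg_enc => /eqP rg; subst r.
  exists (tagnat.rank (existT (fun i => 'I_(p i)) i a)).
  by rewrite /degree_frame /tagnat.sig2 /tagnat.sig1 tagnat.rankK.
by exists (tagnat.sig1 z); rewrite mdeg_enc.
Qed.
End DegreeFrame.

Hypothesis deg_range : forall x, 0 <= mdeg M x <= (cdim C)%:Z.

Definition odd_frame : 'I_(rk_odd C) -> 'I_n := degree_frame (g := fun i => i.*2.+1).
Definition even_frame : 'I_(rk_even C) -> 'I_n := degree_frame (g := fun i => i.*2).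

Lemma odd_frameP : frame (fun x => oddz (mdeg M x)) odd_frame.
Proof.
apply: degree_frameP => [i j|x]; first by rewrite ltz_nat ltnS ltn_double.
have /andP[d0 dn] := deg_range x; apply/idP/existsP => [od|[i /eqP ->]].
  have lt_i : (`|mdeg M x|./2 < (cdim C).+1)%N by lia.
  exists (Ordinal lt_i); apply/eqP => /=; move: od; rewrite /oddz; lia.
by rewrite /oddz /= odd_double.
Qed.

Lemma even_frameP : frame (fun x => ~~ oddz (mdeg M x)) even_frame.
Proof.
apply: degree_frameP => [i j|x]; first by rewrite ltz_nat ltn_double.
have /andP[d0 dn] := deg_range x; apply/idP/existsP => [od|[i /eqP ->]].
  have lt_i : (`|mdeg M x|./2 < (cdim C).+1)%N by lia.
  exists (Ordinal lt_i); apply/eqP => /=; move: od; rewrite /oddz; lia.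
by rewrite /oddz /= odd_double.
Qed.

Lemma odd_to_evenE (G : gmap C C) :
  odd_to_even G = mxsub even_frame odd_frame (flat M M (@cd _ C) + flat M M G).
Proof.
apply/matrixP => i j; rewrite !mxE.
by rewrite /even_frame /odd_frame /degree_frame !mencK.
Qed.

Lemma odd_frame_lt y z : mlt (odd_frame y) (odd_frame z) = (y < z)%N.
Proof. by apply: degree_frame_lt => i j; rewrite ltz_nat ltnS ltn_double. Qed.

Lemma even_frame_lt y z : mlt (even_frame y) (even_frame z) = (y < z)%N.
Proof. by apply: degree_frame_lt => i j; rewrite ltz_nat ltn_double. Qed.

(** This frees the torsion from the order of the bases, and from the choice of a
    contraction, at the price of a sign. *)
Lemma tau_newE k (e o : 'I_k -> 'I_n) (G : 'M[R]_n) :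
  frame (fun x => ~~ oddz (mdeg M x)) e -> frame (fun x => oddz (mdeg M x)) o ->
  contraction (mdeg M) (flat M M (@cd _ C)) G ->
  tau_new C = torsion (mxsub e o (flat M M (@cd _ C) + G)) +
    torsionN1 *+ (\sum_x \sum_y (mlt (o x) (o y) && mlt (e y) (e x)))%N + ceta C.
Proof.
move=> eP oP cG.
have E (G' : gmap C C) : is_contraction G' -> torsion (odd_to_even G') =
    torsion (mxsub e o (flat M M (@cd _ C) + G)) +
    torsionN1 *+ (\sum_x \sum_y (mlt (o x) (o y) && mlt (e y) (e x)))%N.
  move=> /(flat_contraction cG) cG'; rewrite odd_to_evenE.
  rewrite (torsion_mxsub_sorted even_frameP eP odd_frameP oP even_frame_lt odd_frame_lt).
    by rewrite (torsion_fold_indep eP oP cG' cG).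
  exact: (fold_invertible eP oP cG').1.
apply: xget_unique => [|_ [G' cG' ->]]; last by rewrite E.
by exists (unflat M M G); rewrite ?E //; apply: unflat_contraction.
Qed.

End ModelOrder.

(** Signs are counted modulo 2, as parities of relations. *)
Definition parity n (F : rel 'I_n) : bool := odd (\sum_x \sum_y F x y)%N.

Lemma parityE n (F : rel 'I_n) :
  parity F = \big[addb/false]_x \big[addb/false]_y F x y.
Proof.
rewrite /parity (big_morph odd oddD (erefl : odd 0 = false)).
apply: eq_bigr => x _; rewrite (big_morph odd oddD (erefl : odd 0 = false)).
by apply: eq_bigr => y _; rewrite oddb.
Qed.

Lemma eq_parity n (F G : rel 'I_n) : F =2 G -> parity F = parity G.
Proof. by move=> FG; congr odd; apply: eq_bigr => x _; apply: eq_bigr => y _; rewrite FG. Qed.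

Lemma parity_addb n (F G : rel 'I_n) :
  parity (fun x y => F x y (+) G x y) = parity F (+) parity G.
Proof. by rewrite !parityE -big_split; apply: eq_bigr => x _; rewrite -big_split. Qed.

Lemma parity_swap n (F : rel 'I_n) : parity (fun x y => F y x) = parity F.
Proof. by rewrite /parity exchange_big. Qed.

Lemma parity_involution n (s : 'I_n -> 'I_n) (F : rel 'I_n) : involutive s ->
  parity (fun x y => F (s x) (s y)) = parity F.
Proof.
move=> sK; rewrite /parity [in RHS](reindex_inj (inv_inj sK)); congr odd.
by apply: eq_bigr => x _; rewrite [RHS](reindex_inj (inv_inj sK)).
Qed.

Section ConeOrder.
Variable R : invRingType.
Variables (C D : signed_complex R) (n : nat) (M : model C n) (M' : model D n) (f : gmap C D).
Variable N : model (mapping_cone f) (n + n).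
Hypothesis NE : cone_numbering M M' N.

Let shiftW (Q : 'I_n -> Prop) : (forall r a, Q (@menc _ _ _ M (r - 1) a)) -> forall x, Q x.
Proof.
move=> H x; elim/(@modelW _ _ _ M): x => r a.
have [t rt] : exists t, r = t - 1 by exists (r + 1); rewrite addrK.
by subst r; apply: H.
Qed.

Lemma cone_lt_ll x y : mlt N (lshift n x) (lshift n y) = mlt M' x y.
Proof.
elim/(@modelW _ _ _ M'): x => r a; elim/(@modelW _ _ _ M'): y => s b.
by rewrite -!(cone_menc_l NE) !mlt_enc.
Qed.

Lemma cone_lt_rr x y : mlt N (rshift n x) (rshift n y) = mlt M x y.
Proof.
elim/shiftW: x => r a; elim/shiftW: y => s b.
rewrite -!(cone_menc_r NE) !mlt_enc ltrD2r (inj_eq (addIr _)); case: eqVneq => // rs.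
by subst s; rewrite ltn_add2l.
Qed.

Lemma cone_lt_lr x y : mlt N (lshift n x) (rshift n y) = (mdeg M' x <= mdeg M y + 1).
Proof.
elim/(@modelW _ _ _ M'): x => r a; elim/shiftW: y => s b.
rewrite -(cone_menc_l NE) -(cone_menc_r NE) mlt_enc !mdeg_enc subrK.
rewrite le_eqVlt orbC; case: eqVneq => //= rs.
by subst s; rewrite ltn_addr.
Qed.

Lemma cone_lt_rl x y : mlt N (rshift n x) (lshift n y) = (mdeg M x + 1 < mdeg M' y).
Proof.
elim/shiftW: x => r a; elim/(@modelW _ _ _ M'): y => s b.
rewrite -(cone_menc_l NE) -(cone_menc_r NE) mlt_enc !mdeg_enc subrK.
case: eqVneq => //= rs; rewrite ?orbF //.
by subst s; rewrite ltnNge (leq_trans (ltnW (ltn_ord b)) (leq_addr _ _)) orbF.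
Qed.

Let od x := oddz (mdeg M' x).
Let A x y := mlt M' x y && mlt M y x.
Let P x y := mdeg M y + 1 < mdeg M' x.

(** Pairs of equal parity compare the orders of the two complexes. For [x] odd and [y]
    even the pair [(x, y)] is inverted when neither [P x y] nor [P y x] holds, and
    [(y, x)] when both do. *)
Lemma cone_inversions :
  parity (fun x y => mlt N (cone_odd (mdeg M') x) (cone_odd (mdeg M') y) &&
                     mlt N (cone_even (mdeg M') y) (cone_even (mdeg M') x)) =
  parity (fun x y => (od x == od y) && A x y) (+)
  parity (fun x y => [&& od x, ~~ od y & ~~ (P x y (+) P y x)]).
Proof.
transitivity (parity (fun x y => [&& od x, od y & A x y] (+)
    ([&& ~~ od x, ~~ od y & A y x] (+)
    ([&& od x, ~~ od y & ~~ P x y && ~~ P y x] (+) [&& ~~ od x, od y & P x y && P y x])))).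
  apply: eq_parity => x y; rewrite /cone_odd /cone_even -/(od x) -/(od y) /A /P.
  case: (od x); case: (od y); rewrite /= ?cone_lt_ll ?cone_lt_rr ?cone_lt_lr ?cone_lt_rl //.
  - by rewrite addbF.
  - by rewrite !addbF !leNgt.
  - by rewrite andbC.
  - by rewrite !addbF andbC.
rewrite !parity_addb -(parity_swap (fun x y => [&& ~~ od x, ~~ od y & A y x])).
rewrite -(parity_swap (fun x y => [&& ~~ od x, od y & P x y && P y x])).
have -> : parity (fun x y => (od x == od y) && A x y) =
    parity (fun x y => [&& od x, od y & A x y]) (+) parity (fun x y => [&& ~~ od y, ~~ od x & A x y]).
  by rewrite -parity_addb; apply: eq_parity => x y; case: (od x); case: (od y); rewrite //= addbF.
rewrite -addbA -parity_addb; do 2!congr (_ (+) _); apply: eq_parity => x y.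
by case: (od x); case: (od y); case: (P x y); case: (P y x).
Qed.

End ConeOrder.

Definition tournament n (K : rel 'I_n) := forall x y, K y x = (x != y) && ~~ K x y.

(** Both sides count the pairs on which [K] and [L] disagree. *)
Lemma parity_tournament n (E K L : rel 'I_n) : symmetric E -> tournament K -> tournament L ->
  parity (fun x y => [&& E x y, K x y & L y x]) =
  parity (fun x y => [&& (x < y)%N, E x y & K x y (+) L x y]).
Proof.
move=> Es Kt Lt.
transitivity (parity (fun x y => [&& (x < y)%N, E x y, K x y & L y x] (+)
    [&& (y < x)%N, E x y, K x y & L y x])).
  apply: eq_parity => x y; case: (ltngtP x y) => [||/val_inj ->]; rewrite ?addbF //.
  by rewrite Lt eqxx /= !andbF.
rewrite parity_addb -(parity_swap (fun x y => [&& (y < x)%N, E x y, K x y & L y x])) -parity_addb.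
apply: eq_parity => x y; rewrite (Es y x) (Kt x y) (Lt x y).
case: (ltngtP x y) => //= lt_xy; rewrite -(inj_eq val_inj) /= (ltn_eqF lt_xy) /=.
by case: (E x y); case: (K x y); case: (L x y).
Qed.

Lemma parity_triangle n (E K L H : rel 'I_n) :
  symmetric E -> tournament K -> tournament L -> tournament H ->
  parity (fun x y => [&& E x y, K x y & H y x]) =
  parity (fun x y => [&& E x y, K x y & L y x]) (+)
  parity (fun x y => [&& E x y, L x y & H y x]).
Proof.
move=> Es Kt Lt Ht; rewrite (parity_tournament Es Kt Ht) (parity_tournament Es Kt Lt) (parity_tournament Es Lt Ht) -parity_addb; apply: eq_parity => x y.
by case: (x < y)%N; case: (E x y); case: (K x y); case: (L x y); case: (H x y).
Qed.

Section ModelTournament.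
Variables (R : invRingType) (C : signed_complex R) (n : nat) (M : model C n).

Lemma model_key_inj x y : mdeg M x = mdeg M y -> mpos M x = mpos M y -> x = y.
Proof.
elim/(@modelW _ _ _ M): x => r a; elim/(@modelW _ _ _ M): y => s b.
by rewrite !mdeg_enc !mpos_enc => rs; subst s => /val_inj ->.
Qed.

Lemma mlt_tournament : tournament (mlt M).
Proof.
move=> x y; rewrite /mlt; case: (ltgtP (mdeg M x) (mdeg M y)) => //= e.
- by rewrite andbF.
- by case: eqVneq e => // ->; rewrite ltxx.
case: (ltngtP (mpos M x) (mpos M y)) => //= e'.
- by rewrite andbF.
- by case: eqVneq e' => // ->; rewrite ltnn.
- by rewrite (model_key_inj e e') eqxx.
Qed.

End ModelTournament.

Section DualOrder.
Variables (R : invRingType) (C : signed_complex R) (n : nat) (M : model C n).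
Variables (s : 'I_n -> 'I_n) (M' : model (dual_complex C) n).
Hypotheses (sK : involutive s) (M'E : dual_numbering M s M').

Let back x y := (mdeg M y < mdeg M x) || (mdeg M x == mdeg M y) && (mpos M x < mpos M y)%N.

Lemma dual_mlt x y : mlt M' x y = back (s x) (s y).
Proof.
elim/(@modelW _ _ _ M'): x => r a; elim/(@modelW _ _ _ M'): y => t b.
rewrite mlt_enc /back !M'E !sK !mdeg_enc !mpos_enc; congr (_ || _ && _); lia.
Qed.

Let od x := oddz (mdeg M x).

(** The order of the dual is that of [C], transported by [s], with the degrees
    reversed. The transport by [s] adds an even number of inversions: [s] is the identity,
    or it exchanges those among odd elements with those among even elements. *)
Lemma dual_inversions (c : bool) : (forall x, od (s x) = od x (+) c) -> (~~ c -> s =1 id) ->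
  parity (fun x y => [&& od x == od y, mlt M x y & mlt M' y x]) =
  parity (fun x y => (od x == od y) && (mdeg M x < mdeg M y)).
Proof.
move=> os s1; have s_inj := inv_inj sK.
have Es : symmetric (fun x y => od x == od y) by move=> x y; rewrite eq_sym.
have t1 : tournament (fun x y => mlt M (s x) (s y)).
  by move=> x y; rewrite mlt_tournament (inj_eq s_inj).
have t2 : tournament (mlt M') by exact: (mlt_tournament M').
rewrite (parity_triangle (L := fun x y => mlt M (s x) (s y)) Es (mlt_tournament M) t1 t2).
have -> : parity (fun x y => [&& od x == od y, mlt M x y & mlt M (s y) (s x)]) = false.
  case: c os s1 => os s1; last first.
    rewrite -[RHS](_ : parity (fun _ _ : 'I_n => false) = false); last first.
      by rewrite /parity big1 // => x _; rewrite big1.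
    apply: eq_parity => x y; rewrite !s1 // mlt_tournament.
    by case: (mlt M y x); rewrite /= ?andbF.
  transitivity (parity (fun x y => [&& od x, od y, mlt M x y & mlt M (s y) (s x)] (+)
     [&& ~~ od x, ~~ od y, mlt M x y & mlt M (s y) (s x)])).
    by apply: eq_parity => x y; case: (od x); case: (od y); rewrite //= addbF.
  rewrite parity_addb -(parity_involution _ sK) -parity_swap.
  rewrite -[RHS](addbb (parity (fun x y => [&& ~~ od x, ~~ od y, mlt M x y & mlt M (s y) (s x)]))).
  congr (_ (+) _); apply: eq_parity => x y; rewrite !sK !os.
  by case: (od x); case: (od y); rewrite //= andbC.
rewrite -[RHS](parity_involution _ sK); apply: eq_parity => x y.
rewrite dual_mlt !os /mlt /back (inj_eq (can_inj (addbK c))).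
congr (_ && _); case: (ltgtP (mdeg M (s x)) (mdeg M (s y))) => //= _.
by case: ltngtP.
Qed.

End DualOrder.

(** * The sign conventions of cones and duals *)

Section TorsionN1.
Variable R : invRingType.
Local Notation t := (@torsionN1 R).

Lemma torsionN1_eq k l : odd k = odd l -> t *+ k = t *+ l.
Proof. by move=> kl; rewrite /torsionN1 torsionN1_odd kl -torsionN1_odd. Qed.

Lemma torsionN1_muln_opp k : - (t *+ k) = t *+ k.
Proof.
by apply/eqP; rewrite eq_sym -addr_eq0 -mulrnDr addnn -muln2 mulnC mulrnA
  [t *+ 2]torsionN1_double mul0rn.
Qed.

Lemma torsionN1_sign k i : (t *+ k) *~ (-1) ^+ i = t *+ k.
Proof. by rewrite -signr_odd; case: (odd i); rewrite //= expr1 mulrNz torsionN1_muln_opp. Qed.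

Lemma torsionN1_mulz (z : int) : t *~ z = t *+ oddz z.
Proof.
case: z => k; first by rewrite -[RHS](@torsionN1_eq k) ?oddb.
by rewrite NegzE mulrNz oddzN torsionN1_muln_opp -[RHS](@torsionN1_eq k.+1) ?oddb.
Qed.

Lemma eps_nat (a b : nat) : eps R a b = t *+ (a * b).
Proof. by rewrite /eps -PoszM. Qed.

Lemma K1_star_torsionN1 k : K1_star (t *+ k) = t *+ k.
Proof.
have iN1 := mx_inverse_invertible (mx_inverseN1 R).
have i1 := mx_invertible1 R 1.
rewrite /torsionN1 torsionN1_odd; case: (odd k); rewrite ?mulr1n ?mulr0n.
  rewrite K1_star_torsion //; congr torsion; apply/matrixP => i j.
  by rewrite !mxE eq_sym; case: (_ == _); rewrite ?mulr1n ?mulr0n ?involN ?invol1 ?invol0.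
by rewrite -(torsion1 R 1) K1_star_torsion // adjmx1.
Qed.

End TorsionN1.

Lemma sum_eq_ord (a m : nat) : (\sum_(j < m) (a == j :> nat) = (a < m))%N.
Proof.
case: ltnP => am.
  by rewrite (bigD1 (Ordinal am)) //= eqxx big1 // => j; rewrite -val_eqE eq_sym => /negbTE /= ->.
by rewrite big1 // => j _; rewrite gtn_eqF // (leq_trans (ltn_ord j)).
Qed.

(** The degrees of which the ranks enter the sign of the dual of a complex of
    dimension [d]. *)
Definition sign_degree (d : nat) (x : int) : bool :=
  (`|x| == d + 2 %[mod 4])%N || (`|x| == d + 3 %[mod 4])%N.

Section Counts.
Variables (R : invRingType) (C D : signed_complex R) (n : nat).
Variables (dC dD : 'I_n -> int).
Hypotheses (crkC : forall r, crk C r = (\sum_x (dC x == r))%N).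
Hypotheses (crkD : forall r, crk D r = (\sum_x (dD x == r))%N).
Hypotheses (range : forall x, 0 <= dC x <= (cdim C)%:Z) (dD0 : forall x, 0 <= dD x).

Lemma betaE : beta C D =
  torsionN1 *+ (\sum_x \sum_y ((oddz (dC x) == oddz (dD y)) && (dD y < dC x)%R))%N.
Proof.
transitivity (@torsionN1 R *+ (\sum_(i < (cdim C).+1) \sum_(j < i)
    (crk C i.*2 * crk D j.*2 + crk C i.*2.+1 * crk D j.*2.+1)%N)%N).
  rewrite -sumrMnr; apply: eq_bigr => i _; rewrite -sumrMnr; apply: eq_bigr => j _.
  by rewrite !eps_nat torsionN1_muln_opp -mulrnDr.
congr (_ *+ _).
transitivity (\sum_(i < (cdim C).+1) \sum_x \sum_y \sum_(j < i)
   ((dC x == i.*2) * (dD y == j.*2) + (dC x == i.*2.+1) * (dD y == j.*2.+1)))%N.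
  apply: eq_bigr => i _; under [RHS]eq_bigr do rewrite exchange_big.
  rewrite [RHS]exchange_big; apply: eq_bigr => j _.
  rewrite !crkC !crkD !big_distrlr -big_split; apply: eq_bigr => x _.
  by rewrite -big_split.
rewrite exchange_big; apply: eq_bigr => x _; rewrite exchange_big; apply: eq_bigr => y _.
have := range x; have := dD0 y; case: (dD y) => // l _; case: (dC x) => // k /andP[_]; rewrite lez_nat => kn.
transitivity (\sum_(i < (cdim C).+1) (k./2 == i :> nat) * (\sum_(j < i) (l./2 == j :> nat)) * (odd k == odd l))%N.
  apply: eq_bigr => i _; rewrite big_distrr big_distrl; apply: eq_bigr => j _ /=.
  rewrite !eqz_nat.
  have H (m e : nat) : ((m == e.*2) = ~~ odd m && (m./2 == e)) /\ ((m == e.*2.+1) = odd m && (m./2 == e)).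
    lia.
  rewrite !(H k i).1 !(H k i).2 !(H l j).1 !(H l j).2.
  by case: (odd k); case: (odd l); case: (k./2 == i); case: (l./2 == j).
have lt_k : (k./2 < (cdim C).+1)%N by lia.
rewrite (bigD1 (Ordinal lt_k)) //= eqxx mul1n sum_eq_ord big1 ?addn0; last first.
  by move=> j; rewrite -val_eqE eq_sym => /negbTE /= ->.
rewrite /oddz /= ltz_nat; case: eqVneq => e; rewrite ?muln0 ?muln1 //=.
congr nat_of_bool; lia.
Qed.

Lemma chiE : chi C = (\sum_x ~~ oddz (dC x))%N%:Z - (\sum_x oddz (dC x))%N%:Z.
Proof.
rewrite !(big_morph Posz PoszD (erefl : 0%N%:Z = 0)) -sumrB.
transitivity (\sum_(r < (cdim C).+1) \sum_x (-1) ^+ r * (dC x == r)%:Z : int).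
  by apply: eq_bigr => r _; rewrite crkC -mulr_sumr (big_morph Posz PoszD (erefl : 0%N%:Z = 0)).
rewrite exchange_big; apply: eq_bigr => x _.
have := range x; case: (dC x) => k //= kn.
have lt_k : (k < (cdim C).+1)%N by rewrite ltnS -lez_nat.
rewrite (bigD1 (Ordinal lt_k)) //= eqxx mulr1 big1 ?addr0; last first.
  by move=> j; rewrite -val_eqE eq_sym eqz_nat => /negbTE /= ->; rewrite mulr0.
by rewrite -signr_odd /oddz /=; case: (odd k).
Qed.

Lemma rk_oddE : rk_odd C = (\sum_x oddz (dC x))%N.
Proof.
rewrite /rk_odd; rewrite (eq_bigr _ (fun i _ => crkC _)).
rewrite exchange_big; apply: eq_bigr => x _.
have := range x; case: (dC x) => k //= kn; rewrite /oddz /=.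
transitivity (\sum_(i < (cdim C).+1) (k./2 == i :> nat) * odd k)%N.
  by apply: eq_bigr => i _; rewrite eqz_nat; case: (odd k) (odd_double_half k) => /=; lia.
by rewrite -big_distrl sum_eq_ord /=; lia.
Qed.

(** The summand [(crk C r)^2] may be replaced by [crk C r], as [-1] has order 2. *)
Lemma sum_eps_diag (P : pred nat) :
  \sum_(r < (cdim C).+1 | P r) eps R (crk C r) (crk C r) =
  torsionN1 *+ (\sum_x P `|dC x|%N)%N.
Proof.
transitivity (@torsionN1 R *+ (\sum_(r < (cdim C).+1 | P r) crk C r)%N).
  rewrite -sumrMnr; apply: eq_bigr => r _; rewrite eps_nat; apply: torsionN1_eq.
  by rewrite oddM andbb.
congr (_ *+ _); rewrite (eq_bigr _ (fun i _ => crkC _)).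
rewrite exchange_big; apply: eq_bigr => x _.
have := range x; case: (dC x) => k //= kn.
have lt_k : (k < (cdim C).+1)%N by rewrite ltnS -lez_nat.
rewrite big_mkcond (bigD1 (Ordinal lt_k)) //= eqxx big1 ?addn0; last first.
  by move=> j; rewrite -val_eqE eq_sym eqz_nat => /negbTE /= ->; case: ifP.
by case: ifP.
Qed.

End Counts.

Section Duality.
Variables (R : invRingType) (C : signed_complex R) (n : nat) (M : model C n).
Variables (s : 'I_n -> 'I_n).

Definition dual_based (d : int) (B : based_complex R n) : based_complex R n :=
  BasedComplex (fun x => d - bdeg B (s x))
    (mxsub s s (adjmx (bd B) *m sgnmx (fun x => d - bdeg B x))).

Hypothesis range : forall x, 0 <= mdeg M x <= (cdim C)%:Z.
Hypothesis sK : involutive s.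
Hypothesis s_odd : forall x, oddz (mdeg M (s x)) = oddz (mdeg M x) (+) odd (cdim C).
Hypothesis s1 : ~~ odd (cdim C) -> s =1 id.

Lemma dual_basedE (M' : model (dual_complex C) n) :
  dual_numbering M s M' -> based M' = dual_based (cdim C) (based M).
Proof.
move=> M'E; rewrite /based (flat_dual sK M'E) /dual_based /=; congr BasedComplex.
by apply: funext => x; rewrite (mdeg_dual sK M'E).
Qed.

Let od x := oddz (mdeg M x).
Let crkC := crk_mdeg M.

Lemma ceta_dual b : ceta C = torsionN1 *+ b -> ceta (dual_complex C) = torsionN1 *+ (b +
  \sum_x \sum_y ((od x == od y) && (mdeg M y < mdeg M x)%R) +
  \sum_x sign_degree (cdim C) (mdeg M x))%N.
Proof.
move=> etaC; have M0 x : 0 <= mdeg M x by have /andP[] := range x.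
rewrite [LHS]/= etaC (betaE crkC crkC range M0) !K1_star_torsionN1 !torsionN1_sign.
rewrite (sum_eps_diag crkC range (fun r => (r == cdim C + 2 %[mod 4]) || (r == cdim C + 3 %[mod 4]))).
by rewrite !mulrnDr.
Qed.

(** With [N_o] odd basis elements and [A] those of degree congruent to [n + 2] or
    [n + 3], the sign conventions contribute [N_o + A]: the other terms, which
    depend on the order of the basis, cancel against the signs [beta]. *)
Lemma absolute_torsionE (phi0 : gmap C C) u : ceta C = 0 \/ ceta C = torsionN1 ->
  has_torsion (based M) (dual_based (cdim C) (based M)) (colsub s (flat M M phi0)) u ->
  absolute_torsion phi0 = u + torsionN1 *+ (\sum_x oddz (mdeg M x) +
    \sum_x sign_degree (cdim C) (mdeg M x))%N.
Proof.
move=> etaC; have [M' M'E] := dual_model_exists M sK.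
have degM' := mdeg_dual sK M'E.
rewrite -(dual_basedE M'E) -(flat_duality phi0 sK M'E) => -[par [G cG ->]].
have [N NE] := cone_model_exists M' M (duality_map phi0).
have degN : mdeg N = cone_deg (based M) (based M') by apply/funext/(mdeg_cone NE).
have cdN := flat_cone NE.
have rangeN x : 0 <= mdeg N x <= (cdim (mapping_cone (duality_map phi0)))%:Z.
  rewrite degN /= (maxn_idPr (leqnSn _)); elim/splitW: x => x; rewrite /cone_deg ?degs_l ?degs_r /=.
    by have := range x; lia.
  by rewrite degM'; have := range (s x); lia.
rewrite -cdN -degN in cG.
rewrite /absolute_torsion /tau_new_map.
rewrite (tau_newE rangeN (e := cone_even (mdeg M)) (o := cone_odd (mdeg M)) _ _ cG); first last.
- by rewrite degN; exact: cone_oddP.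
- by rewrite degN; exact: cone_evenP.
rewrite cdN -!addrA; congr (_ + _).
rewrite torsionN1_odd -/(parity _) (cone_inversions NE).
have E1 := dual_inversions sK M'E s_odd s1.
have crkSB (r : int) : crk (suspension (dual_complex C)) r = (\sum_x ((mdeg M' x + 1)%R == r))%N.
  rewrite -[LHS]/(crk (dual_complex C) (r - 1)) (crk_mdeg M'); apply: eq_bigr => x _.
  by rewrite eq_sym subr_eq eq_sym.
have rangeSB x : 0 <= mdeg M' x + 1 <= (cdim (suspension (dual_complex C)))%:Z.
  by rewrite degM' /=; have := range (s x); lia.
have SB0 x : 0 <= mdeg M' x + 1 by have /andP[] := rangeSB x.
have [b etab] : exists b, ceta C = torsionN1 *+ b by case: etaC => ->; [exists 0%N|exists 1%N].
have -> : ceta (mapping_cone (duality_map phi0)) = ceta C + (- ceta (dual_complex C))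
    - beta C (suspension (dual_complex C)) + eps R (rk_odd C) (chi (suspension (dual_complex C))).
  by [].
rewrite etab (ceta_dual etab) (betaE crkC crkSB range SB0) (rk_oddE crkC range).
rewrite (chiE crkSB rangeSB) E1 /eps torsionN1_mulz !torsionN1_muln_opp -!mulrnDr.
have odM' x : oddz (mdeg M' x + 1) = ~~ od x by rewrite oddzD -par /= addbT.
apply: torsionN1_eq; rewrite !oddD -!/(parity _) !oddb oddzM oddzD oddzN.
have cnt (k : nat) : oddz k%:Z = odd k by [].
rewrite !cnt.
have -> : parity (fun x y => (od x == od y) && (mdeg M y < mdeg M x)%R) =
    parity (fun x y => (od x == od y) && (mdeg M x < mdeg M y)).
  by rewrite -parity_swap; apply: eq_parity => x y; rewrite eq_sym.
have -> : (\sum_x ~~ oddz (mdeg M' x + 1) = \sum_x od x)%N.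
  by apply: eq_bigr => x _; rewrite odM' negbK.
have -> : (\sum_x oddz (mdeg M' x + 1) = \sum_x ~~ od x)%N.
  by apply: eq_bigr => x _; rewrite odM'.
pose P x y := mdeg M' y + 1 < mdeg M x.
have -> : parity (fun x y => (oddz (mdeg M x) == oddz (mdeg M' y + 1)) && (mdeg M' y + 1 < mdeg M x)) =
   parity (fun x y => [&& od x, ~~ od y & P x y]) (+) parity (fun x y => [&& od x, ~~ od y & P y x]).
  rewrite -(parity_swap (fun x y => [&& od x, ~~ od y & P y x])) -parity_addb.
  apply: eq_parity => x y; rewrite odM' -/(od x) /P.
  by case: (od x); case: (od y); rewrite //= addbF.
have -> : parity (fun x y => [&& oddz (mdeg M x), ~~ oddz (mdeg M y)
     & ~~ ((mdeg M' y + 1 < mdeg M x) (+) (mdeg M' x + 1 < mdeg M y))]) =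
   odd (\sum_x od x) && odd (\sum_x ~~ od x)%N (+)
   (parity (fun x y => [&& od x, ~~ od y & P x y]) (+) parity (fun x y => [&& od x, ~~ od y & P y x])).
  rewrite -oddM big_distrlr /= -parity_addb -[odd _]/(odd _).
  transitivity (parity (fun x y => od x && ~~ od y) (+)
     parity (fun x y => [&& od x, ~~ od y & P x y] (+) [&& od x, ~~ od y & P y x])); last first.
    by congr (odd _ (+) _); apply: eq_bigr => x _; apply: eq_bigr => y _; rewrite mulnb.
  rewrite -parity_addb; apply: eq_parity => x y; rewrite -/(od x) -/(od y) -/(P x y) -/(P y x).
  by case: (od x); case: (od y); case: (P x y); case: (P y x).
rewrite -/od; move: (parity _) (parity _) (parity _) (odd _) (odd _) (odd _) (odd _).
by do 7!case.
Qed.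

End Duality.

(** * Symmetric Poincare complexes *)

Lemma frame_exists w (P : pred 'I_w) : exists f : 'I_#|P| -> 'I_w, frame P f.
Proof.
exists enum_val; split; first exact: enum_val_inj.
move=> z; apply/idP/codomP => [Pz|[i ->]]; last exact: enum_valP.
by exists (enum_rank_in Pz z); rewrite enum_rankK_in.
Qed.

(** Numbering the odd and the even elements in parallel gives an involution that
    exchanges them. *)
Lemma parity_involution_exists n (p : pred 'I_n) : #|p| = #|predC p| ->
  exists2 s : 'I_n -> 'I_n, involutive s & forall x, p (s x) = ~~ p x.
Proof.
move=> eq_card; have [o oP] := frame_exists p; have [e eP] := frame_exists (predC p).
move: e eP; rewrite -eq_card => e eP.
have ex x : exists i, x == (if p x then o i else e i).
  case px: (p x); first by have := px; rewrite (frameP oP) => /codomP[i ->]; exists i.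
  have : predC p x by rewrite /= px.
  by rewrite (frameP eP) => /codomP[i ->]; exists i.
pose idx x := xchoose (ex x); have idxE x : x = if p x then o (idx x) else e (idx x).
  exact: (eqP (xchooseP (ex x))).
have po i : p (o i) by exact: (frame_mem i oP).
have pe i : p (e i) = false by apply/negbTE; exact: (frame_mem i eP).
have idxo i : idx (o i) = i by apply: (frame_inj oP); rewrite [RHS]idxE po.
have idxe i : idx (e i) = i by apply: (frame_inj eP); rewrite [RHS]idxE pe.
exists (fun x => if p x then e (idx x) else o (idx x)) => x.
  by case px: (p x); rewrite ?pe ?po ?idxe ?idxo [RHS]idxE px.
by case px: (p x); rewrite ?pe ?po.
Qed.

Section Poincare.
Variables (R : invRingType) (C : signed_complex R) (n : nat) (M : model C n).
Hypothesis cC : is_signed_complex C.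

Lemma mdeg_range x : 0 <= mdeg M x <= (cdim C)%:Z.
Proof.
elim/(@modelW _ _ _ M): x => r a; rewrite mdeg_enc.
have : ~~ ((r < 0) || ((cdim C)%:Z < r)).
  by apply/negP => /(crk_out cC) r0; move: a; rewrite r0; case.
by rewrite negb_or -!leNgt.
Qed.

Lemma dual_is_signed_complex : is_signed_complex (dual_complex C).
Proof.
split.
- by move=> r out; apply: (crk_out cC); rewrite /= in out *; lia.
- move=> r s rs; rewrite /= (cd_degree cC); last by apply: contra rs => /eqP; lia.
  by apply/matrixP => i j; rewrite !mxE invol0 mulr0.
- move=> r; rewrite /= !sgn_oddz !scaler_sign.
  have := cd_cd cC ((cdim C)%:Z - (r + 2)).
  have -> : (cdim C)%:Z - (r + 2) + 1 = (cdim C)%:Z - (r + 1) by lia.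
  have -> : (cdim C)%:Z - (r + 2) + 2 = (cdim C)%:Z - r by lia.
  move/(congr1 (@adjmx R _ _)); rewrite adjmxM.
  have -> : adjmx 0 = 0 :> 'M[R]_(crk C ((cdim C)%:Z - r), crk C ((cdim C)%:Z - (r + 2))).
    by apply/matrixP => i j; rewrite !mxE invol0.
  by move=> dd; do 2 case: oddz; rewrite ?mulNmx ?mulmxN ?opprK dd ?oppr0.
have [b etab] : exists b, ceta C = torsionN1 *+ b.
  by case: (ceta_sign cC) => ->; [exists 0%N|exists 1%N].
rewrite (ceta_dual mdeg_range etab) /torsionN1 torsionN1_odd.
by case: odd; [right|left].
Qed.

Section Dual.
Variable phi : nat -> gmap C C.
Hypothesis equiv : is_chain_equivalence (duality_map (phi 0%N)).

Lemma dual_contractible (s : 'I_n -> 'I_n) : involutive s -> exists G,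
  contraction (cone_deg (based M) (dual_based s (cdim C) (based M)))
    (cone_d (based M) (dual_based s (cdim C) (based M)) (colsub s (flat M M (phi 0%N)))) G.
Proof.
move=> sK; have [M' M'E] := dual_model_exists M sK.
rewrite -(dual_basedE sK M'E) -(flat_duality _ sK M'E).
exact: flat_equivalence cC dual_is_signed_complex equiv.
Qed.

(** In odd dimension the cone has [2 N_o] odd and [2 N_e] even basis elements,
    and its fold is invertible. *)
Lemma odd_dim_card : rank_well_defined R -> odd (cdim C) ->
  #|[pred x | oddz (mdeg M x)]| = #|predC [pred x | oddz (mdeg M x)]|.
Proof.
move=> rkR od; have [G cG] := dual_contractible (s := id) (fun x => erefl).
have [o oP] := frame_exists [pred x | oddz (mdeg M x)].
have [e eP] := frame_exists (predC [pred x | oddz (mdeg M x)]).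
have degr y : oddz ((cdim C)%:Z - mdeg M y + 1) = oddz (mdeg M y).
  by rewrite !oddzD oddzN /= [oddz _]od addTb addbT negbK.
have o2P : frame (fun z => oddz (cone_deg (based M) (dual_based id (cdim C) (based M)) z)) (join_frame o o).
  apply: (join_frameP oP oP) => x; rewrite /cone_deg ?degs_l ?degs_r //=.
have e2P : frame (fun z => ~~ oddz (cone_deg (based M) (dual_based id (cdim C) (based M)) z)) (join_frame e e).
  by apply: (join_frameP eP eP) => x; rewrite /cone_deg ?degs_l ?degs_r //= degr.
have [F [FG GF]] := fold_rect_inverse e2P o2P cG.
by have := rkR _ _ _ _ FG GF; rewrite !addnn => /double_inj.
Qed.

Lemma dual_involution_exists : rank_well_defined R -> exists s : 'I_n -> 'I_n,
  [/\ involutive s, forall x, oddz (mdeg M (s x)) = oddz (mdeg M x) (+) odd (cdim C) &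
      ~~ odd (cdim C) -> s =1 id].
Proof.
move=> rkR; case od: (odd (cdim C)); last first.
  by exists id; split=> // x; rewrite addbF.
have [s sK sp] := parity_involution_exists (odd_dim_card rkR od).
by exists s; split=> // x; rewrite addbT; exact: sp.
Qed.

Lemma dual_has_torsion (s : 'I_n -> 'I_n) : involutive s ->
  (forall x, oddz (mdeg M (s x)) = oddz (mdeg M x) (+) odd (cdim C)) -> exists u,
  has_torsion (based M) (dual_based s (cdim C) (based M)) (colsub s (flat M M (phi 0%N))) u.
Proof.
move=> sK so; have [G cG] := dual_contractible sK; eexists; split; last by exists G.
by move=> x; rewrite /= oddzD oddzN so addbC -addbA addbb addbF.
Qed.

End Dual.

(** The homotopy is [phi_1] up to sign, by the relation [phi_cycle] for [s = 1]. *)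
Lemma transposition_homotopic (phi : nat -> gmap C C) : is_symmetric_structure phi ->
  exists2 H, homog (mdeg M) (fun x => (cdim C)%:Z - mdeg M x) 1 H &
    flat M M (phi 0%N) - flat M M (transposition (phi 0%N)) =
    bd (based M) *m H + H *m (adjmx (bd (based M)) *m sgnmx (fun x => (cdim C)%:Z - mdeg M x)).
Proof.
move=> [phi_deg cyc]; set m := cdim C in phi_deg cyc *.
pose k (p : int) : int := m%:Z + 1 - p.
have k1 p q : q != k p -> phi 1%N p q = 0.
  by move=> qk; apply: phi_deg; apply: contra qk => /eqP e; apply/eqP; rewrite /k; lia.
pose psi : gmap C C := fun p q => if odd m then phi 1%N p q else - phi 1%N p q.
have psi1 p q : q != k p -> psi p q = 0 by move=> /k1 e; rewrite /psi e oppr0 if_same.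
exists (flat M M psi).
  move=> y x; elim/(@modelW _ _ _ M): x => p a; elim/(@modelW _ _ _ M): y => q b.
  rewrite !mdeg_enc flatE => nz; have [|ne] := eqVneq q (k p); first by rewrite /k; lia.
  by move: nz; rewrite (psi1 _ _ ne) mxE eqxx.
pose delta : gmap C C := fun p q => sgn (m%:Z - p) *: adjmx (cd C q p).
have delta1 : has_degree 1 delta.
  move=> p q pq; rewrite /delta (cd_degree cC); last by apply: contra pq => /eqP; lia.
  by apply/matrixP => i j; rewrite !mxE invol0 mulr0.
have -> : adjmx (bd (based M)) *m sgnmx (fun x => m%:Z - mdeg M x) = flat M M delta.
  by apply/flatP => r s a b; rewrite mulmx_sgn mxE mxE flatE mdeg_enc !mxE sgn_oddz.
rewrite /= (flat_mul_at _ _ _ _ psi1) (flat_mul _ _ _ _ delta1) flatN !flatD.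
apply/flat_inj => p r; have [pr|npr] := eqVneq (p + r) m%:Z; last first.
  rewrite phi_deg ?addr0 // [transposition _ _ _]/transposition (phi_deg _ r p) 1?addrC ?addr0 //.
  rewrite (@cd_degree _ _ cC (k p)) ?mul0mx; last by apply: contra npr => /eqP; rewrite /k; lia.
  rewrite (psi1 (p + 1)) ?mul0mx; last by apply: contra npr => /eqP; rewrite /k; lia.
  by apply/matrixP => i j; rewrite !mxE invol0 mulr0 oppr0 !addr0.
have -> : k p = r + 1 by rewrite /k; lia.
have /(cyc 1%N) : p + r = m%:Z + 1%N%:Z - 1 by rewrite pr addrK.
rewrite /psi /delta /phi_pred (_ : m%:Z - p = r); last by rewrite -pr addrC addKr.
have o1 : oddz 1 = true by [].
rewrite !sgn_oddz !oddzD [oddz m]/oddz o1 /= !addbT negbK expr1 scaleN1r !scaler_sign.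
have lin (X Y P T : 'M[R]_(crk C r, crk C p)) : X + Y + (P - T) = 0 -> P - T = - X - Y.
  by move=> e; rewrite -[LHS]subr0 -e; zmodule.
have lin' (X Y P T : 'M[R]_(crk C r, crk C p)) : X + Y - (P - T) = 0 -> P - T = X + Y.
  by move=> e; rewrite -[LHS]addr0 -e; zmodule.
by case: (odd m); case: (oddz r) => e; rewrite ?mulmxN ?mulNmx; first [exact: lin|exact: lin'].
Qed.

Lemma has_torsion_transposition (phi : nat -> gmap C C) (s : 'I_n -> 'I_n) u :
  is_symmetric_structure phi -> involutive s ->
  has_torsion (based M) (dual_based s (cdim C) (based M)) (colsub s (flat M M (phi 0%N))) u ->
  has_torsion (based M) (dual_based s (cdim C) (based M))
    (colsub s (flat M M (transposition (phi 0%N)))) u.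
Proof.
move=> phiP sK; have [H Hh HE] := transposition_homotopic phiP.
apply: (has_torsion_homotopic (h := colsub s H)) => [i j|]; first by rewrite mxE; exact: Hh.
have -> : colsub s (flat M M (phi 0%N)) - colsub s (flat M M (transposition (phi 0%N))) =
    colsub s (flat M M (phi 0%N) - flat M M (transposition (phi 0%N))).
  by apply/matrixP => i j; rewrite !mxE.
rewrite HE; apply/matrixP => i j; rewrite mxE [LHS]mxE [RHS]mxE; congr (_ + _).
  by rewrite mxE [RHS]mxE; apply: eq_bigr => x _; congr (_ * _); rewrite [RHS]mxE.
rewrite mxE [RHS]mxE (reindex_inj (inv_inj sK)); apply: eq_bigr => x _ /=.
by congr (_ * _); rewrite [RHS]mxE.
Qed.

End Poincare.

(** * The product of two symmetric Poincare complexes *)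

Lemma torsion_signs (R : pzRingType) n (s : 'I_n -> bool) :
  torsion (signs_mx R s) = torsion ((-1)%:M : 'M[R]_1) *+ (\sum_x s x)%N.
Proof. by rewrite (torsion_diag_sign (s := s) (erefl _)).2 card_predE. Qed.

Lemma rowsub_involutionK (R : pzRingType) n (s : 'I_n -> 'I_n) : involutive s ->
  rowsub s 1%:M *m rowsub s 1%:M = 1%:M :> 'M[R]_n.
Proof. by move=> sK; rewrite -rowsubE; apply/matrixP => i j; rewrite !mxE sK. Qed.

Section Reindex.
Variables (R : invRingType) (n : nat) (B : based_complex R n) (d : int) (s : 'I_n -> 'I_n).
Hypotheses (sK : involutive s) (sp : forall x, oddz (bdeg B (s x)) = oddz (bdeg B x)).

Lemma has_torsion_reindex (X : 'M[R]_n) w :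
  has_torsion B (dual_based s d B) (colsub s X) w ->
  has_torsion B (dual_based id d B) (colsub id X) (w + torsion (rowsub s 1%:M : 'M[R]_n)).
Proof.
move=> tw; have J2 := rowsub_involutionK R sK.
have rowE (A : 'M[R]_n) : rowsub s 1%:M *m A = rowsub s A by rewrite -rowsubE.
have colE (A : 'M[R]_n) : A *m rowsub s 1%:M = colsub s A.
  apply/matrixP => i j; rewrite [LHS]mxE [RHS]mxE (bigD1 (s j)) //= mxE mxE sK eqxx mulr1.
  rewrite big1 ?addr0 // => k ks; rewrite mxE mxE; by case: eqVneq => [e|]; rewrite ?mulr0 //; move: ks; rewrite -e sK eqxx.
have := @has_torsion_involution _ _ B (dual_based s d B) (colsub s X) w (rowsub s 1%:M)
  (fun x => d - bdeg B x) J2.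
have -> : BasedComplex (fun x => d - bdeg B x) (rowsub s 1%:M *m bd (dual_based s d B) *m rowsub s 1%:M)
    = dual_based id d B.
  rewrite rowE colE /dual_based; congr BasedComplex; apply/matrixP => i j.
  by rewrite mxE mxE mxE [RHS]mxE !sK.
have -> : colsub s X *m rowsub s 1%:M = colsub id X.
  by rewrite colE; apply/matrixP => i j; rewrite !mxE sK.
apply=> //.
- by move=> i j; rewrite !mxE; case: (eqVneq (s i) j) => [<- _|]; rewrite ?eqxx //= addr0 ?sK.
- by move=> i j; rewrite !mxE; case: (eqVneq (s i) j) => [<- _|]; rewrite ?eqxx //= addr0 ?sK.
- by move=> x; rewrite /= !oddzD !oddzN sp.
Qed.

End Reindex.

Section TensorDual.
Variables (R S : invRingType).
Local Notation T := (tensor_ring R S).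
Variables (N M : nat) (C : based_complex R N) (D : based_complex S M) (n m : int).
Variables (sC : 'I_N -> 'I_N) (sD : 'I_M -> 'I_M).
Hypotheses (sCK : involutive sC) (sDK : involutive sD).
Hypotheses (cC : is_complex C) (cD : is_complex D).

Definition pair_map (k : 'I_(N * M)) : 'I_(N * M) :=
  of_pair (sC (pair_of k).1, sD (pair_of k).2).

Lemma pair_mapK : involutive pair_map.
Proof.
move=> k; rewrite /pair_map of_pairK; cbn [fst snd].
by rewrite sCK sDK -surjective_pairing pair_ofK.
Qed.

(** The sign of the isomorphism of [(C (x) D)^(n+m-* )] with
    [C^(n-* ) (x) D^(m-* )] is that of [(-1)^((n - x) y)] in bidegree [(x, y)]. *)
Definition dual_sign (k : 'I_(N * M)) : bool :=
  oddz (n - bdeg C (pair_of k).1) && oddz (bdeg D (pair_of k).2).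

Let BT := tensor_based C D.

Lemma adj_tmx k l k' l' (A : 'M[R]_(k, l)) (B : 'M[S]_(k', l')) :
  adjmx (tmx A B) = tmx (adjmx A) (adjmx B).
Proof. by apply/matrixP => i j; rewrite mxE mxE !tmx_rect !mxE invol_tens. Qed.

Lemma adj_sgnmx k (d : 'I_k -> int) : adjmx (sgnmx d : 'M[S]_k) = sgnmx d.
Proof.
apply/matrixP => i j; rewrite !mxE eq_sym; case: eqVneq => [->|]; last by rewrite !mulr0n invol0.
by rewrite !mulr1n; case: oddz; rewrite ?expr1 ?expr0 ?involN invol1.
Qed.

Lemma tensor_dual_d :
  signs_mx T dual_sign *m
    (tmx 1%:M (adjmx (bd D) *m sgnmx (fun y => m - bdeg D y)) +
     tmx (adjmx (bd C) *m sgnmx (fun x => n - bdeg C x)) (sgnmx (fun y => m - bdeg D y)))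
    *m signs_mx T dual_sign =
  adjmx (bd BT) *m sgnmx (fun k => n + m - bdeg BT k).
Proof.
apply/matrixP => i j; rewrite mulmx_signs signs_mulmx mulmx_sgn [X in _ * (_ * X)]mxE !tmx_rect.
rewrite adjmxD !adj_tmx adjmx1 adj_sgnmx [X in _ = _ * X]mxE !tmx_rect !mulmx_sgn.
rewrite /dual_sign /BT; cbn [bdeg tensor_based].
move: (pair_of i) (pair_of j) => [x y] [x' y']; cbn [fst snd].
have sl (b : bool) a c : tens ((-1) ^+ b * a) c = (-1) ^+ b * tens a c :> T.
  by rewrite !mulr_sign; case: b; rewrite ?tensNl.
have sr (b : bool) a c : tens a ((-1) ^+ b * c) = (-1) ^+ b * tens a c :> T.
  by rewrite !mulr_sign; case: b; rewrite ?tensNr.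
rewrite !mulrDr sr sl; congr (_ + _).
  rewrite !mulrA -!signr_addb [1%:M x x']mxE.
  case: (eqVneq x x') => [<-|_]; last by rewrite mulr0n !tens0l !mulr0.
  have [dy|dy] := eqVneq (bd D y' y) 0; first by rewrite !mxE dy invol0 !tens0r !mulr0.
  congr ((-1) ^+ nat_of_bool _ * _); have := bd_homog cD dy.
  move=> ->; rewrite !oddzD !oddzN !oddzD.
  by case: (oddz n); case: (oddz m); case: (oddz (bdeg C x)); case: (oddz (bdeg D y)).
rewrite !mulrA -!signr_addb ![sgnmx _ y y']mxE.
case: (eqVneq y y') => [<-|_]; last by rewrite !mulr0n !tens0r !mulr0.
have [dx|dx] := eqVneq (bd C x' x) 0; first by rewrite !mxE dx invol0 !tens0l !mulr0.
have sr1 (b : bool) a : tens a ((-1) ^+ b) = (-1) ^+ b * tens a 1 :> T by rewrite -sr mulr1.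
rewrite !mulr1n !sr1 !mulrA -!signr_addb.
congr ((-1) ^+ nat_of_bool _ * _); have := bd_homog cC dx.
move=> ->; rewrite !oddzD !oddzN !oddzD.
by case: (oddz n); case: (oddz m); case: (oddz (bdeg C x)); case: (oddz (bdeg D y)).
Qed.

Lemma tensor_based_dual :
  BasedComplex (fun k => n + m - bdeg BT (pair_map k)) (mxsub pair_map pair_map
    (tmx 1%:M (adjmx (bd D) *m sgnmx (fun y => m - bdeg D y)) +
     tmx (adjmx (bd C) *m sgnmx (fun x => n - bdeg C x)) (sgnmx (fun y => m - bdeg D y)))) =
  tensor_based (dual_based sC n C) (dual_based sD m D).
Proof.
rewrite /tensor_based /dual_based; congr BasedComplex.
  apply: funext => k; cbn [bdeg BT tensor_based]; rewrite /pair_map of_pairK; cbn [fst snd].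
  by rewrite opprD addrACA.
apply/matrixP => i j; rewrite mxE mxE [RHS]mxE !tmx_rect /pair_map !of_pairK; cbn [fst snd bdeg bd].
congr (tens _ _ + tens _ _).
- by rewrite !mxE (inj_eq (inv_inj sCK)).
- by rewrite [RHS]mxE.
- by rewrite [RHS]mxE.
- by rewrite !mxE (inj_eq (inv_inj sDK)).
Qed.

Hypotheses (sC_par : forall x, oddz (bdeg C (sC x)) = oddz (bdeg C x) (+) oddz n).
Hypotheses (sD_par : forall y, oddz (bdeg D (sD y)) = oddz (bdeg D y) (+) oddz m).

(** By [tensor_dual_d] the signs conjugate the product of the duals to the dual of the
    product. *)
Lemma has_torsion_tensor_dual X Y w :
  has_torsion BT (tensor_based (dual_based sC n C) (dual_based sD m D))
    (tmx (colsub sC X) (colsub sD Y)) w ->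
  has_torsion BT (dual_based pair_map (n + m) BT)
    (colsub pair_map (tmx X Y *m signs_mx T dual_sign))
    (w + torsion ((-1)%:M : 'M[T]_1) *+ (\sum_k dual_sign k)%N).
Proof.
move=> tw; rewrite -(_ : \sum_k dual_sign (pair_map k) = \sum_k dual_sign k)%N; last first.
  by rewrite [RHS](reindex_inj (inv_inj pair_mapK)).
rewrite -torsion_signs.
have -> : colsub pair_map (tmx X Y *m signs_mx T dual_sign) =
    tmx (colsub sC X) (colsub sD Y) *m signs_mx T (dual_sign \o pair_map).
  apply/matrixP => i j; rewrite [LHS]mxE !mulmx_signs !tmx_rect /pair_map of_pairK.
  by congr (_ * tens _ _); rewrite !mxE.
have colsub_signs (A : 'M[T]_(N * M)) : signs_mx T (dual_sign \o pair_map) *m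
    mxsub pair_map pair_map A *m signs_mx T (dual_sign \o pair_map) =
    mxsub pair_map pair_map (signs_mx T dual_sign *m A *m signs_mx T dual_sign).
  by apply/matrixP => i j; rewrite mulmx_signs signs_mulmx [RHS]mxE mulmx_signs signs_mulmx mxE.
have BE := tensor_based_dual.
have -> : dual_based pair_map (n + m) BT =
    BasedComplex (fun k => n + m - bdeg BT (pair_map k)) (signs_mx T (dual_sign \o pair_map) *m
      bd (tensor_based (dual_based sC n C) (dual_based sD m D)) *m signs_mx T (dual_sign \o pair_map)).
  by rewrite -BE /= colsub_signs tensor_dual_d.
have signs_homog (s : 'I_(N * M) -> bool) (e : 'I_(N * M) -> int) : homog e e 0 (signs_mx T s).
  by move=> i j; rewrite mxE; case: (eqVneq i j) => [->|]; rewrite ?mulr0n ?eqxx ?addr0.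
apply: has_torsion_involution => //.
- exact: signs_mxK.
- by rewrite -BE; exact: signs_homog.
- by rewrite -BE; exact: signs_homog.
- by move=> k; rewrite -BE.
Qed.

End TensorDual.

(** [f] is the product of its restrictions to [p] and to the complement of [p],
    which are conjugate under [g]. *)
Lemma odd_perm_commuting_involutions w (p : 'I_w -> bool) (f g : 'I_w -> 'I_w)
    (fK : involutive f) : involutive g ->
  (forall k, p (f k) = p k) -> (forall k, p (g k) = ~~ p k) -> (forall k, f (g k) = g (f k)) ->
  perm (inv_inj fK) = false :> bool.
Proof.
move=> gK pf pg fg; pose a k := if p k then f k else k.
have aK : involutive a by move=> k; rewrite /a; case pk: (p k); rewrite ?pf pk ?fK.
have -> : perm (inv_inj fK) = (perm (inv_inj aK) * (perm (inv_inj gK) * perm (inv_inj aK) * perm (inv_inj gK)))%g.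
  apply/permP => k; rewrite !permM !permE /a.
  by case pk: (p k); rewrite ?pf ?pg ?pk /= ?pf ?pg ?pk ?gK ?fg ?gK.
by rewrite !odd_permM; case: (odd_perm _); case: (odd_perm _).
Qed.

Lemma torsion_rowsub_involution (R : pzRingType) n (s : 'I_n -> 'I_n) (sK : involutive s) :
  torsion (rowsub s 1%:M : 'M[R]_n) = torsion ((-1)%:M : 'M[R]_1) *+ perm (inv_inj sK).
Proof.
rewrite -(torsion_perm_mx R (perm (inv_inj sK))).2; congr torsion.
by apply/matrixP => i j; rewrite !mxE permE.
Qed.

Section PairMap.
Variables (N M : nat) (sC : 'I_N -> 'I_N) (sD : 'I_M -> 'I_M) (p : 'I_N -> bool) (q : 'I_M -> bool).
Hypotheses (sCK : involutive sC) (sDK : involutive sD).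
Hypotheses (ps : forall x, p (sC x) = ~~ p x) (qs : forall y, q (sD y) = ~~ q y).

Lemma odd_perm_pair_map (pK : involutive (pair_map sC sD)) : perm (inv_inj pK) = false :> bool.
Proof.
have idK k : involutive (@id 'I_k) by [].
have lK := pair_mapK sCK (idK M); have rK := pair_mapK (idK N) sDK.
have comp k : pair_map sC id (pair_map id sD k) = pair_map sC sD k.
  by rewrite /pair_map !of_pairK.
have comm k : pair_map sC id (pair_map id sD k) = pair_map id sD (pair_map sC id k).
  by rewrite /pair_map !of_pairK.
have -> : perm (inv_inj pK) = (perm (inv_inj rK) * perm (inv_inj lK))%g.
  by apply/permP => k; rewrite permM !permE comp.
rewrite odd_permM (odd_perm_commuting_involutions (p := fun k => p (pair_of k).1) rK lK) //.
- rewrite (odd_perm_commuting_involutions (p := fun k => q (pair_of k).2) lK rK) //.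
  + by move=> k; rewrite /pair_map of_pairK.
  + by move=> k; rewrite /pair_map of_pairK; cbn [snd]; rewrite qs.
- by move=> k; rewrite /pair_map of_pairK.
- by move=> k; rewrite /pair_map of_pairK; cbn [fst]; rewrite ps.
Qed.
End PairMap.

Lemma sum_pair_of N M (F : 'I_N -> 'I_M -> nat) :
  (\sum_k F (pair_of k).1 (pair_of k).2 = \sum_x \sum_y F x y)%N.
Proof.
rewrite pair_big (reindex (@of_pair N M)); last first.
  by apply: onW_bij; exists (@pair_of N M); [exact: of_pairK|exact: pair_ofK].
by apply: eq_bigr => -[x y] _; rewrite of_pairK.
Qed.

Lemma odd_sum (I : finType) (F : I -> nat) : odd (\sum_i F i)%N = \big[addb/false]_i odd (F i).
Proof. exact: (big_morph odd oddD (erefl : odd 0 = false)). Qed.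

(** [sign_degree d x] is the parity of the binomial coefficient of [x - d] over 2, and
    [a + b] over 2 is the sum of [a] over 2, [b] over 2 and [a b]. *)
Lemma sign_degreeD (n m : nat) (x y : int) : 0 <= x -> 0 <= y ->
  sign_degree (n + m) (x + y) =
  sign_degree n x (+) sign_degree m y (+) (oddz (n%:Z - x) && oddz (m%:Z - y)).
Proof.
case: x => // x _; case: y => // y _.
rewrite /sign_degree !oddzD !oddzN /oddz -PoszD !absz_nat.
rewrite -(@odd_mod x 4) // -(@odd_mod y 4) // -(@odd_mod n 4) // -(@odd_mod m 4) // -(modnDml (n + m) 2) -(modnDml (n + m) 3) -(modnDm x y) -(modnDm n m).
rewrite -(modnDml n 2) -(modnDml n 3) -(modnDml m 2) -(modnDml m 3).
have := ltn_pmod x (isT : (0 < 4)%N); have := ltn_pmod y (isT : (0 < 4)%N).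
have := ltn_pmod n (isT : (0 < 4)%N); have := ltn_pmod m (isT : (0 < 4)%N).
move: (x %% 4)%N (y %% 4)%N (n %% 4)%N (m %% 4)%N => a b c e.
by case: e => [|[|[|[|e]]]] // _; case: c => [|[|[|[|c]]]] // _;
  case: b => [|[|[|[|b]]]] // _; case: a => [|[|[|[|a]]]].
Qed.

Lemma K1_map_torsionN1 (R S : invRingType) (f : {rmorphism R -> S}) k :
  K1_map f (torsionN1 *+ k) = torsionN1 *+ k.
Proof.
have iN1 := mx_inverse_invertible (mx_inverseN1 R).
elim: k => [|k IH]; first by rewrite !mulr0n K1_map0.
rewrite !mulrS K1_mapD IH; congr (_ + _).
by rewrite /torsionN1 K1_map_torsion // map_scalar_mx rmorphN1.
Qed.

(** For [m] odd, [s] exchanges the odd and the even basis elements. *)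
Lemma sum_odd_codegree K (d : 'I_K -> int) (s : 'I_K -> 'I_K) (m : int) : involutive s ->
  (forall y, oddz (d (s y)) = oddz (d y) (+) oddz m) ->
  (\sum_y oddz (m - d y) = \sum_y oddz (d y))%N.
Proof.
move=> sK ds; rewrite [RHS](reindex_inj (inv_inj sK)); apply: eq_bigr => y _.
by rewrite ds oddzD oddzN addbC.
Qed.

(** The cross terms of [sign_degreeD] cancel against the signs of [dual_sign]. *)
Lemma sign_count N K (n m : nat) (dC : 'I_N -> int) (dD : 'I_K -> int) (sD : 'I_K -> 'I_K) :
  (forall x, 0 <= dC x) -> (forall y, 0 <= dD y) -> involutive sD ->
  (forall y, oddz (dD (sD y)) = oddz (dD y) (+) odd m) ->
  odd (\sum_x \sum_y (oddz (n%:Z - dC x) && oddz (dD y))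
       + \sum_x \sum_y sign_degree (n + m) (dC x + dD y))%N =
  odd (K * \sum_x sign_degree n (dC x) + N * \sum_y sign_degree m (dD y))%N.
Proof.
move=> C0 D0 sDK sDp.
have E : odd (\sum_x \sum_y sign_degree (n + m) (dC x + dD y))%N =
   odd (\sum_x \sum_y (sign_degree n (dC x) + sign_degree m (dD y) +
     oddz (n%:Z - dC x) * oddz (m%:Z - dD y)))%N.
  rewrite !odd_sum; apply: eq_bigr => x _; rewrite !odd_sum; apply: eq_bigr => y _.
  by rewrite sign_degreeD // !oddD oddM !oddb.
rewrite oddD E -oddD.
have -> : (\sum_x \sum_y (sign_degree n (dC x) + sign_degree m (dD y) +
     oddz (n%:Z - dC x) * oddz (m%:Z - dD y)) =
   K * (\sum_x sign_degree n (dC x)) + N * (\sum_y sign_degree m (dD y)) +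
   (\sum_x oddz (n%:Z - dC x)) * (\sum_y oddz (dD y)))%N.
  rewrite -(sum_odd_codegree (m := m) sDK sDp) big_distrlr /=.
  rewrite big_distrr /= -[X in (_ + X * _)%N](card_ord N) -sum_nat_const -!big_split /=.
  apply: eq_bigr => x _; rewrite !big_split sum_nat_const card_ord.
  by rewrite /=.
have -> : (\sum_x \sum_y (oddz (n%:Z - dC x) && oddz (dD y)) =
   (\sum_x oddz (n%:Z - dC x)) * (\sum_y oddz (dD y)))%N.
  by rewrite big_distrlr; apply: eq_bigr => x _; apply: eq_bigr => y _; rewrite /= mulnb.
by rewrite addnC -addnA addnn oddD odd_double addbF.
Qed.

Lemma chi_model (R : invRingType) (C : signed_complex R) n (M : model C n) :
  is_signed_complex C -> chi C = (even_rank (based M))%:Z - (odd_rank (based M))%:Z.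
Proof.
move=> cC; rewrite (chiE (crk_mdeg M) (mdeg_range M cC)).
by rewrite /even_rank /odd_rank !card_predE.
Qed.

Lemma even_odd_rank (R : invRingType) n (C : based_complex R n) :
  (even_rank C + odd_rank C = n)%N.
Proof.
rewrite /even_rank /odd_rank !card_predE -big_split /= -[RHS]card_ord -sum1_card.
by apply: eq_bigr => x _; case: oddz.
Qed.

(** If the dimensions are both odd, then the involution on pairs preserves
    parities; being an even permutation, it may be replaced by the identity. *)
Lemma tensor_involution (R S : invRingType) N K (C : based_complex R N) (D : based_complex S K)
    (n m : nat) (sC : 'I_N -> 'I_N) (sD : 'I_K -> 'I_K) X w :
  let BT := tensor_based C D in
  involutive sC -> involutive sD ->
  (forall x, oddz (bdeg C (sC x)) = oddz (bdeg C x) (+) odd n) -> (~~ odd n -> sC =1 id) ->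
  (forall y, oddz (bdeg D (sD y)) = oddz (bdeg D y) (+) odd m) -> (~~ odd m -> sD =1 id) ->
  has_torsion BT (dual_based (pair_map sC sD) (n%:Z + m%:Z) BT) (colsub (pair_map sC sD) X) w ->
  exists s : 'I_(N * K) -> 'I_(N * K), [/\ involutive s,
    forall k, oddz (bdeg BT (s k)) = oddz (bdeg BT k) (+) odd (n + m),
    ~~ odd (n + m) -> s =1 id & has_torsion BT (dual_based s (n + m)%N BT) (colsub s X) w].
Proof.
move=> BT sCK sDK sCp sC1 sDp sD1 tw; have pK := pair_mapK sCK sDK.
have pp k : oddz (bdeg BT (pair_map sC sD k)) = oddz (bdeg BT k) (+) odd (n + m).
  rewrite /BT; cbn [bdeg tensor_based]; rewrite /pair_map of_pairK; cbn [fst snd].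
  by rewrite !oddzD sCp sDp oddD addbACA.
have [/andP[on om]|nm] := boolP (odd n && odd m); last first.
  exists (pair_map sC sD); split; [exact: pK|exact: pp| |exact: tw] => enm k.
  have [en em] : ~~ odd n /\ ~~ odd m by move: nm enm; rewrite oddD; case: odd; case: odd.
  by rewrite /pair_map sC1 // sD1 // -surjective_pairing pair_ofK.
have tid : has_torsion BT (dual_based id (n%:Z + m%:Z) BT) (colsub id X) w; last first.
  by exists id; split; [|move=> k; rewrite oddD on om addbF| |exact: tid].
have pp' k : oddz (bdeg BT (pair_map sC sD k)) = oddz (bdeg BT k) by rewrite pp oddD on om addbF.
have := has_torsion_reindex pK pp' tw.
rewrite (torsion_rowsub_involution _ pK).
have sCf x : oddz (bdeg C (sC x)) = ~~ oddz (bdeg C x) by rewrite sCp on addbT.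
have sDf y : oddz (bdeg D (sD y)) = ~~ oddz (bdeg D y) by rewrite sDp om addbT.
rewrite (odd_perm_pair_map sCK sDK (p := fun x => oddz (bdeg C x)) (q := fun y => oddz (bdeg D y)) sCf sDf).
by rewrite mulr0n addr0.
Qed.

Theorem proposition32 (R R' : invRingType)
  (rankR : rank_well_defined R) (rankR' : rank_well_defined R')
  (rankRR' : rank_well_defined (tensor_ring R R'))
  (evenR : forms_4k2_have_even_rank R) (evenR' : forms_4k2_have_even_rank R')
  (C : signed_complex R) (phi : nat -> gmap C C)
  (C_phi : is_symmetric_Poincare phi)
  (D : signed_complex R') (theta : nat -> gmap D D)
  (D_theta : is_symmetric_Poincare theta)
  (eta : K1 (tensor_ring R R')) (eta_sign : eta = 0 \/ eta = torsionN1) :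
  absolute_torsion (tensor_phi0 eta (phi 0%N) (theta 0%N)) =
    K1_map (@tensl R R') (absolute_torsion (phi 0%N)) *~ chi D
    + K1_map (@tensr R R') (absolute_torsion (theta 0%N)) *~ chi C.
Proof.
have [[cC _ eC] [cD symD eD]] := (C_phi, D_theta).
have [N [M _]] := model_exists (crk_out cC); have [N' [M' _]] := model_exists (crk_out cD).
have rC := mdeg_range M cC; have rD := mdeg_range M' cD.
have [sC [sCK sCp sC1]] := dual_involution_exists M cC eC rankR.
have [sD [sDK sDp sD1]] := dual_involution_exists M' cD eD rankR'.
have [u tu] := dual_has_torsion cC eC sCK sCp.
have [v tv] := dual_has_torsion cD eD sDK sDp.
rewrite (absolute_torsionE rC sCK sCp sC1 (ceta_sign cC) tu).
rewrite (absolute_torsionE rD sDK sDp sD1 (ceta_sign cD) tv).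
have tw := has_torsion_tensor_dual sCK sDK (based_is_complex M cC) (based_is_complex M' cD)
  (has_torsion_tensor tu (has_torsion_transposition cD symD sDK tv)).
have [L LE] := tensor_model_exists eta M M' (crk_out cC).
have BL : based L = tensor_based (based M) (based M').
  rewrite /based (flat_tensor_cd LE); congr BasedComplex; first exact/funext/(mdeg_tensor LE).
have [s [sK sp s1 ts]] :=
  tensor_involution (C := based M) (D := based M') sCK sDK sCp sC1 sDp sD1 tw.
have dL : mdeg L = bdeg (tensor_based (based M) (based M')) by rewrite -BL.
have rL k : 0 <= mdeg L k <= (cdim (tensor_complex C D eta))%:Z.
  rewrite dL; cbn [bdeg tensor_based]; have := rC (pair_of k).1; have := rD (pair_of k).2.
  rewrite /=; lia.
rewrite -dL in sp; rewrite -BL in ts.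
have := absolute_torsionE rL sK sp s1 (phi0 := tensor_phi0 eta (phi 0%N) (theta 0%N)) eta_sign.
rewrite (flat_tensor_phi0 LE).
move=> /(_ _ ts) ->.
set Ce := even_rank (based M); set Co := odd_rank (based M).
set De := even_rank (based M'); set Do := odd_rank (based M').
have CoE : (\sum_x oddz (mdeg M x) = Co)%N by rewrite /Co /odd_rank card_predE.
have DoE : (\sum_x oddz (mdeg M' x) = Do)%N by rewrite /Do /odd_rank card_predE.
have LoE : (\sum_k oddz (mdeg L k) = Ce * Do + Co * De)%N.
  by rewrite -odd_rank_tensor /odd_rank card_predE dL.
pose J := (\sum_k dual_sign (based M) (based M') (cdim C) k)%N.
pose AL := (\sum_k sign_degree (cdim C + cdim D) (mdeg L k))%N.
pose AC := (\sum_x sign_degree (cdim C) (mdeg M x))%N.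
pose AD := (\sum_y sign_degree (cdim D) (mdeg M' y))%N.
have signE : odd (J + AL) = odd (N' * AC + N * AD).
  have JE : J = (\sum_x \sum_y (oddz ((cdim C)%:Z - mdeg M x) && oddz (mdeg M' y)))%N.
    exact: (sum_pair_of (fun x y => oddz ((cdim C)%:Z - mdeg M x) && oddz (mdeg M' y))).
  have ALE : AL = (\sum_x \sum_y sign_degree (cdim C + cdim D) (mdeg M x + mdeg M' y))%N.
    rewrite /AL dL.
    exact: (sum_pair_of (fun x y => sign_degree (cdim C + cdim D) (mdeg M x + mdeg M' y))).
  rewrite JE ALE; apply: (sign_count _ _ _ sDK sDp) => x.
    by have /andP[] := rC x.
  by have /andP[] := rD x.
rewrite CoE DoE LoE -/J -/AL -/AC -/AD (chi_model M cC) (chi_model M' cD) -/Ce -/Co -/De -/Do.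
have mulz (V : zmodType) (x : V) (a b : nat) : x *~ (a%:Z - b%:Z) = x *+ a - x *+ b.
  by rewrite mulrzBr -!pmulrn.
rewrite !K1_mapD !K1_map_torsionN1 !mulz !mulrnDl -!mulrnA !opprD !torsionN1_muln_opp.
rewrite -[torsion _]/(@torsionN1 (tensor_ring R R')).
set t := torsionN1; set U := K1_map _ u; set V := K1_map _ v.
(* With [N = Ce + Co] and [N' = De + Do], the multiples of [t] agree modulo 2. *)
have key : t *+ (N * Do + N' * Co + (Ce * Do + Co * De)) + t *+ J + t *+ (Ce * Do + Co * De + AL) =
    t *+ ((Co + AC) * De) + t *+ ((Co + AC) * Do) + (t *+ ((Do + AD) * Ce) + t *+ ((Do + AD) * Co)).
  rewrite -!mulrnDr; apply: torsionN1_eq.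
  have := even_odd_rank (based M); have := even_odd_rank (based M').
  rewrite -/Ce -/Co -/De -/Do => NE' NE; move: signE; rewrite -NE -NE' !oddD !oddM !oddD.
  move: (odd J) (odd AL) (odd AC) (odd AD) (odd Ce) (odd Co) (odd De) (odd Do).
  by do 8!case.
move: key; move: t U V => t U V key.
transitivity (U *+ De - U *+ Do + (V *+ Ce - V *+ Co) +
  (t *+ (N * Do + N' * Co + (Ce * Do + Co * De)) + t *+ J + t *+ (Ce * Do + Co * De + AL))).
  by zmodule.
by rewrite key; zmodule.
Qed.
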